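(* Let $X$ be a toric hyper-Kähler manifold and $X^{!}$ its dual toric hyper-Kähler manifold, with elliptic bar involutions $\beta^{ell}_X$, $\beta^{ell}_{X^!}$, as in the context. For $\lambda\in\mathbb{Z}^n$ put $$\Theta_{X}(\lambda)=(q;q)_{\infty}^{-r}\sum_{\beta\in\mathbb{X}_{*}(S)}(-1)^{(\kappa,\beta)}q^{\frac12(\beta,\beta)+(\lambda+\frac12\kappa,\beta)}\mathcal{L}(\lambda+\beta)z^{\beta},$$ $$\Theta_{X^!}(\lambda)=(q;q)_{\infty}^{-d}\sum_{\alpha\in\mathbb{X}^{*}(H)}(-1)^{(\kappa,\alpha)}q^{\frac12(\alpha,\alpha)+(\lambda+\frac12\kappa,\alpha)}\mathcal{L}^{!}(\lambda+\alpha)a^{\alpha}.$$ Then $\beta^{ell}_{X}(\Theta_{X}(\lambda))=\Theta_{X}(\lambda)$ and $\beta^{ell}_{X^{!}}(\Theta_{X^{!}}(\lambda))=\Theta_{X^{!}}(\lambda)$ for every $\lambda\in\mathbb{Z}^n$. Moreover, for every $I\in\mathbb{B}$, up to a sign $\pm$ (depending on $I$), $$\pm\mathfrak{S}_{X}(p_I)=\sum_{\lambda\in\Xi}(-1)^{(\lambda,\kappa)}q^{\frac{1}{2}(\lambda,\lambda+\kappa)}\,i^{*}_{p_I^{!}}\Theta_{X^{!}}(\lambda)\cdot\Theta_{X}(\lambda),$$ where $\Xi=\mathbb{Z}^n/(\mathbb{X}_{*}(S)+\mathbb{X}^{*}(H))$ and the sum is over arbitrary lifts to $\mathbb{Z}^n$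 of the elements of $\Xi$ (each term is independent of the lift).
   Context: Toric hyper-Kähler data. Fix $n\ge1$, $T=(\mathbb{C}^\times)^n$ and an exact sequence of algebraic tori $1\to S\to T\to H\to1$, $S\cong(\mathbb{C}^\times)^r$, $H\cong(\mathbb{C}^\times)^d$, $r+d=n$. $\mathbb{X}_*(\cdot)$, $\mathbb{X}^*(\cdot)$ are cocharacter and character lattices; $\varepsilon_1,\dots,\varepsilon_n$ is the standard basis of $\mathbb{X}_*(T)=\mathbb{Z}^n$ and $\varepsilon_i^*$ the dual basis of $\mathbb{X}^*(T)$. Let $\mathfrak{a}:\mathbb{X}_*(T)\to\mathbb{X}_*(H)$, $\mathfrak{b}:\mathbb{X}^*(T)\to\mathbb{X}^*(S)$ be the induced surjections, $\mathfrak{a}_i=\mathfrak{a}(\varepsilon_i)$, $\mathfrak{b}_i=\mathfrak{b}(\varepsilon_i^* )$; assume all $\mathfrak{a}_i\neq0$, $\mathfrak{b}_i\ne0$, and unimodularity: any $d$ linearly independent $\mathfrak{a}_i$'s generate $\mathbb{X}_*(H)$ over $\mathbb{Z}$. So $\mathbb{X}_*(S)=\mathrm{Ker}\,\mathfrak{a}$, $\mathbb{X}^*(H)=\mathrm{Ker}\,\mathfrak{b}$. $\mathbb{B}$ is the set of $I\subset\{1,\dots,n\}$ such that $\{\mathfrak{a}_i\}_{i\in I}$ is a basis of $\mathbb{X}_*(H)$. A signed circuit is $C=C_+\sqcup C_-$ with $\{\mathfrak{a}_i\}_{i\in C}$ minimal linearly dependent and $\sum_{C_+}\mathfrak{a}_i=\sum_{C_-}\mathfrak{a}_i$;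 $\beta_C=\sum_{C_+}\varepsilon_i-\sum_{C_-}\varepsilon_i\in\mathbb{X}_*(S)$. Signed cocircuits $C^\vee$ and $\alpha_{C^\vee}\in\mathbb{X}^*(H)$ are defined likewise with $\mathfrak{b}_i,\varepsilon_i^*$. For $I\in\mathbb{B}$, $j\in I^c$: $\beta^I_j=\beta_C$ for the unique signed circuit $C\subset I\cup\{j\}$ with $j\in C_+$; for $i\in I$: $\alpha^I_i=\alpha_{C^\vee}$ for the unique signed cocircuit $C^\vee\subset I^c\cup\{i\}$ with $i\in C^\vee_+$. Fix $\eta\in\mathbb{X}^*(S)$ and $\xi\in\mathbb{X}_*(H)$ with $\langle\eta,\beta_C\rangle\ne0$, $\langle\xi,\alpha_{C^\vee}\rangle\neq0$ for all $C,C^\vee$. Put $I_\pm=\{i\in I:\pm\langle\xi,\alpha^I_i\rangle>0\}$, $I^c_\pm=\{j\in I^c:\pm\langle\eta,\beta^I_j\rangle>0\}$. $X=\mu^{-1}(0)^{\eta\text{-ss}}/S$ is the Hamiltonian reduction of $T^*\mathbb{C}^n$ (moment map $\mu(x,y)=\sum x_iy_i\mathfrak{b}_i$), with residual action of $H$ and action of $\mathbb{S}=\mathbb{C}^\times$ by $\sigma(x,y)=(\sigma^{-1}x,\sigma^{-1}y)$; $\dim X=2d$. Its $H$-fixed points are $p_I$, $I\in\mathbb{B}$. $\mathcal{L}(\lambda)$ is the $H\times\mathbb{S}$-equivariant line bundle on $X$ induced from $\lambda\in\mathbb{X}^*(T)$ (trivial $\mathbb{S}$-action). The chamber $\mathfrak{C}$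 is the one containing $\xi$. Dual. Identify $\mathbb{X}^*(T)\cong\mathbb{Z}^n\cong\mathbb{X}_*(T)$ by the standard inner product $(-,-)$, so $\mathbb{X}_*(S)$ and $\mathbb{X}^*(H)$ are orthogonal sublattices of $\mathbb{Z}^n$; $\kappa=(1,\dots,1)$. $X^!$ is the toric hyper-Kähler manifold of the dual sequence $1\to H^\vee\to T^\vee\to S^\vee\to1$ with GIT parameter $\xi$ and chamber containing $\eta$; $p_I^!$ is its fixed point corresponding to $I^c$, and $\mathcal{L}^!(\lambda)$, $\lambda\in\mathbb{Z}^n$, its tautological line bundles; $\dim X^!=2r$. Equivariant parameters of $X$ are $a^\alpha$ ($\alpha\in\mathbb{X}^*(H)$) and $v$ (natural character of $\mathbb{S}$), Kähler parameters are $z^\beta$ ($\beta\in\mathbb{X}_*(S)$); for $X^!$ the roles of $a$ and $z$ are exchanged. Restrictions: $i_{p_I}^*\mathcal{L}(\lambda)=v^{\sum_{j\in I^c_+}(\lambda,\beta^I_j)-\sum_{j\in I^c_-}(\lambda,\beta^I_j)}a^{\lambda-\sum_{j\in I^c}(\lambda,\beta_j^I)\varepsilon_j}$, $i_{p^!_I}^*\mathcal{L}^!(\lambda)=v^{\sum_{i\in I_+}(\lambda,\alpha^I_i)-\sum_{i\in I_-}(\lambda,\alpha^I_i)}z^{\lambda-\sum_{i\in I}(\lambda,\alpha_i^I)\varepsilon_i}$. Elliptic objects. Fix $q\in\mathbb{C}$, $0<|q|<1$, $(q;q)_\infty=\prod_{m\ge1}(1-q^m)$, $\vartheta(x)=(x^{1/2}-x^{-1/2})\prod_{m\ge1}(1-q^mx)(1-q^mx^{-1})$.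 $\mathcal{M}$ is the field of single-valued meromorphic functions on the complex torus with coordinate functions $a^\alpha,z^\beta,v$, and $f\mapsto\bar f$ is induced by $v\mapsto v^{-1}$. $\mathbf{K}(X)_{\mathrm{loc}}=\bigoplus_{I\in\mathbb{B}}\mathcal{M}$; classes built from the $\mathcal{L}(\lambda)$ and the parameters are viewed in it through their restrictions $i_{p_I}^*$. For the polarization $T^{1/2}=\sum_iv^{-1}\mathcal{L}(\varepsilon_i^* )-r\mathcal{O}_X$, the Aganagic–Okounkov elliptic stable basis is (known explicit formula) $$\mathrm{Stab}^{AO}(p_I)=\prod_{i\in I_+}\vartheta(v^{-1}\mathcal{L}(-\varepsilon_i^* ))\prod_{i\in I_-}\vartheta(v^{-1}\mathcal{L}(\varepsilon_i^* ))\prod_{j\in I^c_+}\frac{\vartheta(v^{l_j-1}z^{\beta^I_j}\mathcal{L}(\varepsilon_j^* ))}{\vartheta(v^{l_j}z^{\beta^I_j})}\prod_{j\in I^c_-}\frac{\vartheta(v^{-l_j-1}z^{-\beta^I_j}\mathcal{L}(-\varepsilon_j^* ))}{\vartheta(v^{-l_j}z^{-\beta^I_j})},$$ $l_j=-\langle\beta^I_j,\kappa+\sum_{i\in I_+}\mathfrak{b}_i-\sum_{i\in I_-}\mathfrak{b}_i\rangle\pm1$ for $j\in I^c_\pm$. The elliptic standard basis is $\mathrm{Stab}^{ell}_X(p_I)=\vartheta(N^!_{p^!_I,-})\cdot\tau^*\mathrm{Stab}^{AO}(p_I)$, where $\tau^*$ is the substitution $z^\beta\mapsto v^{(\kappa,\beta)}z^\beta$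 and $\vartheta(N^!_{p^!_I,-})=\prod_{j\in I^c_+}\vartheta(v^{-1}i^*_{p_I^!}\mathcal{L}^!(-\varepsilon_j))\prod_{j\in I^c_-}\vartheta(v^{-1}i^*_{p_I^!}\mathcal{L}^!(\varepsilon_j))$ (product of $\vartheta$ over the weights of the repelling part of $T_{p_I^!}X^!$). Put $\mathfrak{S}_X(p_I)=\sqrt{\mathcal{L}(\kappa)\cdot i^*_{p_I^!}\mathcal{L}^!(\kappa)}^{\,-1}\mathrm{Stab}^{ell}_X(p_I)\in\mathbf{K}(X)_{\mathrm{loc}}$ (all half-integral powers cancel). These form an $\mathcal{M}$-basis. $-X$ denotes $X$ with $\xi$ replaced by $-\xi$ (so $I_+$ and $I_-$ are exchanged, also in the formula for $\mathcal{L}^!$). $\beta^{ell}_X:\mathbf{K}(X)_{\mathrm{loc}}\to\mathbf{K}(X)_{\mathrm{loc}}$ is the additive map with $\beta^{ell}_X(fm)=\bar f\beta^{ell}_X(m)$ ($f\in\mathcal{M}$) and $\beta^{ell}_X(\mathfrak{S}_X(p_I))=(-1)^d\mathfrak{S}_{-X}(p_I)$ for all $I$. $\beta^{ell}_{X^!}$ is defined in the same way for $X^!$, exchanging $(\xi,\eta)$, $(I,I^c)$, $(d,r)$, $(a,z)$, $(\mathfrak{a},\mathfrak{b})$. *)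

(* Defs.v *)
From HB Require Import structures.
From mathcomp Require Import all_boot all_order all_algebra.
From mathcomp Require Import complex ring_quotient.
From mathcomp Require Import all_classical all_reals all_analysis.
From mathcomp.analysis.showcase Require summability.
Set Implicit Arguments.
Unset Strict Implicit.
Unset Printing Implicit Defensive.
Import Order.TTheory GRing.Theory Num.Theory.
Import numFieldNormedType.Exports.
Local Open Scope ring_scope.

(* The topology of [R[i]] given by its norm; [differentiable] on [R[i]]-normed
   modules then means complex (Frechet) differentiability. *)
HB.instance Definition _ (R : realType) :=
  PseudoPointedMetric.copy (complex R) (complex R)^o.
HB.instance Definition _ (R : realType) :=
  NormedModule.copy (complex R) (complex R)^o.

Lemma open_neq0 (R : realType) : open [set c : R[i] | c != 0]%classic.
Proof.
have -> : [set c : R[i] | c != 0]%classic = (~` [set 0])%classic.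
  by apply/seteqP; split => c /=; [move=> /eqP | move=> ?; apply/eqP].
rewrite openC; apply: accessible_closed_set1; apply: hausdorff_accessible.
exact: norm_hausdorff.
Qed.

Section Meromorphic.
Variables (R : realType) (d r : nat).
Local Notation C := R[i].

(* Points are triples (a, z, v) of coordinates. *)
Local Notation tpoint := ('rV[C]_d * 'rV[C]_r * C)%type.

Definition torus : set tpoint :=
  [set x : tpoint | (forall k, x.1.1 0 k != 0) /\ (forall k, x.1.2 0 k != 0)
           /\ x.2 != 0]%classic.

Definition holomorphic_on (W : set tpoint) (f : tpoint -> C) : Prop :=
  forall x, W x -> differentiable f x.

(* A meromorphic function on the torus is represented by a total function, of
   which only the values on the torus matter; its values at the zeros of a
   local denominator [h] are arbitrary. *)
Definition meromorphic (f : tpoint -> C) : Prop :=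
  forall x, torus x -> exists (W : set tpoint) (g h : tpoint -> C),
    [/\ open W, W x, holomorphic_on W g /\ holomorphic_on W h,
        (W `<=` closure [set y | W y /\ h y != 0])%classic
      & forall y, W y -> h y != 0 -> f y = g y / h y].

Definition generically_zero (f : tpoint -> C) : Prop :=
  exists D : set tpoint,
    [/\ open D, (D `<=` torus)%classic, (torus `<=` closure D)%classic
      & forall y, D y -> f y = 0].

Definition mero : {pred tpoint -> C} := fun f => `[< meromorphic f >].

Let mul_denominators (W1 W2 : set tpoint) (h1 h2 : tpoint -> C) :
  open W1 -> open W2 -> holomorphic_on W1 h1 ->
  (W1 `<=` closure [set y | W1 y /\ h1 y != 0])%classic ->
  (W2 `<=` closure [set y | W2 y /\ h2 y != 0])%classic ->
  (W1 `&` W2 `<=`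
     closure [set y | (W1 `&` W2) y /\ (h1 * h2) y != 0])%classic.
Proof.
move=> o1 o2 hol d1 d2 y [y1 y2] B By.
have W2y : nbhs y (W2 : set tpoint) by exact: open_nbhs_nbhs.
have [z [[z1 hz] [Bz z2]]] := d1 y y1 _ (filterI By W2y).
have : nbhs y (B `&` (W1 `&` W2))%classic.
  by apply: filterI => //; apply: filterI => //; exact: open_nbhs_nbhs.
rewrite nbhsE => -[V [oV Vy] VB].
have [u [[u1 hu] Vu]] := d1 y y1 V (open_nbhs_nbhs (conj oV Vy)).
have Vu' : nbhs u (V `&` [set t | h1 t != 0])%classic.
  apply: filterI; first exact: (open_nbhs_nbhs (conj oV Vu)).
  have := differentiable_continuous (hol u u1).
  move=> /(_ [set c | c != 0]%classic); apply.
  exact: open_nbhs_nbhs (conj (@open_neq0 R) hu).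
have [_ [_ u2]] := VB _ Vu.
have [t [[t2 ht] [Vt ht1]]] := d2 u u2 _ Vu'.
have [Bt [t1 _]] := VB _ Vt.
by exists t; split => //; split => //; rewrite mulf_neq0.
Qed.


Lemma torus_open : open torus.
Proof.
have FF (x : tpoint) : Filter (nbhs x) by exact: nbhs_filter.
rewrite openE => x [xa [xz xv]]; rewrite /interior /=.
pose ca k (y : tpoint) := y.1.1 0 k; pose cz k (y : tpoint) := y.1.2 0 k.
have ca_cvg k : (ca k @ nbhs x --> ca k x)%classic.
  apply: (@cvg_comp _ _ _ (fun y : tpoint => y.1.1) (fun m : 'rV[C]_d => m 0 k)).
    by apply: cvg_comp; [exact: cvg_fst | exact: cvg_fst].
  exact: coord_continuous.
have cz_cvg k : (cz k @ nbhs x --> cz k x)%classic.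
  apply: (@cvg_comp _ _ _ (fun y : tpoint => y.1.2) (fun m : 'rV[C]_r => m 0 k)).
    by apply: cvg_comp; [exact: cvg_fst | exact: cvg_snd].
  exact: coord_continuous.
have cv_cvg : ((fun y : tpoint => y.2) @ nbhs x --> x.2)%classic by exact: cvg_snd.
have Ha : nbhs x [set y : tpoint | forall k, ca k y != 0]%classic.
  have := @filter_forall _ _ (fun k => [set y | ca k y != 0]%classic) (nbhs x) (FF x).
  by apply => k; exact: (cvgr_neq0 _ (ca_cvg k) (xa k)).
have Hz : nbhs x [set y : tpoint | forall k, cz k y != 0]%classic.
  have := @filter_forall _ _ (fun k => [set y | cz k y != 0]%classic) (nbhs x) (FF x).
  by apply => k; exact: (cvgr_neq0 _ (cz_cvg k) (xz k)).
have Hv : nbhs x [set y : tpoint | y.2 != 0]%classic by exact: (cvgr_neq0 _ cv_cvg xv).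
apply: (@filterS _ (nbhs x) (FF x) _ _ _ (filterI Ha (filterI Hz Hv))).
move=> y [ya [yz yv]].
by split; [exact: ya | split; [exact: yz | exact: yv]].
Qed.

Lemma meromorphic_sub f g : meromorphic f -> meromorphic g -> meromorphic (f - g).
Proof.
move=> mf mg x Tx.
have [W1 [g1 [h1 [op1 x1 [hg1 hh1] d1 e1]]]] := mf x Tx.
have [W2 [g2 [h2 [op2 x2 [hg2 hh2] d2 e2]]]] := mg x Tx.
exists (W1 `&` W2)%classic, (g1 * h2 - g2 * h1), (h1 * h2); split.
- exact: openI.
- by [].
- split=> y [y1 y2]; last exact: differentiableM (hh1 y y1) (hh2 y y2).
  exact: differentiableB (differentiableM (hg1 y y1) (hh2 y y2))
                         (differentiableM (hg2 y y2) (hh1 y y1)).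
- exact: mul_denominators.
move=> y [y1 y2]; rewrite mulf_eq0 negb_or => /andP[n1 n2].
have -> : (f - g) y = f y - g y by [].
rewrite (e1 y y1 n1) (e2 y y2 n2).
have -> : (g1 * h2 - g2 * h1) y = g1 y * h2 y - g2 y * h1 y by [].
have -> : (h1 * h2) y = h1 y * h2 y by [].
by rewrite -mulNr addf_div// mulNr.
Qed.

Lemma meromorphic_mul f g : meromorphic f -> meromorphic g -> meromorphic (f * g).
Proof.
move=> mf mg x Tx.
have [W1 [g1 [h1 [op1 x1 [hg1 hh1] d1 e1]]]] := mf x Tx.
have [W2 [g2 [h2 [op2 x2 [hg2 hh2] d2 e2]]]] := mg x Tx.
exists (W1 `&` W2)%classic, (g1 * g2), (h1 * h2); split.
- exact: openI.
- by [].
- split=> y [y1 y2]; first exact: differentiableM (hg1 y y1) (hg2 y y2).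
  exact: differentiableM (hh1 y y1) (hh2 y y2).
- exact: mul_denominators.
move=> y [y1 y2]; rewrite mulf_eq0 negb_or => /andP[n1 n2].
have -> : (f * g) y = f y * g y by [].
by rewrite (e1 y y1 n1) (e2 y y2 n2) mulf_div.
Qed.

Lemma meromorphic_one : meromorphic 1.
Proof.
move=> x Tx; exists setT, 1, 1; split.
- exact: openT.
- by [].
- by split=> y _; exact: differentiable_cst.
- by move=> y _; apply: subset_closure; split => //; exact: oner_neq0.
- by move=> y _ _; rewrite divr1.
Qed.

Fact mero_subring : subring_closed mero.
Proof.
split=> [|f g|f g].
- exact/asboolP/meromorphic_one.
- by move=> /asboolP mf /asboolP mg; exact/asboolP/meromorphic_sub.
- by move=> /asboolP mf /asboolP mg; exact/asboolP/meromorphic_mul.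
Qed.
HB.instance Definition _ :=
  GRing.isSubringClosed.Build (tpoint -> C) mero mero_subring.

Record mero_fun := MeroFun { mero_val :> tpoint -> C; _ : mero_val \in mero }.
HB.instance Definition _ := [isSub for mero_val].
HB.instance Definition _ := [Choice of mero_fun by <:].
HB.instance Definition _ := [SubChoice_isSubComNzRing of mero_fun by <:].

Definition null_mero : {pred mero_fun} := fun f => `[< generically_zero f >].

Fact null_mero_ideal : idealr_closed null_mero.
Proof.
split.
- apply/asboolP; exists torus; split => //; first exact: torus_open.
  exact: subset_closure.
- apply/asboolP => -[D [oD sD dD z]].
  have T1 : torus (const_mx 1, const_mx 1, 1).
    by split; [|split] => [k|k|] /=; rewrite ?mxE oner_neq0.
  have [y [Dy _]] := dD _ T1 setT (filterT).
  by have /eqP := z y Dy; rewrite oner_eq0.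
- move=> f g h /asboolP[D [oD sD dD z]] /asboolP[E [oE sE dE w]].
  apply/asboolP; exists (D `&` E)%classic; split; first exact: openI.
  + by move=> x [/sD].
  + move=> x Tx B.
    rewrite nbhsE => -[V [oV Vx] VB].
    have [y [Dy Vy]] := dD x Tx V (open_nbhs_nbhs (conj oV Vx)).
    have yVD : nbhs y (V `&` D)%classic by apply: open_nbhs_nbhs; split => //; exact: openI.
    have [t [Et [Vt Dt]]] := dE y (sD _ Dy) _ yVD.
    by exists t; split => //; exact: (VB _ Vt).
  + move=> y [Dy Ey].
    have -> : (f * g + h : mero_fun) y = f y * g y + h y by [].
    by rewrite z// w// mulr0 addr0.
Qed.

HB.instance Definition _ := isIdealr.Build mero_fun null_mero null_mero_ideal.

(* Meromorphic functions on the torus, identified when they agree on a dense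
   open subset. *)
Definition merofield : comNzRingType := {ideal_quot null_mero}.

(* The class of [f], with value 0 when [f] is not meromorphic. *)
Definition mclass (f : tpoint -> C) : merofield :=
  \pi_({ideal_quot null_mero})%qT (insubd (0 : mero_fun) f).

Definition bar (m : merofield) : merofield :=
  mclass (fun x : tpoint => (repr m : mero_fun) (x.1, x.2^-1)).

(* Coordinatewise square roots, with a fixed branch. *)
Definition sqrt_point (x : tpoint) : tpoint :=
  (map_mx sqrtC x.1.1, map_mx sqrtC x.1.2, sqrtC x.2).

End Meromorphic.

Notation tpoint R d r := ('rV[R[i]]_d * 'rV[R[i]]_r * R[i])%type.

Section Vectors.
Variables (n m : nat) (a : 'M[int]_(n, m)).

Definition eps (i : 'I_n) : 'rV[int]_n := delta_mx 0 i.

Definition kappa : 'rV[int]_n := const_mx 1.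

Definition dot k (x y : 'rV[int]_k) : int := \sum_i x 0 i * y 0 i.

Definition independent (I : {set 'I_n}) : Prop :=
  forall c : 'I_n -> int, \sum_(i in I) c i *: row i a = 0 ->
  forall i, i \in I -> c i = 0.

Definition generating (I : {set 'I_n}) : Prop :=
  forall y : 'rV[int]_m, exists c : 'I_n -> int, y = \sum_(i in I) c i *: row i a.

Definition bases : {pred {set 'I_n}} :=
  fun I => `[< independent I /\ generating I >].

(* A signed circuit is the pair (C_+, C_-). *)
Definition signed_circuit (C : {set 'I_n} * {set 'I_n}) : Prop :=
  [/\ [disjoint C.1 & C.2], ~ independent (C.1 :|: C.2),
      forall J : {set 'I_n}, J \proper C.1 :|: C.2 -> independent J
    & \sum_(i in C.1) row i a = \sum_(i in C.2) row i a].

Definition circuit_vector (C : {set 'I_n} * {set 'I_n}) : 'rV[int]_n :=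
  \sum_(i in C.1) eps i - \sum_(i in C.2) eps i.

(* beta^I_j; the default value is irrelevant for a basis I and j outside I. *)
Definition betaI (I : {set 'I_n}) (j : 'I_n) : 'rV[int]_n :=
  circuit_vector (odflt (finset.set0, finset.set0)
    [pick C : {set 'I_n} * {set 'I_n} |
      `[< [/\ signed_circuit C, C.1 :|: C.2 \subset j |: I & j \in C.1] >]]).

(* The coordinates of x in the sublattice of Z^n that is the image of the
   injective transpose of a. *)
Definition lattice_coord (x : 'rV[int]_n) : 'rV[int]_m :=
  xget 0 [set u | u *m a^T = x]%classic.

(* The pairing of a functional eta on that sublattice with x. *)
Definition pairing (eta : 'rV[int]_m) (x : 'rV[int]_n) : int := dot eta (lattice_coord x).

End Vectors.

Arguments eps {n}.
Arguments kappa {n}.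

(* In bases of the lattices, the map a : X_*(T) -> X_*(H) is x |-> x *m ta, so
   that row i ta is a_i, and b : X^*(T) -> X^*(S) is x |-> x *m tb.  The dual
   inclusions X^*(H) -> Z^n and X_*(S) -> Z^n are u |-> u *m ta^T and
   w |-> w *m tb^T. *)
Record toric_data (n d r : nat) := ToricData {
  ta : 'M[int]_(n, d);
  tb : 'M[int]_(n, r);
  teta : 'rV[int]_r;
  txi : 'rV[int]_d }.

Definition dual_data n d r (D : toric_data n d r) : toric_data n r d :=
  ToricData (tb D) (ta D) (txi D) (teta D).

Definition opp_xi n d r (D : toric_data n d r) : toric_data n d r :=
  ToricData (ta D) (tb D) (teta D) (- txi D).

Record toric_hyperkahler n d r (D : toric_data n d r) : Prop := {
  hk_n : (0 < n)%N;
  hk_dim : (r + d = n)%N;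
  hk_inj : forall w : 'rV[int]_r, w *m (tb D)^T = 0 -> w = 0;
  hk_exact : forall x : 'rV[int]_n,
    x *m ta D = 0 <-> exists w : 'rV[int]_r, x = w *m (tb D)^T;
  hk_surj : forall y : 'rV[int]_d, exists x : 'rV[int]_n, x *m ta D = y;
  hk_a : forall i, row i (ta D) != 0;
  hk_b : forall i, row i (tb D) != 0;
  hk_unimodular : forall I : {set 'I_n},
    #|I| = d -> independent (ta D) I -> generating (ta D) I;
  hk_eta : forall C, signed_circuit (ta D) C ->
    pairing (tb D) (teta D) (circuit_vector C) != 0;
  hk_xi : forall C, signed_circuit (tb D) C ->
    pairing (ta D) (txi D) (circuit_vector C) != 0 }.

(* A weight (alpha, beta, k) stands for the monomial a^alpha z^beta v^k. *)
Notation weight n := ('rV[int]_n * 'rV[int]_n * int)%type.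

Definition wz n (b : 'rV[int]_n) : weight n := (0, b, 0).
Definition wv n (k : int) : weight n := (0, 0, k).
Arguments wv {n}.

Definition wswap n (w : weight n) : weight n := (w.1.2, w.1.1, w.2).

(* The substitution z^beta |-> v^(kappa, beta) z^beta. *)
Definition tau n (w : weight n) : weight n := (w.1, w.2 + dot kappa w.1.2).

Section Restrictions.
Variables (n d r : nat) (D : toric_data n d r).

(* I^c_+ and I^c_- *)
Definition Icplus (I : {set 'I_n}) : {set 'I_n} :=
  [set j in ~: I | 0 < pairing (tb D) (teta D) (betaI (ta D) I j)]%SET.
Definition Icminus (I : {set 'I_n}) : {set 'I_n} :=
  [set j in ~: I | pairing (tb D) (teta D) (betaI (ta D) I j) < 0]%SET.

(* The weight of the restriction of L(lambda) to p_I. *)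
Definition Lres (I : {set 'I_n}) (lam : 'rV[int]_n) : weight n :=
  (lam - \sum_(j in ~: I) dot lam (betaI (ta D) I j) *: eps j, 0,
   \sum_(j in Icplus I) dot lam (betaI (ta D) I j)
   - \sum_(j in Icminus I) dot lam (betaI (ta D) I j)).

End Restrictions.

Section Elliptic.
Variables (R : realType) (q : R[i]).
Local Notation C := R[i].

Definition qpoch : C :=
  limn (fun N : nat => \prod_(1 <= m < N.+1) (1 - q ^+ m)).

(* theta(x) as a function of s = x^(1/2). *)
Definition theta (s : C) : C :=
  (s - s^-1) *
  limn (fun N : nat => \prod_(1 <= m < N.+1)
                        ((1 - q ^+ m * s ^+ 2) * (1 - q ^+ m * s ^- 2))).

Section Values.
Variables (n d r : nat) (D : toric_data n d r).

(* I_+ and I_- *)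
Definition Iplus (I : {set 'I_n}) : {set 'I_n} := Icplus (dual_data D) (~: I).
Definition Iminus (I : {set 'I_n}) : {set 'I_n} := Icminus (dual_data D) (~: I).

(* The weight of the restriction of L^!(lambda) to p^!_I. *)
Definition Ldres (I : {set 'I_n}) (lam : 'rV[int]_n) : weight n :=
  wswap (Lres (dual_data D) (~: I) lam).

Definition ell (I : {set 'I_n}) (j : 'I_n) : int :=
  - pairing (tb D)
      (kappa *m tb D + \sum_(i in Iplus I) row i (tb D)
                     - \sum_(i in Iminus I) row i (tb D))
      (betaI (ta D) I j)
  + (if j \in Icplus D I then 1 else -1).

(* In the next three definitions [h w] is the value of the square root of the
   monomial of weight [w]; [I] labels the class and [J] the fixed point to
   which it is restricted. *)
Definition stabAO (I J : {set 'I_n}) (h : weight n -> C) : C :=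
  (\prod_(i in Iplus I) theta (h (wv (-1) + Lres D J (- eps i)))) *
  (\prod_(i in Iminus I) theta (h (wv (-1) + Lres D J (eps i)))) *
  (\prod_(j in Icplus D I)
     (theta (h (wv (ell I j - 1) + wz (betaI (ta D) I j) + Lres D J (eps j)))
      / theta (h (wv (ell I j) + wz (betaI (ta D) I j))))) *
  (\prod_(j in Icminus D I)
     (theta (h (wv (- ell I j - 1) + wz (- betaI (ta D) I j)
                + Lres D J (- eps j)))
      / theta (h (wv (- ell I j) + wz (- betaI (ta D) I j))))).

Definition stab_ell (I J : {set 'I_n}) (h : weight n -> C) : C :=
  (\prod_(j in Icplus D I) theta (h (wv (-1) + Ldres I (- eps j)))) *
  (\prod_(j in Icminus D I) theta (h (wv (-1) + Ldres I (eps j)))) *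
  stabAO I J (fun w => h (tau w)).

Definition frakS (I J : {set 'I_n}) (h : weight n -> C) : C :=
  (h (Lres D J kappa + Ldres I kappa))^-1 * stab_ell I J h.

(* The restriction to p_J of Theta(lambda), where [h w] is the value of the
   monomial of weight [w].  The scalar product (b, b + kappa) is always even. *)
Definition Theta_val (lam : 'rV[int]_n) (J : {set 'I_n}) (h : weight n -> C) : C :=
  qpoch ^- r *
  summability.sum (fun b : {b : 'rV[int]_n | b *m ta D == 0} =>
    (-1) ^ dot kappa (val b)
    * q ^ ((dot (val b) (val b + kappa) %/ 2)%Z + dot lam (val b))
    * h (Lres D J (lam + val b) + wz (val b)) : C).

End Values.

Section Classes.
Variables (d r : nat).
Local Notation M := (merofield R d r).

(* X and its dual share the torus of parameters (a, z, v) and the field M; the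
   evaluation [e] of weights tells which coordinates are the equivariant and
   which the Kaehler ones. *)
Variables (n d' r' : nat) (D : toric_data n d' r').
Variable e : tpoint R d r -> weight n -> C.

Definition Kloc (a : 'M[int]_(n, d')) : zmodType :=
  {ffun {I : {set 'I_n} | I \in bases a} -> M}.

Definition Kscale (a : 'M[int]_(n, d')) (f : M) (m : Kloc a) : Kloc a :=
  [ffun J => f * m J].

(* The half-integral powers cancel, so the choice of square roots is
   immaterial. *)
Definition frakS_class (D' : toric_data n d' r') (I : {set 'I_n}) :
    Kloc (ta D') :=
  [ffun J => mclass (fun x => frakS D' I (val J) (e (sqrt_point x)))].

Definition Theta_res (lam : 'rV[int]_n) (J : {set 'I_n}) : M :=
  mclass (fun x => Theta_val D lam J (e x)).

Definition Theta_class (lam : 'rV[int]_n) : Kloc (ta D) :=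
  [ffun J => Theta_res lam (val J)].

Definition elliptic_bar (f : Kloc (ta D) -> Kloc (ta D)) : Prop :=
  [/\ forall m m', f (m + m') = f m + f m',
      forall c m, f (Kscale c m) = Kscale (bar c) (f m)
    & forall I, I \in bases (ta D) ->
        f (frakS_class D I) = Kscale ((-1) ^+ d') (frakS_class (opp_xi D) I)].

End Classes.

Section Duality.
Variables (n d r : nat) (D : toric_data n d r).

Definition evalX (x : tpoint R d r) (w : weight n) : C :=
  (\prod_k x.1.1 0 k ^ lattice_coord (ta D) w.1.1 0 k) *
  (\prod_k x.1.2 0 k ^ lattice_coord (tb D) w.1.2 0 k) * x.2 ^ w.2.

Definition evalXdual (x : tpoint R d r) (w : weight n) : C := evalX x (wswap w).

(* Congruence modulo X_*(S) + X^*(H). *)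
Definition Xi_equiv (lam mu : 'rV[int]_n) : Prop :=
  exists b al : 'rV[int]_n,
    [/\ b *m ta D = 0, al *m tb D = 0 & mu = lam + (b + al)].

(* s lists exactly one lift of each class in Xi. *)
Definition Xi_lifts (s : seq 'rV[int]_n) : Prop :=
  forall mu, count (fun lam => `[< Xi_equiv lam mu >]) s = 1%N.

(* The term of the expansion of S_X(p_I) indexed by lambda; dot lam (lam + kappa)
   is always even. *)
Definition S_term (I : {set 'I_n}) (lam : 'rV[int]_n) : Kloc d r (ta D) :=
  Kscale (mclass (fun _ => (-1) ^ dot lam kappa
                           * q ^ (dot lam (lam + kappa) %/ 2)%Z)
          * Theta_res (dual_data D) evalXdual lam (~: I))
         (Theta_class D evalX lam).

End Duality.
End Elliptic.

Arguments elliptic_bar [R] q [d r n d' r'] D e f.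

(* Main.v *)
Require Import Defs.
From HB Require Import structures.
From mathcomp Require Import fingroup perm.
From mathcomp Require Import all_boot all_order all_algebra.
From mathcomp Require Import complex ring_quotient finmap.
From mathcomp Require Import all_classical all_reals all_analysis.
From mathcomp.analysis.showcase Require summability.
From mathcomp Require Import ring lra zify.
Set Implicit Arguments.
Unset Strict Implicit.
Unset Printing Implicit Defensive.
Import Order.TTheory GRing.Theory Num.Theory.
Import numFieldNormedType.Exports.
Local Open Scope ring_scope.

Import ComplexField.Normc.

(** Write [cross_wt D I J k] for the weight of the restriction of L(eps_k) to
    p_J times the restriction of L^!(eps_k) to p_I^!, and [thetaF y] for
    theta(y) without its factor y^(1/2). The proof turns on one product
    formula. The shifts l_j of the stable envelope are such that, after the
    substitution z^beta -> v^(kappa,beta) z^beta, the numerators of S_X(p_I)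
    at p_J become the theta functions of these n weights, up to signs and
    inversion of arguments, while the denominators cancel against the theta
    functions of the repelling weights at p_I^!. So S_X(p_I) at p_J is, up to
    a sign that depends on I only, the product over k = 1, ..., n of [thetaF]
    at these weights ([frakS_fac], [frakS_mclass]); this product is symmetric
    under the duality of X and X^!.

    By the Jacobi triple product ([jacobi_triple]) each factor is a series
    over Z, hence the product is a series over Z^n. Group Z^n into the cosets
    of X_*(S) + X^*(H) and write the elements of a coset as lam + beta +
    alpha. Since (alpha, beta) = 0, the quadratic exponent splits, and the
    coset contributes the product of Theta_{X^!}(lam) at p_I^! and
    Theta_X(lam) at p_J ([coset_asum]). This is the expansion of S_X(p_I)
    ([expansion_point], [expansion_mclass]), and it also shows that a term
    depends on the coset only ([term_inv]).

    For the bar involution, read the expansion as a matrix identity S = P T: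
    the rows of T are the classes Theta_X(lam), and P consists of the values
    of Theta_{X^!}. The matrix S is triangular for the order of the bases by
    the value of xi at the vertices of an affine arrangement ([potential_lt]),
    because some factor is theta(1) = 0 otherwise; its diagonal entries are
    theta functions of nontrivial monomials. So S is invertible ([Smat_inv]).
    There are as many cosets as bases: both numbers are the determinant of the
    Gram matrix a^T a, the first by the Smith normal form, the second by the
    Cauchy-Binet formula and unimodularity ([Xi_lifts_ex]). Hence P and T are
    square and T is invertible as well. The antilinear map that fixes the rows
    of T sends row I of S = P T to row I of bar(P) T. The chamber of xi enters
    L^! only through the sign of the exponents of v, so that bar(P) is the
    matrix P of -X, and bar(P) T is the matrix S of -X; comparing the two
    signs gives (-1)^|I| = (-1)^d. This is the bar involution ([bar_ex]). It
    is unique because the S_X(p_I) form a basis, so the maps obtained from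
    different sets of lifts coincide, and all the Theta_X(lam) are fixed
    ([bar_involution]).

    Two analytic facts make the classes meaningful. A series of monomials with
    Gaussian coefficients is holomorphic on the torus: it has a first-order
    expansion with a quadratic remainder whose constants are summable
    ([expands_sum], [holo_theta], [holo_Theta]). And the theta function of a
    nontrivial monomial is invertible: near every point the monomial takes
    values that are not powers of q ([mono_generic], [mclassV]). The
    statements about X^! follow from those about X by exchanging a and z; to
    this end everything is proved for any evaluation of the weights satisfying
    [eval_spec]. *)

(** * Complex moduli and absolutely convergent unordered sums *)

Section Norm.
Variable R : realType.
Local Notation C := R[i].
Implicit Types x y z : C.

Lemma norm_normc x : `|x| = (normc x)%:C%C.
Proof. by []. Qed.

Lemma normcD x y : normc (x + y) <= normc x + normc y.
Proof. exact: le_normcD. Qed.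

Lemma normcNE x : normc (- x) = normc x.
Proof. exact: normcN. Qed.

Lemma normc_ge0 x : 0 <= normc x.
Proof. by case: x => a b; exact: sqrtr_ge0. Qed.

Lemma normcB x y : normc (x - y) = normc (y - x).
Proof. by rewrite -normcNE opprB. Qed.

Lemma normc_eq0 x : (normc x == 0) = (x == 0).
Proof. by apply/eqP/eqP => [/eq0_normc //|->]; rewrite normc0. Qed.

Lemma normc_gt0 x : (0 < normc x) = (x != 0).
Proof. by rewrite lt_def normc_ge0 andbT normc_eq0. Qed.

Lemma normcX x n : normc (x ^+ n) = normc x ^+ n.
Proof. by elim: n => [|n IH]; rewrite ?normc1// !exprS normcM IH. Qed.

Lemma normcXz x (m : int) : normc (x ^ m) = normc x ^ m.
Proof. by case: m => n; rewrite ?NegzE -?exprnN ?normcV normcX. Qed.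

Lemma normc_prod (I : Type) (r : seq I) (F : I -> C) :
  normc (\prod_(i <- r) F i) = \prod_(i <- r) normc (F i).
Proof. by elim/big_rec2: _ => [|i u v _ <-]; rewrite ?normc1 ?normcM. Qed.

Lemma normc_sum (I : Type) (r : seq I) (P : pred I) (F : I -> C) :
  normc (\sum_(i <- r | P i) F i) <= \sum_(i <- r | P i) normc (F i).
Proof.
elim/big_rec2: _ => [|i u v _ H]; rewrite ?normc0//.
by apply: le_trans (normcD _ _) _; rewrite lerD2l.
Qed.

Lemma normc_real (a : R) : 0 <= a -> normc a%:C%C = a.
Proof. by move=> a0; rewrite /normc /= expr0n addr0 sqrtr_sqr ger0_norm. Qed.

Lemma normcBD x y z : normc (x - z) <= normc (x - y) + normc (y - z).
Proof. by apply: le_trans (normcD _ _); rewrite addrA subrK. Qed.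

Lemma posC (e : C) : 0 < e -> exists2 r : R, 0 < r & e = r%:C%C.
Proof.
move=> e0; have /complex_realP[r E] : e \is Num.real by rewrite gtr0_real.
by exists r => //; rewrite -ltcR -E.
Qed.

Lemma cvgc_limn (u : nat -> C) (l : C) :
  (forall e : R, 0 < e -> exists N, forall n, (N <= n)%N -> normc (u n - l) < e) ->
  (u n @[n --> \oo] --> l)%classic.
Proof.
move=> H; apply/cvgrPdist_lt => _ /posC[e e0 ->].
have [N HN] := H e e0; exists N => // n /= Nn.
by rewrite norm_normc ltcR normcB HN.
Qed.

Lemma limn_cvgc (u : nat -> C) (l : C) :
  (u n @[n --> \oo] --> l)%classic ->
  (forall e : R, 0 < e -> exists N, forall n, (N <= n)%N -> normc (u n - l) < e).
Proof.
move=> /cvgrPdist_lt H e e0; have /H[N _ HN] : 0 < e%:C%C by rewrite ltcR.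
by exists N => n Nn; have := HN n Nn; rewrite /= norm_normc ltcR normcB.
Qed.

Lemma limnE (u : nat -> C) (l : C) :
  (u n @[n --> \oo] --> l)%classic -> limn u = l.
Proof. by apply: cvg_lim; exact: norm_hausdorff. Qed.

Definition has_sum (T : choiceType) (f : T -> C) (s : C) :=
  forall e : R, 0 < e -> exists A : {fset T}, forall B : {fset T},
    (A `<=` B)%fset -> normc (\sum_(i <- B) f i - s) < e.

Lemma has_sumE (T : choiceType) (f : T -> C) (s : C) :
  has_sum f s -> summability.sum f = s.
Proof.
move=> H; apply: cvg_lim; first exact: norm_hausdorff.
  by exact: summability.totally_filter.
have FF : Filter (@summability.totally T).
  by have := @summability.totally_filter T; case.
apply/(@cvgrPdist_lt _ _ _ _ FF) => _ /posC[e e0 ->].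
have [A HA] := H e e0; exists A => // B /= AB.
rewrite norm_normc ltcR normcB.
have -> : summability.partial_sum f B = \sum_(i <- B) f i.
  by rewrite /summability.partial_sum (big_seq_fsetE _ _ predT).
exact: HA.
Qed.

Lemma has_sum_unique (T : choiceType) (f : T -> C) (s t : C) :
  has_sum f s -> has_sum f t -> s = t.
Proof. by move=> /has_sumE <- /has_sumE <-. Qed.

(** The norm of a complex normed space has its values in [R[i]]; this is the
    same number as an element of [R]. *)
Definition nrm (V : normedModType C) (x : V) : R := complex.Re (`|x| : C).

Lemma nrmE (V : normedModType C) (x : V) : `|x| = (nrm x)%:C%C.
Proof.
have /complex_realP[r E] : (`|x| : C) \is Num.real by rewrite normr_real.
by rewrite /nrm E.
Qed.

Lemma nrm_ge0 (V : normedModType C) (x : V) : 0 <= nrm x.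
Proof. by have := normr_ge0 x; rewrite nrmE lecE /= eqxx. Qed.

Lemma nrm_ltE (V : normedModType C) (x : V) (e : R) :
  (`|x| < e%:C%C) = (nrm x < e).
Proof. by rewrite nrmE ltcR. Qed.

Lemma nbhsC (V : normedModType C) (x : V) (B : set V) :
  nbhs x B <-> exists2 e : R, 0 < e & forall y : V, nrm (y - x : V) < e -> B y.
Proof.
split=> [/nbhs_ballP[_ /posC[e e0 ->]] H|[e e0 H]].
  exists e => // y hy; apply: H.
  by rewrite -ball_normE /= distrC nrm_ltE.
apply/nbhs_ballP; exists e%:C%C; first by rewrite /= ltcR.
by move=> y; rewrite -ball_normE /= distrC nrm_ltE; exact: H.
Qed.

(** An expansion with quadratic remainder is a convenient sufficient condition
    for differentiability, because it involves real constants only. *)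
Lemma differentiable_taylor (V : normedModType C) (x : V) (f : V -> C)
  (L : {linear V -> C}) (K d : R) : 0 < d -> 0 < K ->
  (forall h, normc (L h) <= K * nrm h) ->
  (forall h, nrm h < d -> normc (f (x + h) - f x - L h) <= K * nrm h ^+ 2) ->
  differentiable f x.
Proof.
move=> d0 K0 HL Hf; apply/diffP.
pose F := nbhs_filter_on x.
pose P (df : {linear V -> C}) := continuous df /\ forall y : V,
      f y = f (lim F) + df (y - lim F : V) +o_(y \near F) (y - lim F : V).
suff : P (get P) by [].
apply: getPex.
exists L; split.
  apply: continuousfor0_continuous => /=.
  have L0 : L 0 = 0 by exact: linear0.
  rewrite /prop_for /continuous_at /= L0.
  apply/cvgrPdist_lt => _ /posC[e e0 ->]; apply/nbhsC; exists (e / K).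
    by rewrite divr_gt0.
  move=> y; rewrite subr0 sub0r normrN => hy.
  rewrite norm_normc ltcR; apply: le_lt_trans (HL y) _.
  by rewrite mulrC -ltr_pdivlMr.
have lx : lim F = x by exact: lim_id.
have E : f = (fun y : V => f (lim F) + L (y - lim F : V))
    +o_F (fun y : V => y - lim F : V).
  apply/eqaddoP => _ /posC[e e0 ->]; apply/nbhsC.
  exists (Num.min d (e / K)) => [|y]; first by rewrite lt_min d0 divr_gt0.
  rewrite lt_min => /andP[yd ye].
  have -> : (f - (fun y : V => f (lim F) + L (y - lim F : V))) y
          = f y - (f x + L (y - x)) by rewrite lx.
  rewrite lx -[X in X <= _]/((normc (f y - (f x + L (y - x))))%:C%C).
  rewrite nrmE -rmorphM lecR.
  have := Hf (y - x) yd; rewrite [x + _]addrC subrK opprD addrA => /le_trans; apply.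
  rewrite expr2 mulrA ler_wpM2r ?nrm_ge0// mulrC -ler_pdivlMr//; exact: ltW.
by move: E; rewrite funeqE.
Qed.

Section Sums.
Implicit Types T U : choiceType.

Definition bsum T (g : T -> R) (B : R) :=
  forall A : {fset T}, \sum_(i <- A) g i <= B.

Lemma fsum_le T (g : T -> R) (A B : {fset T}) : (forall i, 0 <= g i) ->
  (A `<=` B)%fset -> \sum_(i <- A) g i <= \sum_(i <- B) g i.
Proof.
move=> g0 AB; rewrite (big_fsetID _ (mem A) B) /=.
have -> : [fset x in B | x \in A]%fset = A.
  by apply/fsetP => x; rewrite !inE /= andb_idl// => /(fsubsetP AB).
by rewrite lerDl sumr_ge0.
Qed.

(** The sum is the supremum of the finite partial sums. *)
Lemma has_sum_nonneg T (g : T -> R) B : (forall i, 0 <= g i) -> bsum g B ->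
  exists s, has_sum (fun i => (g i)%:C%C) s%:C%C.
Proof.
move=> g0 gB.
pose E := [set s | exists A : {fset T}, s = \sum_(i <- A) g i]%classic.
have E0 : (E !=set0)%classic by exists (\sum_(i <- fset0) g i), fset0.
have Eub : has_ubound E by exists B => _ [A ->].
exists (sup E) => e e0.
have [_ [A ->] hA] := sup_adherent e0 (conj E0 Eub).
exists A => D AD; rewrite -rmorph_sum normcB -rmorphB normc_real.
  rewrite ltrBlDr addrC -ltrBlDr; apply: lt_le_trans hA _; exact: fsum_le.
by rewrite subr_ge0; apply: ub_le_sup => //; exists D.
Qed.

Lemma has_sumD T (f g : T -> C) s t : has_sum f s -> has_sum g t ->
  has_sum (fun i => f i + g i) (s + t).
Proof.
move=> hf hg e e0; have e2 : 0 < e / 2 by rewrite divr_gt0.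
have [A HA] := hf _ e2; have [B HB] := hg _ e2.
exists (A `|` B)%fset => D; rewrite fsubUset => /andP[AD BD].
rewrite big_split /= opprD addrACA (splitr e).
by apply: le_lt_trans (normcD _ _) _; rewrite ltrD ?HA ?HB.
Qed.

Lemma has_sumZ T (f : T -> C) s c : has_sum f s ->
  has_sum (fun i => c * f i) (c * s).
Proof.
move=> hf e e0; have c0 : 0 < normc c + 1 by rewrite ltr_wpDl ?normc_ge0.
have [A HA] := hf (e / (normc c + 1)) (divr_gt0 e0 c0).
exists A => D /HA; rewrite ltr_pdivlMr// -mulr_sumr -mulrBr normcM.
apply: le_lt_trans; rewrite mulrC ler_wpM2l ?normc_ge0//.
by rewrite lerDl.
Qed.

Lemma has_sum_ext T (f g : T -> C) s : f =1 g -> has_sum f s -> has_sum g s.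
Proof. by move=> /funext ->. Qed.

Lemma fset_preimage T U (h : T -> U) (D : {fset U}) : injective h ->
  exists P : {fset T}, forall t, (t \in P) = (h t \in D).
Proof.
move=> hi; exists (fset_set (h @^-1` [set` D])%classic) => t.
rewrite in_fset_set; first by apply/idP/idP => [/set_mem//|?]; exact: mem_set.
by apply: finite_preimage => // x y _ _; exact: hi.
Qed.

Lemma has_sum_inj T U (h : T -> U) (f : U -> C) s : injective h ->
  (forall u, (forall t, h t != u) -> f u = 0) ->
  has_sum (fun t => f (h t)) s -> has_sum f s.
Proof.
move=> hi f0 H e e0.
have [A HA] := H e e0; exists [fset h x | x in A]%fset => D AD.
have [P PE] := fset_preimage D hi.
have PD : ([fset h x | x in P] `<=` D)%fset.
  by apply/fsubsetP => u /imfsetP[t /=]; rewrite PE => tD ->.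
rewrite -(big_fset_incl _ PD).
  rewrite big_imfset /=; last exact: in2W.
  apply: HA; apply/fsubsetP => t tA; rewrite PE.
  by apply: (fsubsetP AD); apply/imfsetP; exists t.
move=> u uD uP; apply: f0 => t; apply: contra uP => /eqP htu.
by apply/imfsetP; exists t => //=; rewrite PE htu.
Qed.

(** Absolute summability is carried along with the value, since rearrangements
    and products need it. *)
Definition asum T (f : T -> C) (s : C) :=
  (exists B, bsum (fun i => normc (f i)) B) /\ has_sum f s.

Lemma bsumD T (f g : T -> R) B D : bsum f B -> bsum g D ->
  bsum (fun i => f i + g i) (B + D).
Proof. by move=> fB gD A; rewrite big_split lerD. Qed.

Lemma bsum_le T (f g : T -> R) B : (forall i, f i <= g i) -> bsum g B -> bsum f B.
Proof. by move=> fg gB A; apply: le_trans (gB A); apply: ler_sum. Qed.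

Lemma bsumZ T (f : T -> R) B c : 0 <= c -> bsum f B ->
  bsum (fun i => c * f i) (c * B).
Proof. by move=> c0 fB A; rewrite -mulr_sumr ler_wpM2l. Qed.

Lemma bsum_inj T U (h : T -> U) (f : T -> R) (g : U -> R) B : injective h ->
  (forall u, 0 <= g u) -> (forall t, f t <= g (h t)) -> bsum g B -> bsum f B.
Proof.
move=> hi g0 fg gB A; apply: le_trans (gB [fset h x | x in A]%fset).
by rewrite big_imfset /=; [exact: ler_sum|exact: in2W].
Qed.

(** Completeness of the complex numbers for unordered sums, by reduction to
    nonnegative families. *)
Lemma asum_ex T (f : T -> C) B : bsum (fun i => normc (f i)) B -> exists s, asum f s.
Proof.
move=> fB.
have ReI z : `|complex.Re z| <= normc z /\ `|complex.Im z| <= normc z.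
  case: z => a b /=; rewrite /normc -!sqrtr_sqr; split; apply: ler_wsqrtr.
    by rewrite lerDl sqr_ge0.
  by rewrite lerDr sqr_ge0.
have part (g : T -> R) : (forall i, `|g i| <= normc (f i)) ->
    exists s : C, has_sum (fun i => (g i)%:C%C) s.
  move=> hg.
  (* A real family g is (g + |g|) - |g|, a difference of nonnegative ones. *)
  have [s Hs] := has_sum_nonneg (fun i => normr_ge0 (g i)) (bsum_le hg fB).
  have gg0 i : 0 <= g i + `|g i| by rewrite -lerBlDr sub0r lerNnormlW.
  have [t Ht] : exists t, has_sum (fun i => (g i + `|g i|)%:C%C) t%:C%C.
    apply: (has_sum_nonneg gg0 (B := B + B)); apply: bsumD; apply: bsum_le fB => //.
    by move=> i; apply: le_trans (ler_norm _) (hg i).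
  exists (t%:C%C + (-1) * s%:C%C).
  apply: (has_sum_ext _ (has_sumD Ht (has_sumZ (-1) Hs))) => i /=.
  by rewrite rmorphD mulN1r addrK.
have [s Hs] := part (fun i => complex.Re (f i)) (fun i => (ReI (f i)).1).
have [t Ht] := part (fun i => complex.Im (f i)) (fun i => (ReI (f i)).2).
exists (s + 'i%C * t); split; first by exists B.
apply: (has_sum_ext _ (has_sumD Hs (has_sumZ ('i%C) Ht))) => i /=.
by rewrite [RHS]complexE.
Qed.

Lemma asum_norm_le T (f : T -> C) s B : bsum (fun i => normc (f i)) B ->
  has_sum f s -> normc s <= B.
Proof.
move=> fB H; apply/ler_addgt0Pr => e e0; have [A HA] := H e e0.
rewrite -[s](subrK (\sum_(i <- A) f i)) addrC; apply: le_trans (normcD _ _) _.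
apply: lerD; first by apply: le_trans (normc_sum _ _ _) (fB A).
by rewrite normcB ltW// HA.
Qed.

Lemma asumD T (f g : T -> C) s t : asum f s -> asum g t ->
  asum (fun i => f i + g i) (s + t).
Proof.
move=> [[B fB] fs] [[D gD] gt]; split; last exact: has_sumD.
exists (B + D); apply: bsum_le (bsumD fB gD) => i; exact: normcD.
Qed.

Lemma asumZ T (f : T -> C) s c : asum f s -> asum (fun i => c * f i) (c * s).
Proof.
move=> [[B fB] fs]; split; last exact: has_sumZ.
exists (normc c * B); apply: bsum_le (bsumZ (normc_ge0 c) fB) => i.
by rewrite normcM.
Qed.

Lemma asum_ext T (f g : T -> C) s : f =1 g -> asum f s -> asum g s.
Proof. by move=> /funext ->. Qed.

Lemma asum0 T : asum (fun _ : T => 0) 0.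
Proof.
split; first by exists 0 => A; rewrite big1// => i _; rewrite normc0.
by move=> e e0; exists fset0 => D _; rewrite big1// subr0 normc0.
Qed.

Lemma asum_sum T (I : Type) (r : seq I) (f : I -> T -> C) s :
  (forall i, asum (f i) (s i)) ->
  asum (fun t => \sum_(i <- r) f i t) (\sum_(i <- r) s i).
Proof.
move=> H; elim: r => [|i r IH].
  by rewrite big_nil; apply: asum_ext (asum0 _) => t; rewrite big_nil.
rewrite big_cons; apply: asum_ext (asumD (H i) IH) => t; by rewrite big_cons.
Qed.

Lemma asum_inj T U (h : T -> U) (f : U -> C) s : injective h ->
  (forall u, (forall t, h t != u) -> f u = 0) ->
  asum (fun t => f (h t)) s -> asum f s.
Proof.
move=> hi f0 [[B fB] fs]; split; last exact: has_sum_inj fs.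
exists B => D.
have [P PE] := fset_preimage D hi.
have PD : ([fset h x | x in P] `<=` D)%fset.
  by apply/fsubsetP => u /imfsetP[t /=]; rewrite PE => tD ->.
apply: le_trans (fB P); rewrite -(big_fset_incl _ PD).
  by rewrite big_imfset /=; last exact: in2W.
move=> u uD uP; rewrite f0 ?normc0// => t; apply: contra uP => /eqP htu.
by apply/imfsetP; exists t => //=; rewrite PE htu.
Qed.

Lemma asum_bij T U (h : T -> U) (k : U -> T) (f : U -> C) s :
  cancel h k -> cancel k h -> asum f s -> asum (fun t => f (h t)) s.
Proof.
move=> hk kh fs; apply: (asum_inj (can_inj kh)).
  by move=> t /(_ (h t)); rewrite hk eqxx.
by apply: asum_ext fs => u; rewrite kh.
Qed.

Lemma fprod_sum T U (f : T -> C) (g : U -> C) (A : {fset T}) (B : {fset U}) :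
  \sum_(p <- (A `*` B)%fset) f p.1 * g p.2 = (\sum_(i <- A) f i) * (\sum_(j <- B) g j).
Proof.
rewrite big_imfset2 /=; last by move=> [a b] [a' b'] _ _ /= [-> ->].
by rewrite mulr_suml; apply: eq_bigr => i _; rewrite mulr_sumr.
Qed.

(** The product family is summable, so its sum can be computed along
    rectangles, where it factors. *)
Lemma asum_prod T U (f : T -> C) (g : U -> C) s t : asum f s -> asum g t ->
  asum (fun p : T * U => f p.1 * g p.2) (s * t).
Proof.
move=> [[B fB] fs] [[D gD] gt].
have bnd : bsum (fun p : T * U => normc (f p.1 * g p.2)) (B * D).
  move=> A; pose A1 := [fset p.1 | p in A]%fset; pose A2 := [fset p.2 | p in A]%fset.
  have AA : (A `<=` A1 `*` A2)%fset.
    by apply/fsubsetP => p pA; rewrite in_fsetM !in_imfset.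
  apply: le_trans (fsum_le _ AA) _; first by move=> i; exact: normc_ge0.
  have -> : \sum_(i <- (A1 `*` A2)%fset) normc (f i.1 * g i.2) =
     (\sum_(i <- A1) normc (f i)) * (\sum_(j <- A2) normc (g j)).
    rewrite big_imfset2 /=; last by move=> [a b] [a' b'] _ _ /= [-> ->].
    by rewrite mulr_suml; apply: eq_bigr => i _; rewrite mulr_sumr;
       apply: eq_bigr => j _; rewrite normcM.
  by apply: ler_pM; rewrite ?sumr_ge0// => *; exact: normc_ge0.
have [u [bu hu]] := asum_ex bnd; split => //.
suff -> : s * t = u by [].
apply/eqP; rewrite -subr_eq0 -normc_eq0; apply/eqP/le_anti; rewrite normc_ge0 andbT.
apply/ler_addgt0Pr => e e0; rewrite add0r.
pose M := normc s + normc t + 1.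
have M0 : 0 < M by rewrite ltr_wpDl ?addr_ge0 ?normc_ge0.
pose d := Num.min 1 (e / (2 * M)).
have d0 : 0 < d by rewrite lt_min ltr01 divr_gt0 ?mulr_gt0.
have [Z HZ] := hu (e / 2) (divr_gt0 e0 (ltr0Sn R 1)).
have [A HA] := fs d d0; have [E HE] := gt d d0.
pose A1 := (A `|` [fset p.1 | p in Z])%fset; pose A2 := (E `|` [fset p.2 | p in Z])%fset.
have ZA : (Z `<=` A1 `*` A2)%fset.
  by apply/fsubsetP => p pZ; rewrite in_fsetM !in_fsetU !in_imfset// !orbT.
have := HZ _ ZA; rewrite fprod_sum.
have := HA A1 (fsubsetUl _ _); have := HE A2 (fsubsetUl _ _).
set x := \sum_(i <- A1) _; set y := \sum_(i <- A2) _ => hy hx hxy.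
have hs : normc (s * t - x * y) <= e / 2.
  have -> : s * t - x * y = - ((x - s) * (y - t) + s * (y - t) + t * (x - s)) by ring.
  rewrite normcNE.
  have h1 : normc ((x - s) * (y - t)) <= d.
    rewrite normcM -[leRHS]mul1r ler_pM ?normc_ge0//; last exact: ltW.
    by apply: le_trans (ltW hx) _; rewrite ge_min lexx.
  have h2 : normc (s * (y - t)) <= normc s * d.
    by rewrite normcM ler_wpM2l ?normc_ge0// ltW.
  have h3 : normc (t * (x - s)) <= normc t * d.
    by rewrite normcM ler_wpM2l ?normc_ge0// ltW.
  apply: (@le_trans _ _ (M * d)).
    apply: le_trans (normcD _ _) _; apply: le_trans (lerD (normcD _ _) h3) _.
    apply: le_trans (lerD (lerD h1 h2) (lexx _)) _.
    by rewrite /M !mulrDl mul1r addrC addrA addrC; lra.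
  have : d <= e / (2 * M) by rewrite ge_min lexx orbT.
  rewrite invfM mulrA ler_pdivlMr// mulrC => /le_trans; apply.
  by rewrite mulrC.
apply: le_trans (normcBD _ (x * y) _) _; rewrite (splitr e).
by apply: lerD => //; exact: ltW.
Qed.

Definition ifset n : {fset nat} := [fset x in index_iota 0 n]%fset.

Lemma mem_ifset n i : (i \in ifset n) = (i < n)%N.
Proof. by rewrite in_fset /= mem_index_iota. Qed.

Lemma sum_ifset (V : nmodType) n (f : nat -> V) :
  \sum_(i <- ifset n) f i = \sum_(i < n) f i.
Proof.
rewrite -(big_mkord predT f); apply: perm_big; apply: uniq_perm.
- exact: fset_uniq.
- exact: iota_uniq.
- by move=> i; rewrite mem_ifset mem_index_iota.
Qed.

Lemma leq_bigmax_fset (T : choiceType) (A : {fset T}) (g : T -> nat) t :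
  t \in A -> (g t <= \max_(i <- A) g i)%N.
Proof. by move=> tA; rewrite (big_fsetD1 t tA) leq_maxl. Qed.

Lemma bsum_nat (u : nat -> R) B : (forall i, 0 <= u i) ->
  (forall n, \sum_(i < n) u i <= B) -> bsum u B.
Proof.
move=> u0 H A; pose N := (\max_(i <- A) i).+1.
apply: le_trans (H N); rewrite -sum_ifset.
apply: fsum_le => //; apply/fsubsetP => x xA; rewrite mem_ifset ltnS.
exact: (leq_bigmax_fset id xA).
Qed.

Lemma has_sum_exhaust T (f : T -> C) s (F : nat -> {fset T}) :
  (forall t, exists N, forall n, (N <= n)%N -> t \in F n) ->
  has_sum f s -> (\sum_(i <- F n) f i @[n --> \oo] --> s)%classic.
Proof.
move=> HF H; apply: cvgc_limn => e /H[A HA].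
have /choice[g Hg] := HF.
exists (\max_(i <- A) g i) => n An; apply: HA; apply/fsubsetP => t tA.
by apply: Hg; apply: leq_trans An; exact: leq_bigmax_fset tA.
Qed.
End Sums.
End Norm.

(** * Infinite products and dominated convergence *)

Section Products.
Variable R : realType.
Local Notation C := R[i].

Lemma geo_sum (rho : R) n : 0 <= rho < 1 -> \sum_(i < n) rho ^+ i <= (1 - rho)^-1.
Proof.
move=> /andP[r0 r1]; have r' : 0 < 1 - rho by rewrite subr_gt0.
rewrite -[leRHS]mul1r ler_pdivlMr// mulrC.
suff -> : (1 - rho) * \sum_(i < n) rho ^+ i = 1 - rho ^+ n by rewrite gerBl exprn_ge0.
elim: n => [|n IH]; first by rewrite big_ord0 mulr0 expr0 subrr.
by rewrite big_ord_recr mulrDr IH exprS /=; ring.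
Qed.

Lemma geo_small (rho K e : R) : 0 <= rho < 1 -> 0 <= K -> 0 < e ->
  exists P, forall p, (P <= p)%N -> K * rho ^+ p <= e.
Proof.
move=> /andP[r0 r1] K0 e0.
have H : (rho ^+ n @[n --> \oo] --> (0 : R))%classic.
  by apply: cvg_expr; rewrite ger0_norm.
have K1 : 0 < K + 1 by rewrite ltr_wpDl.
have [N _ HN] := (cvgrPdist_le (F := \oo%classic) _ _).1 H (e / (K + 1)) (divr_gt0 e0 K1).
exists N => p Np; have := HN p Np; rewrite /= sub0r normrN ger0_norm ?exprn_ge0//.
rewrite ler_pdivlMr// mulrC => /(le_trans _); apply.
by rewrite ler_wpM2r ?exprn_ge0// lerDl.
Qed.

Lemma prod_tail (x : nat -> R) n : (forall i, 0 <= x i <= 1) ->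
  1 - \sum_(i < n) x i <= \prod_(i < n) (1 - x i) <= 1.
Proof.
move=> x01; elim: n => [|n /andP[IH1 IH2]]; first by rewrite !big_ord0 subr0 lexx.
have /andP[x0 x1] := x01 n.
have p0 : 0 <= \prod_(i < n) (1 - x i).
  by apply: prodr_ge0 => i _; rewrite subr_ge0; case/andP: (x01 i).
rewrite !big_ord_recr /=; apply/andP; split; last first.
  by apply: mulr_ile1 => //; rewrite ?subr_ge0// gerBl.
rewrite mulrBr mulr1 opprD addrA; apply: lerB => //.
by rewrite -[leRHS]mul1r ler_wpM2r.
Qed.

(** Induction on the number P of factors to be split off. For P = 0 the sum of
    the |u m| is at most 1/2, so that the product of the 1 - |u m| is at least
    1/2, which yields both bounds. *)
Lemma prod_bounds (rho : R) : 0 <= rho < 1 -> forall P (K : R) (u : nat -> C), 0 <= K ->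
  K * rho ^+ P / (1 - rho) <= 1 / 2 -> (forall m, normc (u m) <= K * rho ^+ m) ->
  (exists2 B, 0 < B & forall N, normc (\prod_(m < N) (1 - u m)) <= B) /\
  ((forall m, 1 - u m != 0) ->
   exists2 e, 0 < e & forall N, e <= normc (\prod_(m < N) (1 - u m))).
Proof.
move=> r01; have [r0 r1] := andP r01; have r' : 0 < 1 - rho by rewrite subr_gt0.
elim=> [|P IH] K u K0 KP Hu.
  rewrite expr0 mulr1 in KP.
  have x01 i : 0 <= K * rho ^+ i <= 1.
    rewrite mulr_ge0 ?exprn_ge0//=; apply: (@le_trans _ _ K).
      by rewrite ler_piMr// exprn_ile1// ltW.
    move: KP; rewrite ler_pdivrMr// => /le_trans; apply.
    by rewrite div1r; have := r0; lra.
  have lo N : 1 / 2 <= \prod_(i < N) (1 - K * rho ^+ i).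
    have /andP[H _] := prod_tail N x01; apply: le_trans H.
    rewrite -mulr_sumr; have := ler_wpM2l K0 (geo_sum N r01); move: KP; lra.
  split; first exists 2 => // N.
    have h1 : normc (\prod_(m < N) (1 - u m)) <= \prod_(i < N) (1 + K * rho ^+ i).
      rewrite normc_prod; apply: ler_prod => i _; rewrite normc_ge0 /=.
      by apply: le_trans (normcD _ _) _; rewrite normc1 normcNE lerD2l.
    apply: le_trans h1 _.
    have h2 : (\prod_(i < N) (1 + K * rho ^+ i)) * \prod_(i < N) (1 - K * rho ^+ i) <= 1.
      rewrite -big_split /=; apply: prodr_ile1 => i _ /=.
      have /andP[x0 x1] := x01 i; set x := K * _ in x0 x1 *.
      by apply/andP; split; [apply: mulr_ge0; lra | nra].
    have p0 : 0 <= \prod_(i < N) (1 + K * rho ^+ i).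
      by apply: prodr_ge0 => i _; have /andP[? _] := x01 i; lra.
    have := ler_wpM2l p0 (lo N); lra.
  move=> _; exists (1 / 2) => // N; apply: le_trans (lo N) _.
  rewrite normc_prod; apply: ler_prod => i _.
  have /andP[_ x1] := x01 i; rewrite subr_ge0 x1 /=.
  have := normcD (1 - u i) (u i); rewrite subrK normc1.
  have := Hu i; lra.
have Kr0 : 0 <= K * rho by rewrite mulr_ge0.
have KP' : K * rho * rho ^+ P / (1 - rho) <= 1 / 2 by rewrite -(mulrA K) -exprS.
have Hu' m : normc (u m.+1) <= K * rho * rho ^+ m by rewrite -(mulrA K) -exprS.
have [[B B0 HB] He] := IH _ (fun m => u m.+1) Kr0 KP' Hu'; split.
  exists (Num.max 1 (normc (1 - u 0%N) * B)); first by rewrite lt_max ltr01.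
  move=> [|N]; first by rewrite big_ord0 normc1 le_max lexx.
  rewrite big_ord_recl normcM le_max; apply/orP; right.
  by rewrite ler_wpM2l ?normc_ge0//; exact: HB.
move=> un0; have [e e0 {}He] := He (fun m => un0 m.+1).
have u0 : 0 < normc (1 - u 0%N) by rewrite normc_gt0.
exists (Num.min 1 (normc (1 - u 0%N) * e)); first by rewrite lt_min ltr01 mulr_gt0.
move=> [|N]; first by rewrite big_ord0 normc1 ge_min lexx.
rewrite big_ord_recl normcM ge_min; apply/orP; right.
by rewrite ler_wpM2l ?normc_ge0//; exact: He.
Qed.

Lemma prod_bounded (rho K : R) (u : nat -> C) : 0 <= rho < 1 -> 0 <= K ->
  (forall m, normc (u m) <= K * rho ^+ m) ->
  (exists2 B, 0 < B & forall N, normc (\prod_(m < N) (1 - u m)) <= B) /\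
  ((forall m, 1 - u m != 0) ->
   exists2 e, 0 < e & forall N, e <= normc (\prod_(m < N) (1 - u m))).
Proof.
move=> r01 K0 Hu; have [r0 r1] := andP r01; have r' : 0 < 1 - rho by rewrite subr_gt0.
have [P HP] := geo_small r01 (divr_ge0 K0 (ltW r')) (divr_gt0 (@ltr01 R) (ltr0Sn R 1)).
apply: (prod_bounds r01 (P := P) K0) => //.
by rewrite mulrAC HP.
Qed.

Lemma telescope_sum (p : nat -> C) n : \sum_(i < n) (p i.+1 - p i) = p n - p 0%N.
Proof.
elim: n => [|n IH]; first by rewrite big_ord0 subrr.
by rewrite big_ord_recr /= IH addrC addrA subrK.
Qed.

(** The partial products are bounded, hence their increments are dominated by
    a geometric series. *)
Lemma prod_cvg (rho K : R) (u : nat -> C) : 0 <= rho < 1 -> 0 <= K ->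
  (forall m, normc (u m) <= K * rho ^+ m) ->
  exists l : C, (\prod_(m < N) (1 - u m) @[N --> \oo] --> l)%classic.
Proof.
move=> r01 K0 Hu; have [[B B0 HB] _] := prod_bounded r01 K0 Hu.
pose p N := \prod_(m < N) (1 - u m).
have [s [_ hs]] : exists s, asum (fun i => p i.+1 - p i) s.
  apply: (@asum_ex _ _ _ (B * K / (1 - rho))); apply: bsum_nat => [i|n].
    exact: normc_ge0.
  apply: (@le_trans _ _ (\sum_(i < n) B * K * rho ^+ i)).
    apply: ler_sum => i _; rewrite /p big_ord_recr /=.
    rewrite [X in normc X](_ : _ = - (p i * u i)); last by rewrite /p; ring.
    rewrite normcNE normcM -mulrA ler_pM ?normc_ge0//; exact: HB.
  by rewrite -mulr_sumr ler_wpM2l ?mulr_ge0// ?(ltW B0)// geo_sum.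
exists (s + 1).
have -> : (fun N => \prod_(m < N) (1 - u m)) =
   (fun N => \sum_(i <- ifset N) (p i.+1 - p i) + 1).
  apply: funext => N; rewrite sum_ifset (telescope_sum p) /p big_ord0; ring.
apply: cvgD; last exact: cvg_cst.
apply: has_sum_exhaust hs => t; exists t.+1 => n; by rewrite mem_ifset.
Qed.

(** Dominated convergence for series: a finite set carries the sum of the |f
    t| up to d; on it the convergence of the coefficients is used, outside of
    it their boundedness. *)
Lemma tannery (T : choiceType) (f : T -> C) s (F : nat -> {fset T})
  (c : nat -> T -> C) cl B :
  (forall t, exists N, forall n, (N <= n)%N -> t \in F n) ->
  asum f s -> 0 <= B -> (forall n t, normc (c n t) <= B) -> normc cl <= B ->
  (forall t, (c n t @[n --> \oo] --> cl)%classic) ->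
  (\sum_(t <- F n) c n t * f t @[n --> \oo] --> cl * s)%classic.
Proof.
move=> HF [[G HG] hs] B0 cB clB ccl.
have G0 : 0 <= G by have := HG fset0; rewrite big_seq_fset0.
have -> : (fun n => \sum_(t <- F n) c n t * f t) =
  (fun n => \sum_(t <- F n) (c n t - cl) * f t + cl * \sum_(t <- F n) f t).
  apply: funext => n; rewrite mulr_sumr -big_split; apply: eq_bigr => t _.
  by rewrite /=; ring.
rewrite -[cl * s]add0r; apply: cvgD; last first.
  by apply: cvgM; [exact: cvg_cst | exact: has_sum_exhaust hs].
apply: cvgc_limn => e e0.
have [g hg] := has_sum_nonneg (fun t => normc_ge0 (f t)) HG.
pose d := e / (4 * (2 * B + 1)).
have B1 : 0 < 2 * B + 1 by lra.
have d0 : 0 < d by rewrite divr_gt0// mulr_gt0.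
have [A HA] := hg d d0.
have hA D : (A `<=` D)%fset -> \sum_(i <- D) normc (f i) <= \sum_(i <- A) normc (f i) + 2 * d.
  move=> AD; have := HA D AD; have := HA A (fsubset_refl _).
  rewrite -!rmorph_sum -!rmorphB => h1 h2.
  have rB (z : R) : normc z%:C%C < d -> - d < z < d.
    by rewrite /normc /= expr0n addr0 sqrtr_sqr ltr_norml.
  by move: h1 h2 => /rB h1 /rB h2; lra.
have /choice[N1 HN1] := HF.
pose ep := e / (4 * (G + 1)).
have ep0 : 0 < ep by rewrite divr_gt0// mulr_gt0// ltr_wpDl.
have /choice[N2 HN2] : forall t, exists N, forall n, (N <= n)%N -> normc (c n t - cl) < ep.
  by move=> t; exact: (limn_cvgc (ccl t)).
exists (maxn (\max_(i <- A) N1 i) (\max_(i <- A) N2 i)) => n.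
rewrite geq_max => /andP[n1 n2].
have AF : (A `<=` F n)%fset.
  apply/fsubsetP => t tA; apply: HN1; apply: leq_trans n1.
  exact: leq_bigmax_fset tA.
rewrite subr0; apply: le_lt_trans (normc_sum _ _ _) _.
rewrite (big_fsetID _ (mem A) (F n)) /=.
have -> : [fset x in F n | x \in A]%fset = A.
  by apply/fsetP => x; rewrite !inE /= andb_idl// => /(fsubsetP AF).
have h1 : \sum_(i <- A) normc ((c n i - cl) * f i) <= ep * G.
  apply: le_trans (_ : _ <= ep * \sum_(i <- A) normc (f i)) _; last first.
    by rewrite ler_wpM2l ?(ltW ep0)//; exact: HG.
  rewrite mulr_sumr big_seq [leRHS]big_seq; apply: ler_sum => t tA.
  rewrite normcM ler_wpM2r ?normc_ge0// ltW// HN2//.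
  apply: leq_trans n2; exact: leq_bigmax_fset tA.
have h2 : \sum_(i <- [fset x in F n | x \notin A]%fset) normc ((c n i - cl) * f i)
     <= 2 * B * (2 * d).
  apply: le_trans (_ : _ <= 2 * B * \sum_(i <- [fset x in F n | x \notin A]%fset) normc (f i)) _.
    rewrite mulr_sumr; apply: ler_sum => t _; rewrite normcM ler_wpM2r ?normc_ge0//.
    apply: le_trans (normcD _ _) _; rewrite normcNE; have := cB n t; lra.
  rewrite ler_wpM2l//; first lra.
  have := hA _ AF; rewrite (big_fsetID _ (mem A) (F n)) /=.
  have -> : [fset x in F n | x \in A]%fset = A.
    by apply/fsetP => x; rewrite !inE /= andb_idl// => /(fsubsetP AF).
  by rewrite lerD2l.
have h3 : ep * G <= e / 4.
  rewrite /ep invfM mulrA -[leLHS]mulrA ler_piMr//; first by apply: divr_ge0; rewrite ?(ltW e0).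
  by rewrite mulrC ler_pdivrMr ?mul1r ?lerDl// ltr_wpDl.
have h4 : 2 * B * (2 * d) <= e / 2.
  have -> : 2 * B * (2 * d) = (e / 2) * (2 * B / (2 * B + 1)).
    by rewrite /d; field; lra.
  rewrite ler_piMr//; first by apply: divr_ge0; rewrite ?(ltW e0).
  by rewrite ler_pdivrMr//; lra.
lra.
Qed.

End Products.

(** * The Jacobi triple product *)

Section Tri.
Lemma mul_succ_bin (k : int) :
  k * (k + 1) = (2 * 'C(if k is Posz n then n.+1 else `|k|%N, 2))%:Z.
Proof.
have H n : (2 * 'C(n.+1, 2) = n.+1 * n)%N.
  by rewrite bin2 /= mul2n halfK oddM /= andNb subn0.
case: k => n; rewrite H; first by lia.
by rewrite NegzE; lia.
Qed.

Definition tri (k : int) : int := ((k * (k + 1)) %/ 2)%Z.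

Lemma tri_bin (k : int) : tri k = ('C(if k is Posz n then n.+1 else `|k|%N, 2))%:Z.
Proof. by rewrite /tri mul_succ_bin PoszM mulrC mulzK. Qed.

Lemma tri2 (k : int) : tri k * 2 = k * (k + 1).
Proof. by rewrite tri_bin mul_succ_bin PoszM mulrC. Qed.
End Tri.

Section JTP.
Variable R : realType.
Local Notation C := R[i].

(** Induction on the number P of terms to be dropped before the ratio is at
    most 1/2. *)
Lemma ratio_bound (rho : R) : 0 <= rho -> forall P (K : R) (u : nat -> R),
  K * rho ^+ P <= 1 / 2 -> 0 <= K -> rho <= 1 -> (forall n, 0 <= u n) ->
  (forall n, u n.+1 <= K * rho ^+ n * u n) ->
  exists B, forall n, \sum_(i < n) u i <= B.
Proof.
move=> r0; elim=> [|P IH] K u KP K0 r1 u0 Hu.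
  exists (2 * u 0%N) => n.
  suff H : \sum_(i < n) u i + 2 * u n <= 2 * u 0%N.
    by apply: le_trans H; rewrite lerDl mulr_ge0.
  elim: n => [|n IH]; first by rewrite big_ord0 add0r.
  rewrite big_ord_recr /=; apply: le_trans IH.
  have h1 : K * rho ^+ n <= 1 / 2.
    apply: le_trans KP; rewrite expr0 mulr1 ler_piMr// exprn_ile1//.
  have := Hu n; have := ler_wpM2r (u0 n) h1; lra.
have [B HB] : exists B, forall n, \sum_(i < n) u i.+1 <= B.
  apply: (IH (K * rho) (fun n => u n.+1)) => //.
  - by rewrite -(mulrA K) -exprS.
  - by rewrite mulr_ge0.
  - by move=> n; rewrite -(mulrA K) -exprS; exact: Hu.
exists (u 0%N + B) => -[|n]; last by rewrite big_ord_recl lerD2l; exact: HB.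
rewrite big_ord0; apply: addr_ge0 => //.
by have := HB 0%N; rewrite big_ord0.
Qed.

Lemma bsum_int (g : int -> R) B1 B2 : (forall k, 0 <= g k) ->
  bsum (fun n => g (Posz n)) B1 -> bsum (fun n => g (Negz n)) B2 -> bsum g (B1 + B2).
Proof.
move=> g0 H1 H2 A.
have [P HP] := fset_preimage (h := Posz) A (fun _ _ e => let: erefl := e in erefl).
have [N HN] := fset_preimage (h := Negz) A (fun _ _ e => let: erefl := e in erefl).
apply: le_trans (lerD (H1 P) (H2 N)).
have PI : injective Posz by move=> a b [].
have NI : injective Negz by move=> a b [].
rewrite (big_fsetID _ (fun k : int => if k is Posz _ then true else false) A) /=.
apply: lerD.
  have -> : [fset x in A | if x is Posz _ then true else false]%fset =
            [fset Posz x | x in P]%fset.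
    apply/fsetP => -[n|n]; rewrite !inE /=.
      rewrite andbT; apply/idP/imfsetP => [nA|[m /= mP ->]]; last by rewrite -HP.
      by exists n => //=; rewrite HP.
    by rewrite andbF; apply/esym/negP => /imfsetP[m].
  by rewrite big_imfset //=; exact: in2W.
have -> : [fset x in A | ~~ (if x is Posz _ then true else false)]%fset =
            [fset Negz x | x in N]%fset.
  apply/fsetP => -[n|n]; rewrite !inE /=.
    by rewrite andbF; apply/esym/negP => /imfsetP[m].
  rewrite andbT; apply/idP/imfsetP => [nA|[m /= mP ->]]; last by rewrite -HN.
  by exists n => //=; rewrite HN.
by rewrite big_imfset //=; exact: in2W.
Qed.

(** Gaussian decay dominates every geometric growth; all the theta series
    below converge for this reason. *)
Lemma theta_bsum (rho L : R) : 0 <= rho < 1 -> 0 <= L ->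
  exists B, bsum (fun k : int => rho ^ (tri k) * L ^+ `|k|%N) B.
Proof.
move=> r01 L0; have [r0 r1] := andP r01.
have [P HP] := geo_small r01 L0 (divr_gt0 (@ltr01 R) (ltr0Sn R 1)).
pose u n : R := rho ^+ 'C(n.+1, 2) * L ^+ n.
have u0 n : 0 <= u n by rewrite mulr_ge0 ?exprn_ge0.
have us n : u n.+1 <= L * rho ^+ n * u n.
  rewrite /u binS bin1 exprD exprS exprS.
  have -> : rho ^+ 'C(n.+1, 2) * (rho * rho ^+ n) * (L * L ^+ n) =
     rho * (L * rho ^+ n * (rho ^+ 'C(n.+1, 2) * L ^+ n)) by ring.
  by rewrite ler_piMl ?(ltW r1)// !mulr_ge0 ?exprn_ge0.
have [B HB] := ratio_bound r0 (HP P (leqnn _)) L0 (ltW r1) u0 us.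
have bu := bsum_nat u0 HB.
exists (B + L * B); apply: bsum_int.
- by move=> k; rewrite mulr_ge0 ?exprn_ge0// exprz_ge0.
- by apply: bsum_le bu => n; rewrite tri_bin.
- apply: bsum_le (bsumZ L0 bu) => n; rewrite tri_bin /= /u.
  by rewrite -exprnP exprS mulrCA.
Qed.

Variable q : C.
Hypotheses (q0 : q != 0) (q1 : normc q < 1).
Let r01 : 0 <= normc q < 1. Proof. by rewrite normc_ge0. Qed.

Definition qpochn n := \prod_(m < n) (1 - q ^+ m.+1).

Lemma qpochn_factor_neq0 m : 1 - q ^+ m.+1 != 0.
Proof.
rewrite subr_eq0; apply/eqP => E; have := q1; rewrite ltNge => /negP[].
have : normc (q ^+ m.+1) = 1 by rewrite -E normc1.
rewrite normcX => E'; rewrite leNgt; apply/negP => h.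
by have := exprn_ilt1 m.+1 (normc_ge0 q) h; rewrite E' ltxx.
Qed.

Let qpu m : normc (q ^+ m.+1) <= normc q * normc q ^+ m.
Proof. by rewrite normcX exprS. Qed.

Lemma qpoch_cvg : (qpochn n @[n --> \oo] --> qpoch q)%classic.
Proof.
have [l Hl] := prod_cvg r01 (normc_ge0 q) qpu.
suff -> : qpoch q = l by [].
rewrite /qpoch -[RHS](limnE Hl); congr (limn _); apply: funext => N.
by rewrite big_add1 big_mkord.
Qed.

Lemma qpochn_bounds : exists B e, [/\ 0 < B, 0 < e, forall n, normc (qpochn n) <= B
   & forall n, e <= normc (qpochn n)].
Proof.
have [[B B0 HB] He] := prod_bounded r01 (normc_ge0 q) qpu.
have [e e0 {}He] := He qpochn_factor_neq0.
by exists B, e.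
Qed.

Lemma cvg_ge_neq0 (u : nat -> C) (l : C) (e : R) : 0 < e -> (forall n, e <= normc (u n)) ->
  (u n @[n --> \oo] --> l)%classic -> l != 0.
Proof.
move=> e0 He /limn_cvgc/(_ e e0)[N /(_ N (leqnn _))] H; apply/eqP => l0.
by move: H; rewrite l0 subr0 ltNge He.
Qed.

(** The partial products stay away from 0. *)
Lemma qpoch_neq0 : qpoch q != 0.
Proof.
by have [B [e [_ e0 _ He]]] := qpochn_bounds; exact: cvg_ge_neq0 e0 He qpoch_cvg.
Qed.

Fixpoint qbin (M j : nat) : C := match M, j with
  | 0%N, 0%N => 1 | 0%N, _ => 0 | M'.+1, 0%N => 1
  | M'.+1, j'.+1 => q ^+ j * qbin M' j + qbin M' j' end.

Lemma qbin0 M : qbin M 0 = 1. Proof. by case: M. Qed.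

Lemma qbin_gt M j : (M < j)%N -> qbin M j = 0.
Proof.
elim: M j => [|M IH] [|j] //= Mj; rewrite !IH ?mulr0 ?addr0//; exact: ltnW.
Qed.

(** The q-binomial theorem of Gauss, by induction on the number of factors. *)
Lemma qbinomial_theorem M t :
  \prod_(m < M) (1 - q ^+ m * t) =
  \sum_(j < M.+1) (-1) ^+ j * q ^+ 'C(j, 2) * qbin M j * t ^+ j.
Proof.
elim: M t => [|M IH] t.
  by rewrite big_ord0 big_ord_recl big_ord0 /= !expr0 !mulr1 addr0.
rewrite big_ord_recl expr0 mul1r.
have -> : \prod_(i < M) (1 - q ^+ lift ord0 i * t) = \prod_(i < M) (1 - q ^+ i * (q * t)).
  by apply: eq_bigr => i _; rewrite lift0 exprSr mulrA.
rewrite IH mulrBl mul1r [RHS]big_ord_recl.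
have E : \sum_(j < M.+1) (-1) ^+ j * q ^+ 'C(j, 2) * qbin M j * (q * t) ^+ j =
    1 + \sum_(j < M.+1) (-1) ^+ j.+1 * q ^+ 'C(j.+1, 2) * qbin M j.+1 * (q * t) ^+ j.+1.
  rewrite big_ord_recl /= qbin0 !expr0 !mulr1; congr (_ + _).
  rewrite [RHS]big_ord_recr /= qbin_gt// mulr0 mul0r addr0.
  by apply: eq_bigr => i _; rewrite /bump add1n.
rewrite {1}E /= !expr0 !mulr1 -addrA; congr (_ + _).
rewrite mulr_sumr -sumrB; apply: eq_bigr => i _.
rewrite /bump add1n /= binS bin1 !exprS exprMn exprD.
rewrite add0n; by ring.
Qed.

Lemma qbin_qpochn M j : (j <= M)%N -> qbin M j * (qpochn j * qpochn (M - j)) = qpochn M.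
Proof.
elim: M j => [|M IH] [|j] //= jM.
- by rewrite /qpochn !big_ord0 !mulr1.
- by rewrite subn0 /qpochn big_ord0 !mul1r.
rewrite mulrDl subSS.
have [jM'|] := ltnP j M; last first.
  move=> Mj; have -> : j = M by apply/eqP; rewrite eqn_leq -ltnS jM.
  rewrite qbin_gt// mulr0 mul0r add0r.
  have := IH M (leqnn _); rewrite subnn.
  have -> : qpochn M.+1 = qpochn M * (1 - q ^+ M.+1) by rewrite /qpochn big_ord_recr.
  move=> h; transitivity (qbin M M * (qpochn M * qpochn 0) * (1 - q ^+ M.+1)); first by ring.
  by rewrite h.
have S1 : qpochn (M - j) = qpochn (M - j.+1) * (1 - q ^+ (M - j)).
  by rewrite -subnSK// /qpochn big_ord_recr.
have S2 : qpochn j.+1 = qpochn j * (1 - q ^+ j.+1) by rewrite /qpochn big_ord_recr.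
have h1 := IH _ jM'; have h2 := IH _ (ltnW jM').
have -> : qpochn M.+1 = qpochn M * (1 - q ^+ M.+1) by rewrite /qpochn big_ord_recr.
rewrite [X in _ + X](_ : _ = qbin M j * (qpochn j * qpochn (M - j)) * (1 - q ^+ j.+1)); last first.
  by rewrite S2; ring.
rewrite [X in X + _](_ : _ = q ^+ j.+1 * (qbin M j.+1 * (qpochn j.+1 * qpochn (M - j.+1))) * (1 - q ^+ (M - j))); last first.
  by rewrite S1; ring.
rewrite h1 h2; have -> : q ^+ M.+1 = q ^+ j.+1 * q ^+ (M - j).
  by rewrite -exprD; congr (_ ^+ _); rewrite addSn subnKC// ltnW.
ring.
Qed.

Lemma qbin_bound : exists2 B, 0 <= B & forall M j, normc (qbin M j) <= B.
Proof.
have [B [e [B0 e0 HB He]]] := qpochn_bounds.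
exists (B / e ^+ 2); first by rewrite divr_ge0 ?exprn_ge0 ?ltW.
move=> M j; have [jM|jM] := leqP j M; last first.
  by rewrite qbin_gt// normc0 divr_ge0 ?exprn_ge0 ?ltW.
rewrite ler_pdivlMr ?exprn_gt0//.
apply: le_trans (HB M); rewrite -(qbin_qpochn jM) !normcM expr2.
rewrite ler_wpM2l ?normc_ge0// ler_pM// ?(ltW e0)//; exact: He.
Qed.

Definition theta_term (y : C) (k : int) : C := (-1) ^ k * q ^ (tri k) * y ^ k.

(** The q-binomial theorem for 2N + 1 factors at the argument y q^-N, for
    which the factors are spread symmetrically; the Jacobi triple product is
    its limit. *)
Lemma finite_jacobi_triple (y : C) N : y != 0 ->
  (1 - y^-1) * \prod_(m < N) ((1 - q ^+ m.+1 * y) * (1 - q ^+ m.+1 * y^-1)) =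
  \sum_(j < N.+1 + N.+1) qbin (N.+1 + N) j * theta_term y (j%:Z - N.+1%:Z).
Proof.
move=> y0.
have qu n : q ^+ n != 0 by rewrite expf_neq0.
have -> : (1 - y^-1) * \prod_(m < N) ((1 - q ^+ m.+1 * y) * (1 - q ^+ m.+1 * y^-1)) =
   \prod_(m < N.+1) (1 - q ^+ m * y^-1) * \prod_(m < N) (1 - q ^+ m.+1 * y).
  rewrite big_split /= big_ord_recl expr0 mul1r.
  have -> : \prod_(i < N) (1 - q ^+ lift ord0 i / y) = \prod_(i < N) (1 - q ^+ i.+1 / y).
    by apply: eq_bigr => i _; rewrite lift0.
  by ring.
have -> : \prod_(m < N.+1) (1 - q ^+ m * y^-1) =
    (-1) ^+ N.+1 * q ^+ 'C(N.+1, 2) * y ^- N.+1 * \prod_(m < N.+1) (1 - q ^- m * y).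
  have -> : \prod_(m < N.+1) (1 - q ^+ m * y^-1) =
     \prod_(m < N.+1) ((- (q ^+ m / y)) * (1 - q ^- m * y)).
    by apply: eq_bigr => m _; field; rewrite y0 qu.
  rewrite big_split /=; congr (_ * _).
  elim: (N.+1) => [|n IH]; first by rewrite big_ord0 !expr0 invr1 !mulr1.
  rewrite big_ord_recr /= IH binS bin1 exprD !exprS.
  by field; rewrite y0 expf_neq0.
have -> : \prod_(m < N.+1) (1 - q ^- m * y) = \prod_(m < N.+1) (1 - q ^+ m * (y / q ^+ N)).
  rewrite (reindex_inj rev_ord_inj) /=; apply: eq_bigr => m _; rewrite subSS.
  have mN : (m <= N)%N by rewrite -ltnS.
  have -> : q ^+ N = q ^+ (N - m) * q ^+ m by rewrite -exprD subnK.
  by congr (1 - _); field; rewrite !qu.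
have -> : \prod_(m < N) (1 - q ^+ m.+1 * y) =
    \prod_(m < N) (1 - q ^+ (N.+1 + m) * (y / q ^+ N)).
  apply: eq_bigr => m _; congr (1 - _); rewrite addSnnS exprD; field; exact: qu.
rewrite -mulrA; move: (qbinomial_theorem (N.+1 + N) (y / q ^+ N)); move: (qbin (N.+1 + N)) => g.
rewrite big_split_ord /= => ->.
rewrite mulr_sumr -addnS; apply: eq_bigr => j _.
rewrite /theta_term.
have -> : (-1 : C) ^ (j%:Z - N.+1%:Z) = (-1) ^+ j * (-1) ^+ N.+1.
  rewrite expfzDr ?oppr_eq0 ?oner_eq0// -exprnP -exprnN; congr (_ * _).
  by rewrite -exprVn invrN1.
have -> : y ^ (j%:Z - N.+1%:Z) = y ^+ j / y ^+ N.+1.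
  by rewrite expfzDr// -exprnP -exprnN.
have -> : q ^ tri (j%:Z - N.+1%:Z) = q ^+ 'C(N.+1, 2) * q ^+ 'C(j, 2) / (q ^+ N) ^+ j.
  have -> : tri (j%:Z - N.+1%:Z) = 'C(N.+1, 2)%:Z + 'C(j, 2)%:Z - (N * j)%:Z.
    apply: (mulIf (x := 2)) => //; rewrite tri2 !mulrDl.
    have h1 : 'C(N.+1, 2)%:Z * 2 = N%:Z * (N%:Z + 1) by rewrite -(tri2 N) tri_bin.
    have h2 : 'C(j, 2)%:Z * 2 = (j%:Z - 1) * j%:Z.
      case: (j : nat) => [|n] //; rewrite -[n.+1%:Z]/(1 + n%:Z).
      have := tri2 n; rewrite tri_bin /= => ->; ring.
    by rewrite h1 h2 PoszM -[N.+1%:Z]/(1 + N%:Z); ring.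
  by rewrite !expfzDr// -!exprnP -exprnN exprM.
rewrite expr_div_n -exprM.
by field; rewrite !expf_neq0.
Qed.

Lemma theta_term_bsum y : y != 0 -> exists B, bsum (fun k => normc (theta_term y k)) B.
Proof.
move=> y0; pose L := normc y + normc y^-1.
have L0 : 0 <= L by rewrite addr_ge0 ?normc_ge0.
have [B HB] := theta_bsum r01 L0; exists B; apply: bsum_le HB => k.
rewrite /theta_term !normcM !normcXz normcNE normc1 exp1rz mul1r.
apply: ler_wpM2l; first by rewrite exprz_ge0 ?normc_ge0.
case: k => n; rewrite ?NegzE ?abszN absz_nat.
  by rewrite lerXn2r ?nnegrE ?normc_ge0// lerDl normc_ge0.
by rewrite -exprnN -exprVn -normcV lerXn2r ?nnegrE ?normc_ge0// lerDr normc_ge0.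
Qed.

Definition sigfset n : {fset int} := [fset (j%:Z - n.+1%:Z) | j in ifset (n.+1 + n.+1)]%fset.

Lemma sum_sigfset n (f : int -> C) :
  \sum_(k <- sigfset n) f k = \sum_(j < n.+1 + n.+1) f (j%:Z - n.+1%:Z).
Proof.
rewrite big_imfset /=; first by rewrite (sum_ifset _ (fun j => f (j%:Z - n.+1%:Z))).
by move=> i j _ _ /addIr [].
Qed.

Lemma sigfset_ex (k : int) : exists N, forall n, (N <= n)%N -> k \in sigfset n.
Proof.
exists (absz k) => n kn; apply/imfsetP; exists (absz (k + n.+1%:Z)) => /=.
  by rewrite mem_ifset; lia.
by rewrite gez0_abs ?addrK//; lia.
Qed.

Lemma cvg_subseq (u : nat -> C) (l : C) (phi : nat -> nat) (k : nat) :
  (forall n, (n <= phi (n + k)%N)%N) -> (forall m n, (m <= n)%N -> (phi m <= phi n)%N) ->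
  (u n @[n --> \oo] --> l)%classic -> (u (phi n) @[n --> \oo] --> l)%classic.
Proof.
move=> H mono /limn_cvgc Hu; apply: cvgc_limn => e /Hu[N HN].
exists (N + k)%N => n Nn; apply: HN; apply: leq_trans (H N) _; exact: mono.
Qed.

(** A q-binomial coefficient near the middle of a row is a quotient of partial
    products of (q;q)_oo, two of them in the denominator. *)
Lemma qbin_cvg (k : int) :
  (qbin (n.+1 + n) (absz (k + n.+1%:Z)) @[n --> \oo] --> (qpoch q)^-1)%classic.
Proof.
pose g n := qpochn (n.+1 + n) * ((qpochn (absz (k + n.+1%:Z)))^-1 * (qpochn (absz (n%:Z - k)))^-1).
have qn0 n : qpochn n != 0.
  have [B [e [_ e0 _ He]]] := qpochn_bounds.
  by rewrite -normc_gt0; apply: lt_le_trans (He n).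
have H : (g n @[n --> \oo] --> qpoch q * ((qpoch q)^-1 * (qpoch q)^-1))%classic.
  apply: cvgM; first apply: (cvg_subseq (k := 0)); first by move=> n; lia.
  - by move=> m n mn; lia.
  - exact: qpoch_cvg.
  have sub (f : nat -> nat) : (exists k0, forall n, (n <= f (n + k0)%N)%N /\ f (n + k0).+1 = (f (n + k0)%N).+1) ->
     ((qpochn (f n))^-1 @[n --> \oo] --> (qpoch q)^-1)%classic.
    move=> [k0 Hk]; apply: cvgV; first exact: qpoch_neq0.
    apply: cvgc_limn => e e0; have [N HN] := limn_cvgc qpoch_cvg e0.
    exists (N + k0)%N => n nk; apply: HN.
    rewrite -(subnK nk) addnA; apply: leq_trans (Hk _).1.
    exact: leq_addl.
  apply: cvgM; apply: sub; exists (absz k) => n; split; lia.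
have -> : (qpoch q)^-1 = qpoch q * ((qpoch q)^-1 * (qpoch q)^-1).
  by rewrite mulrA mulfV ?qpoch_neq0// mul1r.
apply: cvgc_limn => e e0; have [N HN] := limn_cvgc H e0.
exists (maxn N `|k|%N) => n; rewrite geq_max => /andP[Nn kn].
suff -> : qbin (n.+1 + n) (absz (k + n.+1%:Z)) = g n by exact: HN.
have jl : (absz (k + n.+1%:Z)%R <= n.+1 + n)%N by lia.
rewrite /g -(qbin_qpochn jl).
have -> : (n.+1 + n - absz (k + n.+1%:Z)%R)%N = (absz (n%:Z - k)) by lia.
by field; rewrite !qn0.
Qed.

(** The theta function without its half-integral power: theta(y) = y^(1/2)
    [thetaF y]. *)
Definition thetaF (y : C) : C := (1 - y^-1) *
  limn (fun N => \prod_(1 <= m < N.+1) ((1 - q ^+ m * y) * (1 - q ^+ m * y^-1))).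

(** The coefficients of [finite_jacobi_triple] are bounded and converge to the
    inverse of (q;q)_oo, so that [tannery] applies. *)
Lemma theta_prod_cvg y : y != 0 -> exists s, asum (theta_term y) s /\
  ((1 - y^-1) * \prod_(m < n) ((1 - q ^+ m.+1 * y) * (1 - q ^+ m.+1 * y^-1))
    @[n --> \oo] --> (qpoch q)^-1 * s)%classic.
Proof.
move=> y0; have [B HB] := theta_term_bsum y0; have [s Hs] := asum_ex HB.
exists s; split => //.
have [G G0 HG] := qbin_bound.
have := tannery (c := fun n k => qbin (n.+1 + n) (absz (k + n.+1%:Z))) sigfset_ex Hs
  (B := G + normc (qpoch q)^-1) _ _ _ qbin_cvg.
set H := (X in _ -> _ -> _ -> X); rewrite -/H => /(_ _ _ _) HH.
have : H.
  apply: HH.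
  - by rewrite addr_ge0 ?normc_ge0.
  - by move=> n k; rewrite (le_trans (HG _ _))// lerDl normc_ge0.
  - by rewrite lerDr.
rewrite /H; set u := (X in (X @ _ --> _)%classic -> _); set v := (X in _ -> (X @ _ --> _)%classic).
suff -> : u = v by [].
apply: funext => n; rewrite /u /v finite_jacobi_triple// sum_sigfset.
by apply: eq_bigr => j _; rewrite subrK absz_nat.
Qed.

Lemma thetaF_lim y l :
  ((1 - y^-1) * \prod_(m < n) ((1 - q ^+ m.+1 * y) * (1 - q ^+ m.+1 * y^-1))
    @[n --> \oo] --> l)%classic -> thetaF y = l.
Proof.
move=> Hc.
have E : (fun N => \prod_(1 <= m < N.+1) ((1 - q ^+ m * y) * (1 - q ^+ m * y^-1))) =
   (fun N => \prod_(m < N) ((1 - q ^+ m.+1 * y) * (1 - q ^+ m.+1 * y^-1))).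
  by apply: funext => N; rewrite big_add1 big_mkord.
rewrite /thetaF E.
have [y1|y1] := eqVneq (1 - y^-1) 0.
  rewrite y1 mul0r; symmetry; rewrite -(limnE Hc).
  under [X in limn X]funext do rewrite y1 mul0r.
  by apply: limnE; exact: cvg_cst.
have -> : limn (fun N => \prod_(m < N) ((1 - q ^+ m.+1 * y) * (1 - q ^+ m.+1 * y^-1))) =
  (1 - y^-1)^-1 * l.
  apply: limnE.
  have -> : (fun N => \prod_(m < N) ((1 - q ^+ m.+1 * y) * (1 - q ^+ m.+1 * y^-1))) =
    (cst (1 - y^-1)^-1 \* (fun n => (1 - y^-1) *
       \prod_(m < n) ((1 - q ^+ m.+1 * y) * (1 - q ^+ m.+1 * y^-1)))).
    by apply: funext => n; rewrite /= mulKf.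
  exact: cvgM (cvg_cst _) Hc.
by rewrite mulVKf.
Qed.

Lemma jacobi_triple y : y != 0 -> asum (theta_term y) (qpoch q * thetaF y).
Proof.
move=> y0; have [s [Hs /thetaF_lim ->]] := theta_prod_cvg y0.
by rewrite mulVKf// qpoch_neq0.
Qed.

(** Each of the two half-products is bounded below, as none of its factors
    vanishes. *)
Lemma thetaF_neq0 y : y != 0 -> (forall m : int, y != q ^ m) -> thetaF y != 0.
Proof.
move=> y0 yq.
have y1 : 1 - y^-1 != 0.
  by rewrite subr_eq0 eq_sym; apply: contra (yq 0) => /eqP h; rewrite -[y]invrK h invr1.
have [s [_ Hc]] := theta_prod_cvg y0.
have half z : z != 0 -> (forall m : int, z != q ^ m) ->
   exists2 e, 0 < e & forall N, e <= normc (\prod_(m < N) (1 - q ^+ m.+1 * z)).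
  move=> z0 zq.
  have Hu m : normc (q ^+ m.+1 * z) <= normc q * normc z * normc q ^+ m.
    by rewrite normcM normcX exprS mulrAC.
  have [_] := prod_bounded r01 (mulr_ge0 (normc_ge0 q) (normc_ge0 z)) Hu.
  apply=> m; rewrite subr_eq0; apply: contra (zq (- (m.+1)%:Z)) => /eqP h.
  by rewrite -exprnN -[z](mulKf (expf_neq0 m.+1 q0)) -h mulr1.
have [e1 e10 H1] := half y y0 yq.
have [|m|e2 e20 H2] := half y^-1; first by rewrite invr_eq0.
  by apply: contra (yq (- m)) => /eqP h; rewrite -invr_expz -h invrK.
have s0 : (qpoch q)^-1 * s != 0.
  apply: (cvg_ge_neq0 (e := normc (1 - y^-1) * (e1 * e2))) Hc.
    by rewrite mulr_gt0 ?normc_gt0// mulr_gt0.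
  move=> n; rewrite normcM ler_wpM2l ?normc_ge0// big_split normcM.
  by rewrite ler_pM// ltW.
by rewrite (thetaF_lim Hc).
Qed.
End JTP.

(** * Holomorphy by first-order expansions with uniform constants *)

Section Taylor.
Variable R : realType.
Local Notation C := R[i].

Lemma nrm_row n (x : 'rV[C]_n) k : normc (x 0 k) <= nrm x.
Proof.
rewrite -lecR -nrmE -[X in X <= _]/(`|x 0 k|) [leRHS]/Num.norm /= mx_normE.
by rewrite [_ <= _%:num]num_le; apply: (le_bigmax _ (fun i : 'I_1 * 'I_n => `|x i.1 i.2|%:nng) (0, k)).
Qed.

Lemma nrm_pair (V W : normedModType C) (x : V * W) : nrm x = Num.max (nrm x.1) (nrm x.2).
Proof.
have : `|x| = (Num.max (nrm x.1) (nrm x.2))%:C%C.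
  rewrite prod_normE !nrmE /Order.max ltcR; case: ifP => _ //.
by rewrite nrmE => /complexI.
Qed.

Lemma nrmC (z : C) : nrm z = normc z.
Proof. by []. Qed.

Lemma nrmZ (V : normedModType C) c (x : V) : nrm (c *: x : V) = normc c * nrm x.
Proof. by apply: complexI; rewrite rmorphM /= -!nrmE normrZ. Qed.

Section Good.
Variables (V : normedModType C) (x : V) (dl : R).
Hypotheses (dl0 : 0 < dl) (dl1 : dl <= 1).

(** A first-order expansion of f at x, valid up to distance dl, in which one
    constant K bounds the values, the differential L and the quadratic
    remainder. In contrast to differentiability, this passes to sums of series
    as soon as the constants are summable. *)
Definition expands (f : V -> C) (K : R) := exists L : V -> C,
  [/\ forall a u v, L (a *: u + v) = a * L u + L v,
      forall h, nrm h < dl -> normc (f (x + h)) <= K,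
      forall h, normc (L h) <= K * nrm h
    & forall h, nrm h < dl -> normc (f (x + h) - f x - L h) <= K * nrm h ^+ 2].

Let nv0 : nrm (0 : V) = 0.
Proof. by rewrite /nrm normr0. Qed.

Lemma expands_at f K : expands f K -> normc (f x) <= K.
Proof. by move=> [L [_ /(_ 0) H _ _]]; rewrite addr0 nv0 in H; exact: H. Qed.

Lemma expands_ge0 f K : expands f K -> 0 <= K.
Proof. by move=> /expands_at; apply: le_trans; exact: normc_ge0. Qed.

Lemma expands_le f K K' : K <= K' -> expands f K -> expands f K'.
Proof.
move=> KK [L [h1 h2 h3 h4]]; exists L; split => // h.
- by move=> /h2/le_trans; apply.
- by apply: le_trans (h3 h) _; rewrite ler_wpM2r ?nrm_ge0.
- by move=> /h4/le_trans; apply; rewrite ler_wpM2r ?exprn_ge0 ?nrm_ge0.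
Qed.

Lemma expands_cst c K : normc c <= K -> expands (fun=> c) K.
Proof.
move=> cK; have K0 := le_trans (normc_ge0 c) cK; exists (fun=> 0); split=> // [a u v|h|h _].
- by rewrite mulr0 addr0.
- by rewrite normc0 mulr_ge0 ?nrm_ge0.
- by rewrite subrr subr0 normc0 mulr_ge0 ?exprn_ge0 ?nrm_ge0.
Qed.

Lemma expands_mul f g K K' : expands f K -> expands g K' -> expands (fun y => f y * g y) (4 * K * K').
Proof.
move=> gf gg; have K0 := expands_ge0 gf; have K'0 := expands_ge0 gg.
have fx := expands_at gf; have gx := expands_at gg.
have [L [L1 L2 L3 L4]] := gf; have [M [M1 M2 M3 M4]] := gg.
have KK : 0 <= K * K' by exact: mulr_ge0.
exists (fun h => f x * M h + g x * L h); split=> [a u v|h hd|h|h hd].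
- by rewrite L1 M1; ring.
- rewrite normcM; apply: le_trans (ler_pM (normc_ge0 _) (normc_ge0 _) (L2 h hd) (M2 h hd)) _.
  by lra.
- have n0 := nrm_ge0 h; apply: le_trans (normcD _ _) _; rewrite !normcM.
  have h1 := ler_pM (normc_ge0 _) (normc_ge0 _) fx (M3 h).
  have h2 := ler_pM (normc_ge0 _) (normc_ge0 _) gx (L3 h).
  have := mulr_ge0 KK n0; nra.
have n0 := nrm_ge0 h; have n1 : nrm h <= 1 by apply: le_trans dl1; exact: ltW.
have n2 : 0 <= nrm h ^+ 2 by rewrite exprn_ge0.
(* The three terms below are bounded by 1, 2 and 1 times K K' |h|^2, which
   explains the constant 4. *)
have -> : f (x + h) * g (x + h) - f x * g x - (f x * M h + g x * L h) =
   f (x + h) * (g (x + h) - g x - M h) + ((f (x + h) - f x - L h) * (g x + M h) + L h * M h).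
  by ring.
apply: le_trans (normcD _ _) _.
have h1 : normc (f (x + h) * (g (x + h) - g x - M h)) <= K * (K' * nrm h ^+ 2).
  by rewrite normcM ler_pM ?normc_ge0 ?L2 ?M4.
have h2 : normc ((f (x + h) - f x - L h) * (g x + M h)) <= K * nrm h ^+ 2 * (2 * K').
  rewrite normcM ler_pM ?normc_ge0 ?L4//; apply: le_trans (normcD _ _) _.
  have := M3 h; have : K' * nrm h <= K' by rewrite ler_piMr.
  lra.
have h3 : normc (L h * M h) <= K * nrm h * (K' * nrm h).
  by rewrite normcM ler_pM ?normc_ge0 ?L3 ?M3.
apply: le_trans (lerD h1 (le_trans (normcD _ _) (lerD h2 h3))) _.
by rewrite le_eqVlt; apply/orP; left; apply/eqP; ring.
Qed.

Lemma expands_exp f K n : expands f K -> expands (fun y => f y ^+ n) ((4 * K) ^+ n).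
Proof.
move=> gf; elim: n => [|n IH].
  have -> : (fun y => f y ^+ 0) = (fun=> 1) by apply: funext => y; rewrite expr0.
  by apply: expands_cst; rewrite expr0 normc1.
have -> : (fun y => f y ^+ n.+1) = (fun y => f y * f y ^+ n).
  by apply: funext => y; rewrite exprS.
rewrite exprS; exact: expands_mul.
Qed.

Lemma expands_expz f K m : expands f K -> expands (fun y => (f y)^-1) K ->
  expands (fun y => f y ^ m) ((4 * K) ^+ `|m|%N).
Proof.
case: m => n gf gi; first exact: (expands_exp n gf).
have -> : (fun y => f y ^ Negz n) = (fun y => (f y)^-1 ^+ n.+1).
  by apply: funext => y; rewrite NegzE -exprnN exprVn.
exact: expands_exp.
Qed.

Lemma expands_prod (I : Type) (r : seq I) (f : I -> V -> C) (K : I -> R) :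
  (forall i, expands (f i) (K i)) ->
  expands (fun y => \prod_(i <- r) f i y) (\prod_(i <- r) (4 * K i)).
Proof.
move=> H; elim: r => [|i r IH].
  rewrite big_nil; have -> : (fun y => \prod_(i <- [::]) f i y) = (fun=> 1).
    by apply: funext => y; rewrite big_nil.
  by apply: expands_cst; rewrite normc1.
rewrite big_cons; have -> : (fun y => \prod_(i <- i :: r) f i y) =
    (fun y => f i y * \prod_(i <- r) f i y).
  by apply: funext => y; rewrite big_cons.
exact: expands_mul.
Qed.

Lemma expands_linear (L : V -> C) : (forall a u v, L (a *: u + v) = a * L u + L v) ->
  (forall h, normc (L h) <= nrm h) -> expands L (normc (L x) + 1).
Proof.
move=> L1 L2; have LD u v : L (u + v) = L u + L v.
  by have := L1 1 u v; rewrite scale1r mul1r.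
exists L; split=> // [h hd|h|h hd].
- rewrite LD; apply: le_trans (normcD _ _) _; rewrite lerD2l.
  by apply: le_trans (L2 h) _; apply: le_trans dl1; exact: ltW.
- by apply: le_trans (L2 h) _; rewrite ler_peMl ?nrm_ge0// lerDr normc_ge0.
- rewrite LD [L x + _]addrC addrK subrr normc0 mulr_ge0 ?exprn_ge0 ?nrm_ge0//.
  by rewrite addr_ge0 ?normc_ge0.
Qed.

Lemma expands_linear_inv (L : V -> C) : (forall a u v, L (a *: u + v) = a * L u + L v) ->
  (forall h, normc (L h) <= nrm h) -> L x != 0 -> dl <= normc (L x) / 2 ->
  exists K, expands (fun y => (L y)^-1) K.
Proof.
move=> L1 L2 c0 dc; have LD u v : L (u + v) = L u + L v.
  by have := L1 1 u v; rewrite scale1r mul1r.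
set c := L x in c0 dc *; have n0 : 0 < normc c by rewrite normc_gt0.
have lo h : nrm h < dl -> normc c / 2 <= normc (c + L h).
  move=> hd; have := normcD (c + L h) (- L h); rewrite addrK normcNE.
  by have := L2 h; lra.
have inz h : nrm h < dl -> c + L h != 0.
  by move=> hd; rewrite -normc_gt0; have := lo h hd; lra.
have inv h : nrm h < dl -> normc (c + L h)^-1 <= 2 / normc c.
  move=> hd; rewrite normcV -[leRHS]invrK invfM invrK lef_pV2 ?posrE//.
  - by rewrite mulrC; exact: lo.
  - by have := lo h hd; lra.
  - by rewrite mulr_gt0.
have i0 : 0 <= (normc c)^-1 by rewrite invr_ge0 normc_ge0.
pose K := 2 / normc c + (normc c)^-1 ^+ 2 + 2 * (normc c)^-1 ^+ 3.
have k2 : 0 <= (normc c)^-1 ^+ 2 by rewrite exprn_ge0.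
have k3 : 0 <= (normc c)^-1 ^+ 3 by rewrite exprn_ge0.
exists K, (fun h => - L h / c ^+ 2); split=> [a u v|h hd|h|h hd].
- by rewrite L1; field.
- by rewrite LD; apply: le_trans (inv h hd) _; rewrite /K; lra.
- rewrite normcM normcNE normcV normcX mulrC.
  apply: ler_pM; rewrite ?normc_ge0 ?invr_ge0 ?exprn_ge0 ?normc_ge0//.
  by rewrite -exprVn /K; lra.
rewrite LD -/c.
have -> : (c + L h)^-1 - c^-1 - - L h / c ^+ 2 = (L h ^+ 2 * c^-1 ^+ 2) * (c + L h)^-1.
  by field; rewrite c0 inz.
rewrite normcM normcM !normcX normcV mulrC mulrA mulrAC.
apply: ler_pM; rewrite ?mulr_ge0 ?exprn_ge0 ?normc_ge0//.
  apply: (@le_trans _ _ (2 * (normc c)^-1 ^+ 3)); last by rewrite /K; lra.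
  have := ler_wpM2r k2 (inv h hd); move=> /le_trans; apply.
  by rewrite le_eqVlt; apply/orP; left; apply/eqP; ring.
by rewrite lerXn2r ?nnegrE ?normc_ge0 ?nrm_ge0//; exact: L2.
Qed.

(** The differential of the sum is the sum of the differentials, which
    converges absolutely because of the bound on each of them. *)
Lemma expands_sum (T : choiceType) (f : T -> V -> C) (K : T -> R) (g : V -> C) B :
  (forall t, expands (f t) (K t)) -> bsum K B ->
  (forall h, nrm h < dl -> has_sum (fun t => f t (x + h)) (g (x + h))) -> expands g B.
Proof.
move=> H KB Hg; have /choice[L HL] := H.
have L3 t h : normc (L t h) <= nrm h * K t by have [_ _ h3 _] := HL t; rewrite mulrC.
have bL h : bsum (fun t => normc (L t h)) (nrm h * B).
  by apply: bsum_le (bsumZ (nrm_ge0 h) KB) => t; exact: L3.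
have /choice[M HM] : forall h, exists s, has_sum (fun t => L t h) s.
  by move=> h; have [s [_ hs]] := asum_ex (bL h); exists s.
have gx : has_sum (fun t => f t x) (g x) by rewrite -[x]addr0; apply: Hg; rewrite nv0.
exists M; split=> [a u v|h hd|h|h hd].
- apply: has_sum_unique (HM _) _.
  apply: has_sum_ext (has_sumD (has_sumZ a (HM u)) (HM v)) => t /=.
  by have [-> _ _ _] := HL t.
- apply: asum_norm_le (Hg h hd); apply: bsum_le KB => t.
  by have [_ h2 _ _] := HL t; exact: h2.
- by rewrite mulrC; exact: asum_norm_le (bL h) (HM h).
have hs := has_sumD (has_sumD (Hg h hd) (has_sumZ (-1) gx)) (has_sumZ (-1) (HM h)).
rewrite !mulN1r in hs; apply: asum_norm_le hs; rewrite mulrC.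
apply: bsum_le (bsumZ _ KB); last by rewrite exprn_ge0 ?nrm_ge0.
by move=> t; rewrite !mulN1r [leRHS]mulrC; have [_ _ _ h4] := HL t; exact: h4.
Qed.

Lemma expands_differentiable f K : expands f K -> differentiable f x.
Proof.
move=> gf; have [L [L1 L2 L3 L4]] := gf; have K0 := expands_ge0 gf.
pose L' := HB.pack_for {linear V -> C} L (GRing.isLinear.Build C V C *:%R L L1).
apply: (@differentiable_taylor _ _ x f L' (K + 1) dl) => //.
- by rewrite ltr_wpDl.
- by move=> h; apply: le_trans (L3 h) _; rewrite ler_wpM2r ?nrm_ge0 ?lerDl.
- by move=> h hd; apply: le_trans (L4 h hd) _; rewrite ler_wpM2r ?exprn_ge0 ?nrm_ge0 ?lerDl.
Qed.
End Good.
End Taylor.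

(** * Monomials on the torus *)

Section Torus.
Variables (R : realType) (d r : nat).
Local Notation C := R[i].
Local Notation P := (tpoint R d r).

Definition coord_a (k : 'I_d) (y : P) : C := y.1.1 0 k.
Definition coord_z (k : 'I_r) (y : P) : C := y.1.2 0 k.
Definition coord_v (y : P) : C := y.2.

Lemma nrm_coord_a k y : normc (coord_a k y) <= nrm y.
Proof.
apply: le_trans (nrm_row _ _) _; rewrite nrm_pair le_max nrm_pair le_max.
by rewrite lexx.
Qed.
Lemma nrm_coord_z k y : normc (coord_z k y) <= nrm y.
Proof.
apply: le_trans (nrm_row _ _) _; rewrite nrm_pair le_max nrm_pair le_max.
by rewrite lexx orbT.
Qed.
Lemma nrm_coord_v y : normc (coord_v y) <= nrm y.
Proof. by rewrite nrm_pair le_max -nrmC lexx orbT. Qed.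

Lemma coord_a_lin k a u v : coord_a k (a *: u + v) = a * coord_a k u + coord_a k v.
Proof. by rewrite /coord_a /= !mxE. Qed.
Lemma coord_z_lin k a u v : coord_z k (a *: u + v) = a * coord_z k u + coord_z k v.
Proof. by rewrite /coord_z /= !mxE. Qed.
Lemma coord_v_lin a u v : coord_v (a *: u + v) = a * coord_v u + coord_v v.
Proof. by []. Qed.

Definition mono (y : P) (m1 : 'I_d -> int) (m2 : 'I_r -> int) (m3 : int) : C :=
  (\prod_k coord_a k y ^ m1 k) * (\prod_k coord_z k y ^ m2 k) * coord_v y ^ m3.

(** One radius serves for all monomials, and the constants grow at most
    exponentially with the size of the exponents; this is what the Gaussian
    coefficients of a theta series can absorb. *)
Lemma mono_expands (x : P) : torus x -> exists (dl K0 K : R),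
  [/\ 0 < dl <= 1, 0 <= K0, 1 <= K & forall m1 m2 m3,
     expands x dl (fun y => mono y m1 m2 m3)
       (K0 * K ^+ (\sum_k `|m1 k|%N + \sum_k `|m2 k|%N + `|m3|%N)%N)].
Proof.
move=> [xa [xz xv]].
(* The coordinates of the three factors of the torus, as one family. *)
pose I := ('I_d + 'I_r + unit)%type.
pose L (i : I) : P -> C := match i with inl (inl k) => coord_a k | inl (inr k) => coord_z k | inr _ => coord_v end.
have L1 i a u v : L i (a *: u + v) = a * L i u + L i v.
  by case: i => [[k|k]|[]]; rewrite /L ?coord_a_lin ?coord_z_lin ?coord_v_lin.
have L2 i h : normc (L i h) <= nrm h.
  by case: i => [[k|k]|[]]; rewrite /L ?nrm_coord_a ?nrm_coord_z ?nrm_coord_v.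
have L0 i : L i x != 0 by case: i => [[k|k]|[]] /=; [exact: xa|exact: xz|exact: xv].
pose s := enum (@predT I).
have [dl [dl0 dl1 dlL]] : exists dl : R, [/\ 0 < dl, dl <= 1 & forall i, dl <= normc (L i x) / 2].
  have [dl [dl0 dl1 dlL]] : exists dl : R, [/\ 0 < dl, dl <= 1 & forall i, i \in s -> dl <= normc (L i x) / 2].
    elim: s => [|i s [e [e0 e1 He]]]; first by exists 1.
    exists (Num.min e (normc (L i x) / 2)); split.
    - by rewrite lt_min e0 divr_gt0// normc_gt0.
    - by rewrite ge_min e1.
    - move=> j; rewrite inE => /orP[/eqP ->|/He h]; rewrite ge_min ?lexx ?orbT//.
      by rewrite h.
  by exists dl; split => // i; apply: dlL; rewrite mem_enum.
have [K [K1 HK]] : exists K : R, 1 <= K /\ forall i, expands x dl (L i) K /\ expands x dl (fun y => (L i y)^-1) K.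
  have /choice[f Hf] : forall i, exists K : R, expands x dl (L i) K /\ expands x dl (fun y => (L i y)^-1) K.
    move=> i; have g1 := expands_linear x dl1 (L1 i) (L2 i).
    have [K g2] := expands_linear_inv (L1 i) (L2 i) (L0 i) (dlL i).
    exists (Num.max (normc (L i x) + 1) K).
    by split; [apply: expands_le g1|apply: expands_le g2]; rewrite le_max lexx ?orbT.
  exists (1 + \sum_i f i); have f0 i : 0 <= f i by exact: expands_ge0 (Hf i).1.
  split; first by rewrite lerDl sumr_ge0.
  move=> i; have fi : f i <= 1 + \sum_i f i.
    by rewrite (bigD1 i)//= addrCA lerDl addr_ge0// sumr_ge0.
  by split; [apply: expands_le (Hf i).1|apply: expands_le (Hf i).2].
exists dl, (4 ^+ (d + r + 2)), (4 * K); split; first by rewrite dl0.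
- by rewrite exprn_ge0.
- lra.
move=> m1 m2 m3.
have pw i m : expands x dl (fun y => L i y ^ m) ((4 * K) ^+ `|m|%N).
  by apply: (expands_expz dl0 dl1); [exact: (HK i).1|exact: (HK i).2].
have ga := expands_prod dl0 dl1 (index_enum 'I_d) (fun k => pw (inl (inl k)) (m1 k)).
have gz := expands_prod dl0 dl1 (index_enum 'I_r) (fun k => pw (inl (inr k)) (m2 k)).
have gv := pw (inr tt) m3.
have := expands_mul dl0 dl1 (expands_mul dl0 dl1 ga gz) gv.
apply: expands_le; rewrite !big_split /= !prodrXr !exprD !prodr_const !card_ord.
by rewrite le_eqVlt; apply/orP; left; apply/eqP; rewrite !expr2; ring.
Qed.

Lemma mono_add y m1 m2 m3 m1' m2' m3' : torus y ->
  mono y (fun k => m1 k + m1' k) (fun k => m2 k + m2' k) (m3 + m3') =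
  mono y m1 m2 m3 * mono y m1' m2' m3'.
Proof.
move=> [ya [yz yv]]; rewrite /mono.
have -> : \prod_k coord_a k y ^ (m1 k + m1' k) = (\prod_k coord_a k y ^ m1 k) * \prod_k coord_a k y ^ m1' k.
  by rewrite -big_split; apply: eq_bigr => k _; rewrite expfzDr//; exact: ya.
have -> : \prod_k coord_z k y ^ (m2 k + m2' k) = (\prod_k coord_z k y ^ m2 k) * \prod_k coord_z k y ^ m2' k.
  by rewrite -big_split; apply: eq_bigr => k _; rewrite expfzDr//; exact: yz.
by rewrite expfzDr; [ring|exact: yv].
Qed.

Lemma mono_neq0 y m1 m2 m3 : torus y -> mono y m1 m2 m3 != 0.
Proof.
move=> [ya [yz yv]]; rewrite /mono !mulf_neq0//.
- by apply/prodf_neq0 => k _; rewrite expfz_neq0//; exact: ya.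
- by apply/prodf_neq0 => k _; rewrite expfz_neq0//; exact: yz.
- by rewrite expfz_neq0//; exact: yv.
Qed.

Lemma mono_inv (y : P) m1 m2 m3 : mono (y.1, y.2^-1) m1 m2 m3 = mono y m1 m2 (- m3).
Proof. by rewrite /mono /coord_v /= exprz_inv. Qed.

Lemma mono_sqrt (y : P) m1 m2 m3 : mono (sqrt_point y) m1 m2 m3 ^+ 2 = mono y m1 m2 m3.
Proof.
have S (c : C) m : (sqrtC c ^ m) ^+ 2 = c ^ m by rewrite exprnP exprzAC -exprnP sqrtCK.
rewrite /mono !exprMn S -!prodrXl; congr (_ * _ * _); apply: eq_bigr => k _.
  by rewrite /coord_a /= mxE S.
by rewrite /coord_z /= mxE S.
Qed.

Lemma torus_sqrt (y : P) : torus y -> torus (sqrt_point y).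
Proof.
move=> [ya [yz yv]]; split; [|split] => [k|k|] /=; rewrite ?mxE sqrtC_eq0.
- exact: ya. - exact: yz. - exact: yv.
Qed.

Lemma int_power_between (rho t : R) (m l : int) : t ^ m = rho ^ l ->
  1 < t ^+ `|m|%N -> t ^+ `|m|%N < rho^-1 -> exists p : int, 1 < rho ^ p /\ rho ^ p < rho^-1.
Proof.
case: m => k E h1 h2; first by exists l; rewrite -E.
exists (- l); rewrite -invr_expz -E.
by rewrite NegzE -exprnN invrK -[k.+1]absz_nat -abszN -NegzE.
Qed.

(** If c is itself a power of q, then scaling it by (1 + s)^m with a small s >
    0 changes |c| by a factor strictly between 1 and 1/|q|, up to inversion. *)
Lemma near_power_free (q : C) (c : C) (m : int) (e : R) : normc q < 1 -> q != 0 -> m != 0 ->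
  0 < e -> exists s : R, [/\ 0 <= s, s < e & forall l : int, (1 + s%:C%C) ^ m * c != q ^ l].
Proof.
move=> q1 q0 m0 e0.
have [[l0 El]|N] := pselect (exists l, c = q ^ l); last first.
  exists 0; split => // l; apply/eqP; rewrite addr0 exp1rz mul1r => h; apply: N.
  by exists l.
have rq : 0 < normc q by rewrite normc_gt0.
pose n := `|m|%N.
(* By convexity of (1 + s)^k in s on the interval [0, 1]. *)
have bern (s : R) k : 0 <= s <= 1 -> (1 + s) ^+ k <= 1 + s * (2 ^+ k - 1).
  move=> /andP[s0 s1]; elim: k => [|k IH]; first by rewrite !expr0 subrr mulr0 addr0.
  rewrite !exprS; apply: le_trans (ler_wpM2l _ IH) _; first by lra.
  have k1 : 1 <= (2 : R) ^+ k by rewrite exprn_ege1// ler1n.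
  set t := 2 ^+ k in k1 *.
  have : s * (s * (t - 1)) <= s * (t - 1) by rewrite ler_piMl// mulr_ge0 ?subr_ge0.
  lra.
pose b := (normc q)^-1 - 1.
have b0 : 0 < b by rewrite subr_gt0 invf_gt1.
have t0 : 0 < (2 : R) ^+ n.+1 by rewrite exprn_gt0.
pose s := Num.min (Num.min 1 (e / 2)) (b / 2 ^+ n.+1).
have s0 : 0 < s by rewrite !lt_min ltr01 !divr_gt0.
have s1 : s <= 1 by rewrite !ge_min lexx.
have se : s < e.
  apply: (@le_lt_trans _ _ (e / 2)); first by rewrite !ge_min lexx !orbT.
  lra.
have sb : (1 + s) ^+ n < (normc q)^-1.
  apply: le_lt_trans (bern s n _) _; first by rewrite (ltW s0) s1.
  have : s <= b / 2 ^+ n.+1 by rewrite ge_min lexx orbT.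
  rewrite ler_pdivlMr// exprS /b.
  have : 0 < s * 2 ^+ n by rewrite mulr_gt0// exprn_gt0.
  lra.
have n0 : (0 < n)%N by rewrite absz_gt0.
have s1n : 1 < (1 + s) ^+ n by rewrite exprn_egt1 ?ltrDl// -lt0n.
exists s; split => //; first exact: ltW.
move=> l; apply/eqP => h.
have ns : normc (1 + s%:C%C) = 1 + s.
  by rewrite -[1 in LHS]/((1 : R)%:C%C) -rmorphD normc_real//; lra.
have E : (1 + s) ^ m = normc q ^ (l - l0).
  have /(congr1 (@normc R)) : (1 + s%:C%C) ^ m = q ^ (l - l0).
    by rewrite expfzDr// -h El -mulrA -expfzDr// subrr mulr1.
  by rewrite !normcXz ns.
have [p [p1 p2]] := int_power_between E s1n sb.
have p0 : p < 0.
  rewrite ltNge; apply/negP => p0; move: p1; rewrite ltNge => /negP; apply.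
  by case: p p0 p2 => k //= _ _; rewrite -exprnP exprn_ile1 ?normc_ge0 ?ltW.
move: p2; rewrite ltNge => /negP; apply.
case: p p0 p1 => k // _ _; rewrite NegzE -exprnN lef_pV2 ?posrE ?exprn_gt0//.
by rewrite exprS ler_piMr ?normc_ge0// exprn_ile1 ?normc_ge0 ?ltW.
Qed.

Lemma nbhs_add (x h : P) (B : set P) : nbhs x B ->
  exists2 e, 0 < e & forall h : P, nrm h < e -> B (x + h).
Proof.
move=> /nbhsC[e e0 H]; exists e => // h' hh; apply: H; by rewrite addrC addKr.
Qed.

(** Scaling a single coordinate by 1 + s multiplies the monomial by a power of
    1 + s, so that [near_power_free] applies. *)
Lemma mono_generic (q : C) (x : P) m1 m2 m3 (B : set P) :
  normc q < 1 -> q != 0 -> torus x -> nbhs x B ->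
  (exists k, m1 k != 0) \/ (exists k, m2 k != 0) ->
  exists y, [/\ B y, torus y & forall l : int, mono y m1 m2 m3 != q ^ l].
Proof.
move=> q1 q0 Tx Bx Hm.
have [e e0 He] := nbhs_add 0 Bx.
have [xa [xz xv]] := Tx.
have {}xa k : coord_a k x != 0 by exact: xa.
have {}xz k : coord_z k x != 0 by exact: xz.
have key (h : P) (m : int) : m != 0 ->
   (forall s : R, 0 <= s -> torus (x + s%:C%C *: h) /\
     mono (x + s%:C%C *: h) m1 m2 m3 = (1 + s%:C%C) ^ m * mono x m1 m2 m3) ->
   exists y, [/\ B y, torus y & forall l : int, mono y m1 m2 m3 != q ^ l].
  move=> m0 H; have h1 : 0 < nrm h + 1 by rewrite ltr_wpDl ?nrm_ge0.
  have [s [s0 se Hs]] := near_power_free (mono x m1 m2 m3) q1 q0 m0 (divr_gt0 e0 h1).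
  have [Ty E] := H s s0; exists (x + s%:C%C *: h); split => //; last first.
    by move=> l; rewrite E.
  apply: He; rewrite nrmZ normc_real//; move: se; rewrite ltr_pdivlMr//.
  by apply: le_lt_trans; rewrite ler_wpM2l// lerDl.
have sc (s : R) (c : C) : 0 <= s -> c != 0 -> c + s%:C%C * c != 0.
  move=> s0 c0; rewrite -[X in X + _]mul1r -mulrDl mulf_neq0//.
  rewrite -[1]/((1 : R)%:C%C) -rmorphD fmorph_eq0; lra.
case: Hm => [[k mk]|[k mk]].
  pose h : P := (\row_j (if j == k then coord_a k x else 0), 0, 0).
  apply: (key h (m1 k) mk) => s s0.
  have cav j : coord_a j (x + s%:C%C *: h) = if j == k then (1 + s%:C%C) * coord_a k x else coord_a j x.
    rewrite /coord_a /= !mxE; case: eqP => [->|_]; last by rewrite mulr0 addr0.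
    by rewrite mulrDl mul1r.
  have czv j : coord_z j (x + s%:C%C *: h) = coord_z j x by rewrite /coord_z /= scaler0 addr0.
  have cvv : coord_v (x + s%:C%C *: h) = coord_v x by rewrite /coord_v /= scaler0 addr0.
  split.
    split=> [j|]; last split => [j|].
    - rewrite -/(coord_a j _) cav; case: (j =P k) => _; last by exact: xa.
      by rewrite mulrDl mul1r; apply: sc => //; exact: xa.
    - by rewrite -/(coord_z j _) czv; exact: xz.
    - by rewrite -/(coord_v _) cvv; exact: xv.
  rewrite /mono cvv (eq_bigr (fun k => coord_z k x ^ m2 k)); last by move=> j _; rewrite czv.
  rewrite !mulrA; congr (_ * _ * _).
  rewrite (bigD1 k isT) /= [in RHS](bigD1 k isT) /= cav eqxx exprzMl; last 2 first.
  - rewrite unitfE -[1]/((1 : R)%:C%C) -rmorphD fmorph_eq0; lra.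
  - by rewrite unitfE; exact: xa.
  rewrite mulrA; congr (_ * _); apply: eq_bigr => j /negPf jk; by rewrite cav jk.
pose h : P := (0, \row_j (if j == k then coord_z k x else 0), 0).
apply: (key h (m2 k) mk) => s s0.
have czv j : coord_z j (x + s%:C%C *: h) = if j == k then (1 + s%:C%C) * coord_z k x else coord_z j x.
  rewrite /coord_z /= !mxE; case: eqP => [->|_]; last by rewrite mulr0 addr0.
  by rewrite mulrDl mul1r.
have cav j : coord_a j (x + s%:C%C *: h) = coord_a j x by rewrite /coord_a /= scaler0 addr0.
have cvv : coord_v (x + s%:C%C *: h) = coord_v x by rewrite /coord_v /= scaler0 addr0.
split.
  split=> [j|]; last split => [j|].
  - by rewrite -/(coord_a j _) cav; exact: xa.
  - rewrite -/(coord_z j _) czv; case: (j =P k) => _; last exact: xz.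
    by rewrite mulrDl mul1r; apply: sc => //; exact: xz.
  - by rewrite -/(coord_v _) cvv; exact: xv.
rewrite /mono cvv (eq_bigr (fun k => coord_a k x ^ m1 k)); last by move=> j _; rewrite cav.
suff -> : \prod_j coord_z j (x + s%:C%C *: h) ^ m2 j =
   (1 + s%:C%C) ^ m2 k * \prod_j coord_z j x ^ m2 j by ring.
rewrite (bigD1 k isT) /= [in RHS](bigD1 k isT) /= czv eqxx exprzMl; last 2 first.
- rewrite unitfE -[1]/((1 : R)%:C%C) -rmorphD fmorph_eq0; lra.
- by rewrite unitfE; exact: xz.
rewrite mulrA; congr (_ * _); apply: eq_bigr => j /negPf jk; by rewrite czv jk.
Qed.

End Torus.

(** * Classes of meromorphic functions *)

Section Mero.
Variables (R : realType) (d r : nat).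
Local Notation C := R[i].
Local Notation P := (tpoint R d r).
Local Notation M := (merofield R d r).
Local Notation piM := (\pi_({ideal_quot (null_mero (R:=R) (d:=d) (r:=r))})%qT).
Implicit Types f g : P -> C.

Let FF (x : P) : Filter (nbhs x). Proof. exact: nbhs_filter. Qed.

Lemma torus_nbhs (x : P) : torus x -> nbhs x (@torus R d r).
Proof. by move=> Tx; apply: open_nbhs_nbhs; split => //; exact: torus_open. Qed.

Lemma insubd_mero f : meromorphic f -> (insubd (0 : mero_fun R d r) f : P -> C) = f.
Proof. by move=> mf; rewrite -[LHS]/(\val _) insubdK//; apply/asboolP. Qed.

(** The relation by which the ring of meromorphic functions is divided. *)
Definition gen_eq f g := exists D : set P,
    [/\ open D, (D `<=` @torus R d r)%classic, (@torus R d r `<=` closure D)%classic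
      & forall y, D y -> f y = g y].

Lemma mclass_gen_eq f g : meromorphic f -> meromorphic g -> gen_eq f g ->
  mclass f = mclass g.
Proof.
move=> mf mg [D [oD sD dD E]]; apply/eqP; rewrite /mclass -Quotient.idealrBE.
apply/asboolP; exists D; split => // y Dy.
have -> : (insubd (0 : mero_fun R d r) f - insubd 0 g : mero_fun R d r) y =
  (insubd (0 : mero_fun R d r) f : P -> C) y - (insubd (0 : mero_fun R d r) g : P -> C) y by [].
by rewrite !insubd_mero// E// subrr.
Qed.

Lemma mclass_eqP f g : meromorphic f -> meromorphic g -> mclass f = mclass g -> gen_eq f g.
Proof.
move=> mf mg /eqP; rewrite /mclass -Quotient.idealrBE => /asboolP[D [oD sD dD E]].
exists D; split => // y Dy; have := E y Dy.
have -> : (insubd (0 : mero_fun R d r) f - insubd 0 g : mero_fun R d r) y =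
  (insubd (0 : mero_fun R d r) f : P -> C) y - (insubd (0 : mero_fun R d r) g : P -> C) y by [].
by rewrite !insubd_mero// => /eqP; rewrite subr_eq0 => /eqP.
Qed.

Lemma gen_eq_torus f g : (forall x, torus x -> f x = g x) -> gen_eq f g.
Proof.
move=> H; exists (@torus R d r); split => //; first exact: torus_open.
exact: subset_closure.
Qed.

Lemma mero_ext f g : (forall x, torus x -> f x = g x) -> meromorphic f -> meromorphic g.
Proof.
move=> H mf x Tx; have [W [u [h [oW Wx [hu hh] dW E]]]] := mf x Tx.
exists (W `&` @torus R d r)%classic, u, h; split.
- by apply: openI => //; exact: torus_open.
- by [].
- by split=> y [Wy _]; [exact: hu|exact: hh].
- move=> y [Wy Ty] B By.
  have [z [[Wz hz] [Bz Tz]]] := dW y Wy _ (filterI By (torus_nbhs Ty)).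
  by exists z.
- by move=> y [Wy Ty] hy; rewrite -H// E.
Qed.

(** Either both functions are meromorphic, or neither is; in the second case
    both classes are 0 by convention. *)
Lemma mclass_ext f g : (forall x, torus x -> f x = g x) -> mclass f = mclass g.
Proof.
move=> H; have [mf|nf] := pselect (meromorphic f).
  apply: mclass_gen_eq => //; first exact: mero_ext mf.
  exact: gen_eq_torus.
have ng : ~ meromorphic g.
  by move=> mg; apply: nf; apply: mero_ext mg => x Tx; rewrite H.
rewrite /mclass; apply: (congr1 piM).
by rewrite /insubd !insubF//; apply/asboolPn.
Qed.

Lemma mclassM f g : meromorphic f -> meromorphic g ->
  mclass (fun x => f x * g x) = mclass f * mclass g.
Proof.
move=> mf mg; rewrite /mclass -rmorphM; apply: (congr1 piM).
apply: val_inj; apply: funext => x /=.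
have mfg : meromorphic (fun x => f x * g x) by exact: meromorphic_mul.
rewrite insubd_mero//.
transitivity ((insubd (0 : mero_fun R d r) f : P -> C) x * (insubd (0 : mero_fun R d r) g : P -> C) x); last by [].
by rewrite !insubd_mero.
Qed.

Lemma mero_add f g : meromorphic f -> meromorphic g -> meromorphic (fun x => f x + g x).
Proof.
move=> mf mg; have m0 : meromorphic (0 : P -> C).
  by have := meromorphic_sub mg mg; rewrite subrr.
have := meromorphic_sub mf (meromorphic_sub m0 mg).
by rewrite sub0r opprK.
Qed.

Lemma mclassD f g : meromorphic f -> meromorphic g ->
  mclass (fun x => f x + g x) = mclass f + mclass g.
Proof.
move=> mf mg; rewrite /mclass -rmorphD; apply: (congr1 piM).
apply: val_inj; apply: funext => x /=.
rewrite insubd_mero//; last exact: mero_add.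
transitivity ((insubd (0 : mero_fun R d r) f : P -> C) x + (insubd (0 : mero_fun R d r) g : P -> C) x); last by [].
by rewrite !insubd_mero.
Qed.

Definition holo f := forall x : P, torus x -> differentiable f x.

Lemma holo_mero f : holo f -> meromorphic f.
Proof.
move=> hf x Tx; exists (@torus R d r), f, (fun=> 1); split.
- exact: torus_open.
- by [].
- by split=> y Ty; [exact: hf|exact: differentiable_cst].
- by move=> y Ty; apply: subset_closure; split => //=; exact: oner_neq0.
- by move=> y Ty _; rewrite divr1.
Qed.

Lemma mero_cst c : meromorphic (fun _ : P => c).
Proof. by apply: holo_mero => x _; exact: differentiable_cst. Qed.

Lemma mclass1 : mclass (fun _ : P => 1 : C) = 1.
Proof.
rewrite /mclass -[RHS](rmorph1 (\pi_({ideal_quot (null_mero (R:=R) (d:=d) (r:=r))})%qT)).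
apply: (congr1 piM); apply: val_inj; apply: funext => x /=.
by rewrite insubd_mero//; exact: mero_cst.
Qed.

Lemma mclass0 : mclass (fun _ : P => 0 : C) = 0.
Proof.
rewrite /mclass -[RHS](rmorph0 (\pi_({ideal_quot (null_mero (R:=R) (d:=d) (r:=r))})%qT)).
apply: (congr1 piM); apply: val_inj; apply: funext => x /=.
by rewrite insubd_mero//; exact: mero_cst.
Qed.

Lemma mero_sum (I : Type) (s : seq I) (f : I -> P -> C) : (forall i, meromorphic (f i)) ->
  meromorphic (fun x => \sum_(i <- s) f i x) /\
  mclass (fun x => \sum_(i <- s) f i x) = \sum_(i <- s) mclass (f i).
Proof.
move=> H; elim: s => [|i s [IH1 IH2]].
  rewrite big_nil; under [X in mclass X]funext do rewrite big_nil.
  split; last exact: mclass0.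
  under [X in meromorphic X]funext do rewrite big_nil; exact: mero_cst.
rewrite big_cons -IH2 -mclassD//; under [X in mclass X]funext do rewrite big_cons.
split => //; under [X in meromorphic X]funext do rewrite big_cons.
exact: mero_add.
Qed.

Lemma mero_prod (I : Type) (s : seq I) (f : I -> P -> C) : (forall i, meromorphic (f i)) ->
  meromorphic (fun x => \prod_(i <- s) f i x) /\
  mclass (fun x => \prod_(i <- s) f i x) = \prod_(i <- s) mclass (f i).
Proof.
move=> H; elim: s => [|i s [IH1 IH2]].
  rewrite big_nil; under [X in mclass X]funext do rewrite big_nil.
  split; last exact: mclass1.
  under [X in meromorphic X]funext do rewrite big_nil; exact: mero_cst.
rewrite big_cons -IH2 -mclassM//; under [X in mclass X]funext do rewrite big_cons.
split => //; under [X in meromorphic X]funext do rewrite big_cons.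
exact: meromorphic_mul.
Qed.

Definition dense_neq0 f := forall x : P, torus x -> forall B, nbhs x B ->
  exists y, [/\ B y, torus y & f y != 0].

Lemma mero_inv f : holo f -> dense_neq0 f -> meromorphic (fun x => (f x)^-1).
Proof.
move=> hf nf x Tx; exists (@torus R d r), (fun=> 1), f; split.
- exact: torus_open.
- by [].
- by split=> y Ty; [exact: differentiable_cst|exact: hf].
- by move=> y Ty B By; have [z [Bz Tz fz]] := nf y Ty B By; exists z.
- by move=> y Ty _; rewrite div1r.
Qed.

(** The product of f and 1/f is 1 away from the zeros of f, that is, on a
    dense open set. Invertibility is expressed by an equation, since the
    quotient is presented as a ring. *)
Lemma mclassV f : holo f -> dense_neq0 f ->
  mclass f * mclass (fun x => (f x)^-1) = 1.
Proof.
move=> hf nf; rewrite -mclassM; [|exact: holo_mero|exact: mero_inv].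
rewrite -mclass1; apply: mclass_gen_eq; [|exact: mero_cst|].
  by apply: meromorphic_mul; [exact: holo_mero|exact: mero_inv].
exists [set x | torus x /\ f x != 0]%classic; split.
- rewrite openE => x [Tx fx]; rewrite /interior /=.
  have := differentiable_continuous (hf x Tx).
  move=> /(_ [set c | c != 0]%classic) H; apply: filterI; first exact: torus_nbhs.
  by apply: H; apply: open_nbhs_nbhs; split => //; exact: open_neq0.
- by move=> x [].
- by move=> x Tx B Bx; have [z [Bz Tz fz]] := nf x Tx B Bx; exists z.
- by move=> x [Tx fx]; rewrite mulfV.
Qed.

Definition iota_v (x : P) : P := (x.1, x.2^-1).

Lemma iota_vK : involutive iota_v.
Proof. by move=> [a v]; rewrite /iota_v /= invrK. Qed.

Lemma iota_torus x : torus x -> torus (iota_v x).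
Proof. by move=> [ya [yz yv]]; split=> //; split => //=; rewrite invr_eq0. Qed.

Lemma iota_diff (x : P) : torus x -> differentiable iota_v x.
Proof.
move=> [_ [_ xv]].
apply: differentiable_pair.
  apply: (@linear_differentiable _ _ _ (@fst ('rV[C]_d * 'rV[C]_r) C) x).
  by move=> y; exact: cvg_fst.
have e0 : 0 < Num.min 1 (normc x.2 / 2) by rewrite lt_min ltr01 divr_gt0// normc_gt0.
have [|||K g] := @expands_linear_inv _ _ x (Num.min 1 (normc x.2 / 2)) (fun y : P => y.2) _ _ xv.
- by [].
- by move=> h; rewrite nrm_pair le_max -nrmC lexx orbT.
- by rewrite ge_min lexx orbT.
by apply: expands_differentiable g.
Qed.

Lemma iota_cont (x : P) (B : set P) : torus x -> nbhs (iota_v x) B -> nbhs x (iota_v @^-1` B)%classic.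
Proof. by move=> Tx; exact: differentiable_continuous (iota_diff Tx) _. Qed.

Lemma mero_iota f : meromorphic f -> meromorphic (fun x => f (iota_v x)).
Proof.
move=> mf x Tx; have [W [u [h [oW Wx [hu hh] dW E]]]] := mf _ (iota_torus Tx).
exists [set y | torus y /\ W (iota_v y)]%classic, (u \o iota_v), (h \o iota_v); split.
- rewrite openE => y [Ty Wy]; apply: filterI; first exact: torus_nbhs.
  by apply: iota_cont => //; exact: open_nbhs_nbhs.
- by [].
- by split=> y [Ty Wy]; apply: differentiable_comp; try exact: iota_diff; [exact: hu|exact: hh].
- move=> y [Ty Wy] B By.
  have By' : nbhs (iota_v y) (iota_v @^-1` (B `&` @torus R d r))%classic.
    apply: iota_cont; first exact: iota_torus.
    by rewrite iota_vK; apply: filterI => //; exact: torus_nbhs.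
  have [z [[Wz hz] [Bz Tz]]] := dW _ Wy _ By'.
  by exists (iota_v z); split => //; rewrite /= iota_vK.
- by move=> y [Ty Wy] hy; exact: E.
Qed.

Lemma gen_eq_iota f g : gen_eq f g -> gen_eq (fun x => f (iota_v x)) (fun x => g (iota_v x)).
Proof.
move=> [D [oD sD dD E]]; exists [set y | torus y /\ D (iota_v y)]%classic; split.
- rewrite openE => y [Ty Dy]; apply: filterI; first exact: torus_nbhs.
  by apply: iota_cont => //; exact: open_nbhs_nbhs.
- by move=> y [].
- move=> y Ty B By.
  have By' : nbhs (iota_v y) (iota_v @^-1` (B `&` @torus R d r))%classic.
    apply: iota_cont; first exact: iota_torus.
    by rewrite iota_vK; apply: filterI => //; exact: torus_nbhs.
  have [z [Dz [Bz Tz]]] := dD _ (iota_torus Ty) _ By'.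
  by exists (iota_v z); split => //; rewrite /= iota_vK.
- by move=> y [Ty Dy]; exact: E.
Qed.

Lemma mero_repr (m : M) : meromorphic (repr m : mero_fun R d r).
Proof. exact/asboolP/(valP (repr m)). Qed.

Lemma mclass_repr (m : M) : mclass (repr m : mero_fun R d r) = m.
Proof.
rewrite /mclass -[RHS]reprK; apply: (congr1 piM); apply: val_inj => /=.
by rewrite insubd_mero//; exact: mero_repr.
Qed.

(** The map v -> 1/v preserves dense open subsets of the torus, so the choice
    of the representative does not matter. *)
Lemma bar_mclass f : meromorphic f -> bar (mclass f) = mclass (fun x => f (iota_v x)).
Proof.
move=> mf; rewrite /bar; apply: mclass_gen_eq.
- exact: mero_iota (mero_repr _).
- exact: mero_iota.
apply: gen_eq_iota; apply: mclass_eqP => //; first exact: mero_repr.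
by rewrite mclass_repr.
Qed.

Lemma barM (m m' : M) : bar (m * m') = bar m * bar m'.
Proof.
rewrite -(mclass_repr m) -(mclass_repr m'); set f := (repr m : P -> C); set g := (repr m' : P -> C).
have [mf mg] : meromorphic f /\ meromorphic g by split; exact: mero_repr.
rewrite -mclassM// !bar_mclass//; last exact: meromorphic_mul.
by rewrite -mclassM//; exact: mero_iota.
Qed.

Lemma barD (m m' : M) : bar (m + m') = bar m + bar m'.
Proof.
rewrite -(mclass_repr m) -(mclass_repr m'); set f := (repr m : P -> C); set g := (repr m' : P -> C).
have [mf mg] : meromorphic f /\ meromorphic g by split; exact: mero_repr.
rewrite -mclassD// !bar_mclass//; last exact: mero_add.
by rewrite -mclassD//; exact: mero_iota.
Qed.

Lemma bar_cst c : bar (mclass (fun _ : P => c)) = mclass (fun _ : P => c).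
Proof. by rewrite bar_mclass//; exact: mero_cst. Qed.

Lemma bar0 : bar (0 : M) = 0.
Proof. by rewrite -mclass0 bar_cst. Qed.

Lemma bar1 : bar (1 : M) = 1.
Proof. by rewrite -mclass1 bar_cst. Qed.

End Mero.

(** * Dual exact sequences of lattices and their bases *)

Section Split.
Variables (n d r : nat).

Definition ker m (a : 'M[int]_(n, m)) (x : 'rV[int]_n) : Prop := x *m a = 0.

(** The exact sequence of lattices together with a splitting s, p. The four
    equations are stable under transposition; this makes the duality between a
    and b formal ([split_pair_sym]). *)
Definition split_pair d r (a : 'M[int]_(n, d)) (b : 'M[int]_(n, r)) : Prop :=
  exists (s : 'M[int]_(d, n)) (p : 'M[int]_(n, r)),
    [/\ s *m a = 1%:M, b^T *m a = 0, a *m s + p *m b^T = 1%:M & b^T *m p = 1%:M].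

Lemma split_pair_sym d' r' (a : 'M[int]_(n, d')) (b : 'M[int]_(n, r')) :
  split_pair a b -> split_pair b a.
Proof.
move=> [s [p [sa ba sp bp]]]; exists p^T, s^T; split.
- by rewrite -[b]trmxK -trmx_mul bp trmx1.
- by rewrite -[b]trmxK -trmx_mul ba trmx0.
- by rewrite -[b]trmxK -!trmx_mul -linearD /= addrC sp trmx1.
- by rewrite -trmx_mul sa trmx1.
Qed.

(** The quotient lattice is free. *)
Lemma hk_split (D : toric_data n d r) : toric_hyperkahler D -> split_pair (ta D) (tb D).
Proof.
move=> hD; set a := ta D; set b := tb D.
have /choice[sf Hs] : forall i : 'I_d, exists x : 'rV_n, x *m a = delta_mx 0 i.
  by move=> i; exact: hk_surj hD _.
pose s := \matrix_i sf i.
have sa : s *m a = 1%:M.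
  by apply/row_matrixP => i; rewrite row_mul rowK Hs rowE mulmx1.
have ba : b^T *m a = 0.
  apply/row_matrixP => i; rewrite row_mul row0; apply/(hk_exact hD).
  by exists (delta_mx 0 i); rewrite rowE.
have /choice[pf Hp] : forall i : 'I_n, exists w : 'rV_r, row i (1%:M - a *m s) = w *m b^T.
  move=> i; apply/(hk_exact hD); rewrite -row_mul mulmxBl mul1mx -mulmxA sa mulmx1.
  by rewrite subrr row0.
pose p := \matrix_i pf i.
have sp : a *m s + p *m b^T = 1%:M.
  apply/row_matrixP => i; rewrite linearD /= [row i (p *m _)]row_mul rowK -Hp.
  by rewrite linearB /= addrC subrK.
exists s, p; split => //.
apply/row_matrixP => i; apply/eqP; rewrite -subr_eq0; apply/eqP; apply: (hk_inj hD).
rewrite mulmxBl !row_mul -!row_mul -mulmxA.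
have : b^T *m (a *m s + p *m b^T) = b^T by rewrite sp mulmx1.
rewrite mulmxDr mulmxA ba mul0mx add0r => ->.
by rewrite mul1mx subrr.
Qed.

Section Pair.
Variables (d' r' : nat) (a : 'M[int]_(n, d')) (b : 'M[int]_(n, r')).
Hypothesis ab : split_pair a b.

Lemma kerP x : ker a x <-> exists w, x = w *m b^T.
Proof.
have [s [p [sa ba sp bp]]] := ab; split=> [xa|[w ->]]; last by rewrite /ker -mulmxA ba mulmx0.
exists (x *m p); rewrite -[LHS]mulmx1 -sp mulmxDr mulmxA xa mul0mx add0r.
by rewrite mulmxA.
Qed.

Lemma dot_mx k (x y : 'rV[int]_k) : dot x y = (x *m y^T) 0 0.
Proof. by rewrite mxE; apply: eq_bigr => i _; rewrite mxE. Qed.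

Lemma dotC k (x y : 'rV[int]_k) : dot x y = dot y x.
Proof. by apply: eq_bigr => i _; rewrite mulrC. Qed.

Lemma dot_ker x y : ker a x -> ker b y -> dot x y = 0.
Proof.
move=> /kerP[w ->]; rewrite /ker dot_mx -mulmxA -trmx_mul => ->.
by rewrite trmx0 mulmx0 mxE.
Qed.

Lemma ker_dot y : (forall x, ker a x -> dot x y = 0) -> ker b y.
Proof.
move=> H; apply/rowP => j; rewrite mxE [RHS]mxE.
have /H : ker a (row j b^T) by apply/kerP; exists (delta_mx 0 j); rewrite rowE.
by rewrite dotC /dot => h; rewrite -[RHS]h; apply: eq_bigr => i _; rewrite !mxE.
Qed.

Lemma a_surj (y : 'rV_d') : exists x, x *m a = y.
Proof. by have [s [p [sa _ _ _]]] := ab; exists (y *m s); rewrite -mulmxA sa mulmx1. Qed.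

Lemma bT_inj (w w' : 'rV_r') : w *m b^T = w' *m b^T -> w = w'.
Proof.
have [s [p [_ _ _ bp]]] := ab => /(congr1 (mulmx^~ p)).
by rewrite -!mulmxA bp !mulmx1.
Qed.

Lemma lattice_coordK x : ker a x -> lattice_coord b x *m b^T = x.
Proof.
move=> /kerP[w ->]; rewrite /lattice_coord.
by case: xgetP => [u _ //|/(_ w)] /=.
Qed.

Lemma pairingE eta y x : y *m b = eta -> ker a x -> pairing b eta x = dot y x.
Proof.
move=> <- xa; rewrite /pairing -{2}(lattice_coordK xa) !dot_mx trmx_mul trmxK.
by rewrite mulmxA.
Qed.
End Pair.

Definition supported (I : {set 'I_n}) (x : 'rV[int]_n) := forall k, k \notin I -> x 0 k = 0.

Lemma supported_mulmx d' (a : 'M[int]_(n, d')) I x : supported I x ->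
  x *m a = \sum_(i in I) x 0 i *: row i a.
Proof.
move=> sx; rewrite mulmx_sum_row (bigID (mem I)) /= [X in _ + X]big1 ?addr0// => i iI.
by rewrite sx ?scale0r.
Qed.

Definition mask (I : {set 'I_n}) (c : 'I_n -> int) : 'rV[int]_n :=
  \row_k (if k \in I then c k else 0).

Lemma mask_supported I c : supported I (mask I c).
Proof. by move=> k kI; rewrite mxE (negPf kI). Qed.

Lemma mask_mulmx d' (a : 'M[int]_(n, d')) I c :
  mask I c *m a = \sum_(i in I) c i *: row i a.
Proof.
by rewrite (supported_mulmx _ (@mask_supported I c)); apply: eq_bigr => i iI; rewrite mxE iI.
Qed.

Lemma independentP d' (a : 'M[int]_(n, d')) I :
  independent a I <-> forall x, ker a x -> supported I x -> x = 0.
Proof.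
split=> [H x xa sx|H c]; last first.
  rewrite -mask_mulmx => h i iI.
  have /rowP/(_ i) := H _ h (@mask_supported I c).
  by rewrite !mxE iI.
rewrite /ker (supported_mulmx _ sx) in xa; apply/rowP => k; rewrite mxE.
have [kI|kI] := boolP (k \in I); last exact: sx.
exact: (H (fun i => x 0 i)).
Qed.

(** In terms of the kernel: every assignment of values off I extends to an
    element of the kernel of a. *)
Lemma generatingP d' r' (a : 'M[int]_(n, d')) (b : 'M[int]_(n, r')) I : split_pair a b ->
  generating a I <-> forall y : 'rV[int]_n, exists2 z, ker a z & forall k, k \notin I -> z 0 k = y 0 k.
Proof.
move=> ab; split=> [H y|H y].
  have [c Hc] := H (y *m a); exists (y - mask I c).
    by rewrite /ker mulmxBl mask_mulmx -Hc subrr.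
  by move=> k kI; rewrite !mxE (negPf kI) subr0.
have [x <-] := a_surj ab y; have [z za Hz] := H x.
exists (fun k => x 0 k - z 0 k); rewrite -mask_mulmx.
have -> : mask I (fun k => x 0 k - z 0 k) = x - z.
  apply/rowP => k; rewrite !mxE; case: ifP => // /negbT /Hz ->; by rewrite subrr.
by rewrite mulmxBl za subr0.
Qed.

Lemma basesP d' (a : 'M[int]_(n, d')) I : I \in bases a <-> independent a I /\ generating a I.
Proof. by rewrite /bases; split=> [/asboolP|?]//; apply/asboolP. Qed.

Section Basis.
Variables (d' r' : nat) (a : 'M[int]_(n, d')) (b : 'M[int]_(n, r')).
Hypothesis ab : split_pair a b.
Variable I : {set 'I_n}.
Hypothesis IB : I \in bases a.

Lemma basis_ker0 x : ker a x -> supported I x -> x = 0.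
Proof. by have [/independentP H _] := (basesP a I).1 IB; exact: H. Qed.

Lemma basis_ex (j : 'I_n) : exists x, ker a x /\ forall k, k \notin I -> x 0 k = (j == k)%:R.
Proof.
have [_ /(generatingP _ ab)/(_ (delta_mx 0 j))[z za Hz]] := (basesP a I).1 IB.
by exists z; split => // k /Hz ->; rewrite mxE eqxx eq_sym.
Qed.

(** The fundamental circuit vector of j with respect to the basis I. *)
Definition fund_vec (j : 'I_n) : 'rV[int]_n := projT1 (cid (basis_ex j)).
Lemma fund_vec_ker j : ker a (fund_vec j).
Proof. by have [] := projT2 (cid (basis_ex j)). Qed.
Lemma fund_vec_val j k : k \notin I -> fund_vec j 0 k = (j == k)%:R.
Proof. by have [_] := projT2 (cid (basis_ex j)); apply. Qed.

Lemma kerD d0 (c : 'M[int]_(n, d0)) x y : ker c x -> ker c y -> ker c (x + y).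
Proof. by rewrite /ker mulmxDl => -> ->; rewrite addr0. Qed.
Lemma kerZ d0 (c : 'M[int]_(n, d0)) k x : ker c x -> ker c (k *: x).
Proof. by rewrite /ker -scalemxAl => ->; rewrite scaler0. Qed.
Lemma kerN d0 (c : 'M[int]_(n, d0)) x : ker c x -> ker c (- x).
Proof. by rewrite /ker mulNmx => ->; rewrite oppr0. Qed.
Lemma kerB d0 (c : 'M[int]_(n, d0)) x y : ker c x -> ker c y -> ker c (x - y).
Proof. by move=> hx hy; apply: kerD => //; exact: kerN. Qed.
Lemma ker0 d0 (c : 'M[int]_(n, d0)) : ker c 0.
Proof. by rewrite /ker mul0mx. Qed.
Lemma ker_sum d0 (c : 'M[int]_(n, d0)) (J : Type) (s : seq J) (P : pred J) F :
  (forall j, P j -> ker c (F j)) -> ker c (\sum_(j <- s | P j) F j).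
Proof. by move=> H; apply: big_ind => //; [exact: ker0|exact: kerD]. Qed.

Lemma ker_fund_vec x : ker a x -> x = \sum_(j in ~: I) x 0 j *: fund_vec j.
Proof.
move=> xa; apply/eqP; rewrite -subr_eq0; apply/eqP; apply: basis_ker0.
  by apply: kerB => //; apply: ker_sum => j _; apply: kerZ; exact: fund_vec_ker.
move=> k kI; rewrite !mxE summxE (bigD1 k) ?inE//= !mxE fund_vec_val// eqxx mulr1 big1 ?addr0 ?subrr//.
by move=> j /andP[_ /negPf jk]; rewrite !mxE fund_vec_val// jk mulr0.
Qed.

Lemma ker_eq x y : ker a x -> ker a y -> (forall k, k \notin I -> x 0 k = y 0 k) -> x = y.
Proof.
move=> xa ya H; apply/eqP; rewrite -subr_eq0; apply/eqP; apply: basis_ker0.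
  exact: kerB.
by move=> k kI; rewrite !mxE H// subrr.
Qed.

(** Gale duality. An element of the kernel of b supported off I is determined
    by its pairings with the fundamental vectors, which give its coordinates;
    and prescribed values on I extend to a vector orthogonal to all the
    fundamental vectors. *)
Lemma bases_compl : ~: I \in bases b.
Proof.
have ba := split_pair_sym ab.
apply/basesP; split.
  apply/independentP => x xb sx; apply/rowP => j; rewrite [RHS]mxE.
  have [jI|jI] := boolP (j \in I); first by apply: sx; rewrite inE negbK.
  have := dot_ker ab (fund_vec_ker j) xb; rewrite /dot (bigD1 j)//= fund_vec_val// eqxx mul1r big1 ?addr0//.
  move=> k kj; have [kI|kI] := boolP (k \in I); first by rewrite sx ?mulr0// inE negbK.
  by rewrite fund_vec_val// eq_sym (negPf kj) mul0r.
apply/(generatingP _ ba) => y.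
pose z : 'rV[int]_n := \row_k (if k \in I then y 0 k else - \sum_(i in I) y 0 i * fund_vec k 0 i).
exists z; last by move=> k; rewrite inE negbK mxE => ->.
apply: (ker_dot ab) => x /ker_fund_vec ->.
have zb j : j \in ~: I -> dot z (fund_vec j) = 0.
  rewrite inE => jI; rewrite /dot (bigID (mem I)) /= addrC (bigD1 j)//= mxE (negPf jI) fund_vec_val// eqxx mulr1.
  rewrite [X in _ + X + _]big1 ?addr0; last first.
    by move=> k /andP[kI /negPf kj]; rewrite fund_vec_val// eq_sym kj mulr0.
  by rewrite addrC; apply/eqP; rewrite subr_eq0; apply/eqP; apply: eq_bigr => i iI; rewrite mxE iI.
rewrite dotC dot_mx linear_sum mulmx_sumr summxE big1// => j jI.
by rewrite linearZ /= -scalemxAr mxE -dot_mx zb ?mulr0.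
Qed.

Lemma basis_card : #|I| = d'.
Proof.
have [indep gen] := (basesP a I).1 IB.
pose A := rowsub (fun i : 'I_#|I| => enum_val i) a.
have big_enum_val' (F : 'I_n -> 'rV[int]_d') : \sum_(i in I) F i = \sum_(i < #|I|) F (enum_val i).
  by rewrite big_enum_val.
have /choice[cf Hc] : forall k : 'I_d', exists c : 'rV[int]_#|I|, c *m A = delta_mx 0 k.
  move=> k; have [c Hc] := gen (delta_mx 0 k); exists (\row_i c (enum_val i)).
  rewrite Hc big_enum_val' mulmx_sum_row; apply: eq_bigr => i _; rewrite mxE; congr (_ *: _).
  by apply/rowP => l; rewrite !mxE.
pose B := \matrix_k cf k.
have BA : B *m A = 1%:M by apply/row_matrixP => k; rewrite row_mul rowK Hc rowE mulmx1.
have AB : A *m B = 1%:M.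
  apply/eqP; rewrite -subr_eq0; apply/eqP/row_matrixP => i; rewrite row0.
  set v := row i _; have vA : v *m A = 0.
    by rewrite /v -row_mul mulmxBl -mulmxA BA mulmx1 mul1mx subrr row0.
  apply/rowP => k; rewrite [RHS]mxE.
  pose c (l : 'I_n) := v 0 (enum_rank_in (enum_valP i) l).
  have := indep c; rewrite big_enum_val' => /(_ _ (enum_val k) (enum_valP k)).
  rewrite /c enum_valK_in => -> //; rewrite -[RHS]vA mulmx_sum_row; apply: eq_bigr => l _.
  rewrite enum_valK_in; congr (_ *: _); by apply/rowP => m; rewrite !mxE.
by apply/eqP; rewrite eqn_leq (mulmx1_min BA) (mulmx1_min AB).
Qed.
End Basis.

Lemma bases_complE d' r' (a : 'M[int]_(n, d')) (b : 'M[int]_(n, r')) I : split_pair a b ->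
  (~: I \in bases b) = (I \in bases a).
Proof.
move=> ab; apply/idP/idP => H; last exact: bases_compl ab _ H.
by rewrite -[I]finset.setCK; apply: (bases_compl (split_pair_sym ab)).
Qed.

Lemma det0_ker m (A : 'M[int]_m) : \det A = 0 -> exists2 c : 'rV[int]_m, c != 0 & c *m A = 0.
Proof.
have [L Lu [U Uu [e _ ->]]] := int_Smith_normal_form A.
rewrite !det_mulmx => /eqP; rewrite !mulf_eq0.
have nz (M : 'M[int]_m) : M \in unitmx -> (\det M == 0) = false.
  by rewrite unitmxE => uM; apply/eqP => E; rewrite E unitr0 in uM.
rewrite (nz L Lu) (nz U Uu) orbF /= det_trig; last first.
  apply/is_trig_mxP => i j ij; rewrite mxE.
  by case: eqP => [E|]; rewrite ?mulr0n//; move: ij; rewrite E ltnn.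
move=> /prodf_eq0[i _]; rewrite mxE eqxx mulr1n => /eqP ei.
exists (delta_mx 0 i *m invmx L).
  apply/eqP => /(congr1 (mulmx^~ L)); rewrite mulmxKV// mul0mx => /rowP/(_ i).
  by rewrite !mxE !eqxx.
rewrite !mulmxA mulmxKV// -[X in X *m U](_ : 0 = _) ?mul0mx//.
apply/rowP => j; rewrite -rowE !mxE.
by rewrite ei mul0rn.
Qed.

(** Only unimodularity is not immediate. If r rows of b are independent, then
    they form a nonsingular matrix, so the complementary rows of a are
    independent, hence a basis; Gale duality brings this back to b. *)
Lemma dual_hk (D : toric_data n d r) : toric_hyperkahler D -> toric_hyperkahler (dual_data D).
Proof.
move=> hD; have ab := hk_split hD; have ba := split_pair_sym ab.
split; rewrite /=.
- exact: hk_n hD.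
- by rewrite addnC; exact: hk_dim hD.
- by move=> w h; apply: (bT_inj ba); rewrite h mul0mx.
- by move=> x; exact: (kerP ba).
- exact: a_surj ba.
- exact: hk_b hD.
- exact: hk_a hD.
- move=> J cJ iJ; pose I := ~: J.
  suff IB : I \in bases (ta D).
    have : ~: I \in bases (tb D) by rewrite (bases_complE _ ab).
    by rewrite /I finset.setCK => /basesP[].
  have cI : #|I| = d by have := cardsCs J; rewrite -/I card_ord cJ; have := hk_dim hD; have := cardsC J; rewrite card_ord cJ -/I; lia.
  have indI : independent (ta D) I.
    apply/independentP => x /(kerP ab)[w ->] sx.
    suff -> : w = 0 by rewrite mul0mx.
    pose f (k : 'I_r) : 'I_n := enum_val (cast_ord (esym cJ) k).
    have fJ k : f k \in J by exact: enum_valP.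
    pose B := rowsub f (tb D).
    have Bw : B *m w^T = 0.
      apply/colP => k; rewrite [RHS]mxE.
      have := sx (f k); rewrite inE negbK => /(_ (fJ k)) <-; rewrite !mxE.
      by apply: eq_bigr => l _; rewrite !mxE mulrC.
    have dB : \det B != 0.
      apply/eqP => /det0_ker[c c0 cB]; move/eqP: c0; apply.
      pose c' (l : 'I_n) : int := \sum_(k < r | f k == l) c 0 k.
      have Sc : \sum_(i in J) c' i *: row i (tb D) = c *m B.
        rewrite mulmx_sum_row (partition_big f (mem J))//=.
        apply: eq_bigr => l _; rewrite scaler_suml; apply: eq_bigr => k /eqP <-.
        by congr (_ *: _); apply/rowP => m; rewrite !mxE.
      have f_inj : injective f by move=> k k' /enum_val_inj/cast_ord_inj.
      apply/rowP => k; rewrite [RHS]mxE -[RHS](iJ c' _ (f k) (fJ k)); last by rewrite Sc.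
      rewrite /c' (bigD1 k)//= big1 ?addr0// => k' /andP[/eqP/f_inj -> ].
      by rewrite eqxx.
    have : (\det B) *: w^T = 0.
      by rewrite -mul_scalar_mx -mul_adj_mx -mulmxA Bw mulmx0.
    move=> /colP H; apply/rowP => k; have := H k; rewrite !mxE => /eqP.
    by rewrite mulf_eq0 (negPf dB) /= => /eqP.
  by apply/basesP; split => //; exact: (hk_unimodular hD).
- exact: hk_xi hD.
- exact: hk_eta hD.
Qed.
End Split.

(** * Fundamental circuits and cocircuits *)

Section Circuits.
Variables (n d r : nat) (D : toric_data n d r).
Hypothesis hD : toric_hyperkahler D.
Let a := ta D.
Let b := tb D.
Let ab : split_pair a b := hk_split hD.

Lemma circuit_vectorE (C : {set 'I_n} * {set 'I_n}) k :
  circuit_vector C 0 k = (k \in C.1)%:R - (k \in C.2)%:R.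
Proof.
have S (A : {set 'I_n}) : (\sum_(i in A) eps i : 'rV[int]_n) 0 k = (k \in A)%:R.
  rewrite summxE; under eq_bigr do rewrite mxE eqxx /=.
  have [kA|kA] := boolP (k \in A).
    by rewrite (bigD1 k)//= eqxx big1 ?addr0// => i /andP[_]; rewrite eq_sym => /negPf ->.
  by rewrite big1// => i iA; case: eqP => // E; rewrite E iA in kA.
by rewrite /circuit_vector mxE [X in _ + X]mxE !S.
Qed.

Lemma circuit_vector_mul (C : {set 'I_n} * {set 'I_n}) :
  circuit_vector C *m a = \sum_(i in C.1) row i a - \sum_(i in C.2) row i a.
Proof.
rewrite /circuit_vector mulmxBl !mulmx_suml; congr (_ - _);
by apply: eq_bigr => i _; rewrite /eps rowE.
Qed.

Section OneBasis.
Variable I : {set 'I_n}.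
Hypothesis IB : I \in bases a.

(** Exchanging j for i in the basis I yields d independent vectors, a basis by
    unimodularity. So some vector of the kernel supported on j and I has the
    value 1 at i; it is an integral multiple of the fundamental vector, whose
    entry at i therefore divides 1. *)
Lemma exchange_unit j i : j \notin I -> i \in I -> fund_vec ab IB j 0 i != 0 ->
  fund_vec ab IB j 0 i = 1 \/ fund_vec ab IB j 0 i = -1.
Proof.
move=> jI iI nz; set be := fund_vec ab IB j.
pose I' := (j |: (I :\ i))%SET.
have ji : j != i by apply/eqP => E; rewrite E iI in jI.
have I'n k : k \notin I' -> k != i -> k \notin I /\ k != j.
  by rewrite !inE negb_or negb_and negbK => /andP[kj /orP[->//|kI]].
have supI' x : ker a x -> (forall k, k \notin I' -> k != i -> x 0 k = 0) -> x = x 0 j *: be.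
  move=> xa sx; apply: (ker_eq IB xa); first by apply: kerZ; exact: fund_vec_ker.
  move=> k kI; rewrite mxE fund_vec_val//; case: (j =P k) => [->|jk]; first by rewrite mulr1.
  rewrite mulr0; apply: sx; last by apply/eqP => E; rewrite E iI in kI.
  by rewrite !inE negb_or negb_and negbK kI orbT andbT; apply/eqP => E; apply: jk.
have c' : #|I'| = d.
  have cI := basis_card IB; have := cardsD1 i I; rewrite iI cardsU1 cI.
  by rewrite !inE (negPf jI) andbF /=; lia.
have ind : independent a I'.
  apply/independentP => x xa sx; have E := supI' x xa (fun k kI _ => sx k kI).
  have iI' : i \notin I' by rewrite !inE eqxx /= orbF eq_sym.
  have := sx i iI'; rewrite E mxE => /eqP; rewrite mulf_eq0 (negPf nz) orbF => /eqP ->.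
  by rewrite scale0r.
have /(generatingP _ ab)/(_ (delta_mx 0 i))[z za Hz] := hk_unimodular hD c' ind.
have iI' : i \notin I' by rewrite !inE eqxx /= orbF eq_sym.
have E : z = z 0 j *: be.
  apply: supI' => // k kI ki; rewrite Hz// mxE eqxx /= (negPf ki)//.
have := Hz i iI'; rewrite E !mxE !eqxx /= => h.
have /eqP := congr1 absz h; rewrite abszM muln_eq1 => /andP[_ /eqP]; lia.
Qed.

(** The entries of the fundamental vector are 0, 1 or -1, and any vector of
    the kernel supported on j and I is a multiple of it, whence the
    minimality. *)
Lemma fund_vec_circuit j : j \notin I -> exists C : {set 'I_n} * {set 'I_n},
  [/\ signed_circuit a C, C.1 :|: C.2 \subset j |: I & j \in C.1].
Proof.
move=> jI; set be := fund_vec ab IB j.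
have val k : be 0 k = 0 \/ be 0 k = 1 \/ be 0 k = -1.
  have [kI|kI] := boolP (k \in I).
    by case: (eqVneq (be 0 k) 0) => [|h]; [left|right; exact: exchange_unit].
  by rewrite fund_vec_val//; case: eqP => _; [right; left|left].
pose Cp := [set k | be 0 k == 1]%SET; pose Cm := [set k | be 0 k == -1]%SET.
have suppE k : (k \in Cp :|: Cm) = (be 0 k != 0).
  by rewrite !inE; have [->|[->|->]] := val k.
have vecE : circuit_vector (Cp, Cm) = be.
  by apply/rowP => k; rewrite circuit_vectorE /= !inE; have [->|[->|->]] := val k.
have bj : be 0 j = 1 by rewrite fund_vec_val// eqxx.
have sub : Cp :|: Cm \subset (j |: I)%SET.
  apply/fintype.subsetP => k; rewrite suppE => h; rewrite !inE; apply/orP.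
  have [kI|kI] := boolP (k \in I); first by right.
  by left; move: h; rewrite fund_vec_val//; case: (j =P k) => [->|_]; rewrite ?eqxx.
exists (Cp, Cm); split => //=; last by rewrite inE bj.
split => /=.
- rewrite -setI_eq0; apply/eqP/setP => k; rewrite !inE.
  by have [->|[->|->]] := val k.
- move=> /independentP/(_ be (fund_vec_ker _ _ _)) H.
  have : be = 0 by apply: H => k; rewrite suppE negbK => /eqP.
  by move=> /rowP/(_ j); rewrite bj mxE.
- move=> J /properP[JC [i iC iJ]]; apply/independentP => x xa sx.
  have E : x = x 0 j *: be.
    apply: (ker_eq IB xa); first by apply: kerZ; exact: fund_vec_ker.
    move=> k kI; rewrite mxE fund_vec_val//; case: (j =P k) => [->|jk]; first by rewrite mulr1.
    rewrite mulr0 sx//; apply: contra kI => /(fintype.subsetP JC)/(fintype.subsetP sub).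
    by rewrite !inE => /orP[/eqP kj|//]; case: jk.
  have := sx i iJ; rewrite E mxE; move: iC; rewrite suppE => nz /eqP.
  by rewrite mulf_eq0 (negPf nz) orbF => /eqP ->; rewrite scale0r.
- apply/eqP; rewrite -subr_eq0 -(circuit_vector_mul (Cp, Cm)) vecE.
  by apply/eqP; exact: fund_vec_ker.
Qed.

(** Whichever circuit is picked in the definition of [betaI], its vector
    agrees with the fundamental vector off I, hence everywhere. *)
Lemma betaIE j : j \notin I ->
  betaI a I j = fund_vec ab IB j /\ exists C, signed_circuit a C /\ betaI a I j = circuit_vector C.
Proof.
move=> jI; rewrite /betaI; case: pickP => [C /asboolP[sc sub jC] /=|H]; last first.
  by have [C HC] := fund_vec_circuit jI; have := H C; rewrite (asboolT HC).
split; last by exists C.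
have [dis _ _ S] := sc.
apply: (ker_eq IB).
- by rewrite /ker circuit_vector_mul S subrr.
- exact: fund_vec_ker.
- move=> k kI; rewrite circuit_vectorE fund_vec_val//.
  case: (j =P k) => [<-|jk].
    by rewrite jC (disjointFr dis jC) subr0.
  have : k \notin (C.1 :|: C.2)%SET.
    by apply: contra kI => /(fintype.subsetP sub); rewrite !inE => /orP[/eqP kj|//]; case: jk.
  by rewrite !inE negb_or => /andP[/negPf -> /negPf ->].
Qed.

Lemma betaI_ker j : j \notin I -> ker a (betaI a I j).
Proof. by move=> jI; have [-> _] := betaIE jI; exact: fund_vec_ker. Qed.

Lemma betaI_val j k : j \notin I -> k \notin I -> betaI a I j 0 k = (j == k)%:R.
Proof. by move=> jI kI; have [-> _] := betaIE jI; exact: fund_vec_val. Qed.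

Lemma pairing_neq0 j : j \notin I -> pairing b (teta D) (betaI a I j) != 0.
Proof. by move=> jI; have [_ [C [sc ->]]] := betaIE jI; exact: hk_eta hD _ sc. Qed.

Lemma IcplusE j : (j \in Icplus D I) = (j \notin I) && (0 < pairing b (teta D) (betaI a I j)).
Proof. by rewrite /Icplus !inE. Qed.

Lemma IcminusE j : (j \in Icminus D I) = (j \notin I) && (j \notin Icplus D I).
Proof.
rewrite IcplusE /Icminus !inE; case: (boolP (j \in I)) => //= jI.
by have := pairing_neq0 jI; rewrite -/a -/b; case: ltgtP.
Qed.

Lemma betaI_span x : ker a x -> x = \sum_(j in ~: I) x 0 j *: betaI a I j.
Proof.
move=> xa; rewrite {1}(ker_fund_vec ab IB xa); apply: eq_bigr => j; rewrite inE => jI.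
by have [-> _] := betaIE jI.
Qed.

Lemma ker_b_dot y : (forall j, j \notin I -> dot y (betaI a I j) = 0) -> ker b y.
Proof.
move=> H; apply: (ker_dot ab) => x /betaI_span ->.
rewrite dotC dot_mx linear_sum mulmx_sumr summxE big1// => j; rewrite inE => jI.
by rewrite linearZ /= -scalemxAr mxE -dot_mx H// mulr0.
Qed.

End OneBasis.

Lemma compl_basis I : I \in bases a -> ~: I \in bases (ta (dual_data D)).
Proof. by move=> IB; rewrite (bases_complE I ab). Qed.

End Circuits.

(** * Weights of the tautological line bundles *)

Section Weights.
Variables (n d r : nat) (D : toric_data n d r).
Hypothesis hD : toric_hyperkahler D.
Let a := ta D.
Let b := tb D.
Let ab : split_pair a b := hk_split hD.
Let ba := split_pair_sym ab.
Let hD' := dual_hk hD.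

(** The weights that are characters of the torus of parameters; only on these
    is the evaluation of weights multiplicative. *)
Definition wlat (w : weight n) : Prop := ker b w.1.1 /\ ker a w.1.2.

Variable I : {set 'I_n}.
Hypothesis IB : I \in bases a.
Let IB' : ~: I \in bases (ta (dual_data D)) := compl_basis hD IB.

Definition alphaI (i : 'I_n) := betaI b (~: I) i.

Lemma alphaI_ker i : i \in I -> ker b (alphaI i).
Proof. by move=> iI; apply: (betaI_ker hD' IB'); rewrite inE negbK. Qed.

Lemma alphaI_val i k : i \in I -> k \in I -> alphaI i 0 k = (i == k)%:R.
Proof. by move=> iI kI; apply: (betaI_val hD' IB'); rewrite inE negbK. Qed.

(** The pairing of the two vectors, which is 0, has only two nonzero terms. *)
Lemma alpha_beta i j : i \in I -> j \notin I -> alphaI i 0 j = - betaI a I j 0 i.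
Proof.
move=> iI jI; have := dot_ker ab (betaI_ker hD IB jI) (alphaI_ker iI).
rewrite /dot (bigID (mem I)) /= (bigD1 i)//= [X in _ + X](bigD1 j)//=.
rewrite alphaI_val// eqxx mulr1 [X in _ + X + _]big1 ?addr0; last first.
  by move=> k /andP[kI /negPf ki]; rewrite alphaI_val// eq_sym ki mulr0.
rewrite (betaI_val hD IB jI jI) eqxx mul1r [X in _ + (_ + X)]big1 ?addr0; last first.
  by move=> k /andP[kI /negPf kj]; rewrite (betaI_val hD IB jI kI) eq_sym kj mul0r.
by move=> /eqP; rewrite addrC addr_eq0 => /eqP.
Qed.

Lemma ker_b_eq x y : ker b x -> ker b y -> (forall k, k \in I -> x 0 k = y 0 k) -> x = y.
Proof.
move=> xb yb H; apply: (ker_eq IB' xb yb) => k; rewrite inE negbK; exact: H.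
Qed.

Lemma sum_eps (J : {set 'I_n}) (c : 'I_n -> int) k :
  (\sum_(j in J) c j *: eps j : 'rV[int]_n) 0 k = if k \in J then c k else 0.
Proof.
rewrite summxE; under eq_bigr do rewrite !mxE eqxx /=.
have [kJ|kJ] := boolP (k \in J).
  rewrite (bigD1 k)//= eqxx mulr1 big1 ?addr0// => i /andP[_].
  by rewrite eq_sym => /negPf ->; rewrite mulr0.
rewrite big1// => i iJ; case: (k =P i) => [E|_]; last by rewrite mulr0.
by rewrite E iJ in kJ.
Qed.

Lemma dotDl k (x y z : 'rV[int]_k) : dot (x + y) z = dot x z + dot y z.
Proof. by rewrite /dot -big_split; apply: eq_bigr => i _; rewrite mxE mulrDl. Qed.
Lemma dotZl k c (x z : 'rV[int]_k) : dot (c *: x) z = c * dot x z.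
Proof. by rewrite /dot mulr_sumr; apply: eq_bigr => i _; rewrite mxE mulrA. Qed.
Lemma dotNl k (x z : 'rV[int]_k) : dot (- x) z = - dot x z.
Proof. by rewrite -scaleN1r dotZl mulN1r. Qed.
Lemma dot_eps k (z : 'rV[int]_n) : dot (eps k) z = z 0 k.
Proof.
rewrite /dot (bigD1 k)//= mxE !eqxx mul1r big1 ?addr0// => i /negPf ik.
by rewrite mxE eqxx ik mul0r.
Qed.
Lemma dotDr k (x y z : 'rV[int]_k) : dot z (x + y) = dot z x + dot z y.
Proof. by rewrite dotC dotDl !(dotC z). Qed.

Lemma dotBr k (x y z : 'rV[int]_k) : dot z (x - y) = dot z x - dot z y.
Proof. by rewrite dotDr (dotC z (- y)) dotNl (dotC y). Qed.

Lemma Lres_D lam mu : Lres D I (lam + mu) = Lres D I lam + Lres D I mu.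
Proof.
rewrite /Lres; congr (_, _, _).
- under eq_bigr do rewrite dotDl scalerDl.
  by rewrite big_split /= opprD addrACA.
- by rewrite addr0.
- under eq_bigr do rewrite dotDl; under [X in _ - X]eq_bigr do rewrite dotDl.
  by rewrite !big_split /= opprD addrACA.
Qed.

Lemma Lres_lat lam : wlat (Lres D I lam).
Proof.
split => /=; last exact: ker0.
apply: (ker_b_dot hD IB) => j jI; rewrite dotDl dotNl.
have -> : dot (\sum_(j0 in ~: I) dot lam (betaI (ta D) I j0) *: eps j0) (betaI (ta D) I j)
   = dot lam (betaI (ta D) I j).
  rewrite dot_mx mulmx_suml summxE (bigD1 j) ?inE//= -scalemxAl mxE -dot_mx dot_eps.
  rewrite (betaI_val hD IB jI jI) eqxx mulr1 big1 ?addr0// => k /andP[].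
  rewrite inE => kI kj; rewrite -scalemxAl mxE -dot_mx dot_eps (betaI_val hD IB jI kI).
  by rewrite eq_sym (negPf kj) mulr0.
by rewrite subrr.
Qed.

Lemma Lres_ker lam : ker b lam -> Lres D I lam = (lam, 0, 0).
Proof.
move=> lb; have z j : j \notin I -> dot lam (betaI (ta D) I j) = 0.
  by move=> jI; rewrite dotC (dot_ker ab)//; exact: (betaI_ker hD IB).
rewrite /Lres; congr (_, _, _).
  by rewrite big1 ?subr0// => j; rewrite inE => jI; rewrite z// scale0r.
rewrite !big1 ?subrr// => j.
  by rewrite (IcminusE hD IB) => /andP[jI _]; exact: z.
by rewrite IcplusE => /andP[jI _]; exact: z.
Qed.

Lemma Lres_eps_out j : j \notin I ->
  Lres D I (eps j) = (0, 0, if j \in Icplus D I then 1 else -1).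
Proof.
move=> jI; have dv k : k \notin I -> dot (eps j) (betaI (ta D) I k) = (k == j)%:R.
  by move=> kI; rewrite dot_eps (betaI_val hD IB kI jI).
rewrite /Lres; congr (_, _, _).
  apply/rowP => k; rewrite mxE [X in _ + X]mxE sum_eps inE [RHS]mxE mxE eqxx /=.
  case: ifP => [kI|kI]; first by rewrite dv// eq_sym; case: eqP => _; rewrite ?subrr ?subr0.
  by case: (j =P k) => [E|/eqP jk]; [rewrite -E jI in kI|rewrite eq_sym (negPf jk) subr0].
have [jp|jm] := boolP (j \in Icplus D I).
  rewrite (bigD1 j)//= dv// eqxx !big1 ?addr0 ?subr0// => k.
    by rewrite (IcminusE hD IB) => /andP[kI km]; rewrite dv//; case: eqP => // E; rewrite E jp in km.
  by rewrite IcplusE -andbA => /and3P[kI _ /negPf kj]; rewrite dv// kj.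
rewrite [X in X - _]big1 ?sub0r; last first.
  by move=> k kp; rewrite dv; [case: eqP => // E; rewrite -E kp in jm|move: kp; rewrite IcplusE => /andP[]].
rewrite (bigD1 j) /=; last by rewrite (IcminusE hD IB) jI.
rewrite dv// eqxx big1 ?addr0// => k; rewrite (IcminusE hD IB) -andbA => /and3P[kI _ /negPf kj].
by rewrite dv// kj.
Qed.

Lemma Lres_eps_in i : i \in I -> (Lres D I (eps i)).1.1 = alphaI i.
Proof.
move=> iI; apply: ker_b_eq => //.
- by have [] := Lres_lat (eps i).
- exact: alphaI_ker.
- move=> k kI; rewrite alphaI_val// /Lres /= mxE [X in _ + X]mxE sum_eps inE kI /= subr0.
  by rewrite mxE eqxx eq_sym.
Qed.

End Weights.

Section DualWeights.
Variables (n d r : nat) (D : toric_data n d r).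
Hypothesis hD : toric_hyperkahler D.
Let a := ta D.
Let b := tb D.
Let ab : split_pair a b := hk_split hD.
Let hD' := dual_hk hD.
Variable I : {set 'I_n}.
Hypothesis IB : I \in bases a.
Let IB' : ~: I \in bases (ta (dual_data D)) := compl_basis hD IB.

Lemma Ldres_D lam mu : Ldres D I (lam + mu) = Ldres D I lam + Ldres D I mu.
Proof. by rewrite /Ldres Lres_D. Qed.

Lemma Ldres_lat lam : wlat D (Ldres D I lam).
Proof. by have [h1 h2] := Lres_lat hD' IB' lam; split. Qed.

Lemma Ldres_ker lam : ker a lam -> Ldres D I lam = (0, lam, 0).
Proof. by move=> la; rewrite /Ldres (Lres_ker hD' IB'). Qed.

Lemma IplusE i : (i \in Iplus D I) = (i \in I) && (0 < pairing a (txi D) (alphaI D I i)).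
Proof. by rewrite /Iplus IcplusE inE negbK. Qed.

Lemma IminusE i : (i \in Iminus D I) = (i \in I) && (i \notin Iplus D I).
Proof. by rewrite /Iminus (IcminusE hD' IB') inE negbK. Qed.

Lemma Ldres_eps_in i : i \in I -> Ldres D I (eps i) = (0, 0, if i \in Iplus D I then 1 else -1).
Proof. by move=> iI; rewrite /Ldres (Lres_eps_out hD' IB')// inE negbK. Qed.

Lemma Ldres_eps_out j : j \notin I -> Ldres D I (eps j) =
  (0, betaI a I j, - (\sum_(i in Iplus D I) betaI a I j 0 i - \sum_(i in Iminus D I) betaI a I j 0 i)).
Proof.
move=> jI; have jI' : j \in ~: I by rewrite inE.
have E := Lres_eps_in hD' IB' jI'.
have E2 : alphaI (dual_data D) (~: I) j = betaI a I j by rewrite /alphaI finset.setCK.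
rewrite E2 in E; rewrite /Ldres /wswap E; congr (_, _, _).
rewrite /Lres /= opprB addrC -!sumrN; congr (_ + _).
  apply: eq_bigr => i; rewrite -/(Iminus D I) IminusE => /andP[iI _].
  by rewrite dot_eps -[betaI (tb D) _ _]/(alphaI D I i) (alpha_beta hD IB iI jI) opprK.
apply: eq_bigr => i; rewrite -/(Iplus D I) IplusE => /andP[iI _].
by rewrite dot_eps -[betaI (tb D) _ _]/(alphaI D I i) (alpha_beta hD IB iI jI).
Qed.

(** Up to (kappa, beta), which the substitution tau removes, l_j is the
    exponent of v in L^!(eps_j) at p_I^!, shifted by one. *)
Lemma ell_eq j : j \notin I -> ell D I j = - dot kappa (betaI a I j) + (Ldres D I (eps j)).2
  + (if j \in Icplus D I then 1 else -1).
Proof.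
move=> jI; rewrite /ell; congr (_ + _); rewrite (Ldres_eps_out jI) /=.
pose y : 'rV[int]_n := kappa + \sum_(i in Iplus D I) eps i - \sum_(i in Iminus D I) eps i.
rewrite (pairingE ab (y := y)); last 2 first.
- rewrite /y mulmxBl mulmxDl !mulmx_suml; congr (_ + _ - _);
  by apply: eq_bigr => i _; rewrite rowE.
- exact: (betaI_ker hD IB).
rewrite /y !dotDl dotNl.
have S (J : {set 'I_n}) : dot (\sum_(i in J) eps i) (betaI (ta D) I j) = \sum_(i in J) betaI a I j 0 i.
  rewrite dot_mx mulmx_suml summxE; apply: eq_bigr => i _; by rewrite -dot_mx dot_eps.
by rewrite !S; ring.
Qed.
End DualWeights.

(** * The order on the bases *)

Section Triangular.
Variables (n d r : nat) (D : toric_data n d r).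
Hypothesis hD : toric_hyperkahler D.
Let a := ta D.
Let b := tb D.
Let ab : split_pair a b := hk_split hD.
Let ba := split_pair_sym ab.
Let hD' := dual_hk hD.

(** Let y be a lift of eta. The hyperplanes where a coordinate vanishes cut
    out of y + X^*(H) an arrangement whose vertex x_J, for a basis J, is the
    point with zero coordinates on J. The potential is the value of xi at x_J,
    and x_J - x_I is expanded in the edge directions alpha^I_i at x_I. *)
Lemma potential : exists phi : {set 'I_n} -> int, forall I J, I \in bases a -> J \in bases a ->
  phi J - phi I = \sum_(i in I :\: J) pairing b (teta D) (betaI a J i) * pairing a (txi D) (alphaI D I i).
Proof.
have [y Hy] := a_surj ba (teta D); have [t Ht] := a_surj ab (txi D).
have [x xE] : exists x : {set 'I_n} -> 'rV[int]_n,
    forall J, x J = y - \sum_(i in J) y 0 i *: alphaI D J i.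
  by exists (fun J : {set 'I_n} => y - \sum_(i in J) y 0 i *: alphaI D J i).
exists (fun J => dot t (x J)) => I J IB JB.
have x0 (K : {set 'I_n}) i : K \in bases a -> i \in K -> x K 0 i = 0.
  move=> KB iK; rewrite xE !mxE summxE (bigD1 i)//= mxE (alphaI_val hD KB)// eqxx mulr1.
  rewrite big1 ?addr0 ?subrr// => k /andP[kK /negPf ki].
  by rewrite mxE (alphaI_val hD KB)// ki mulr0.
have xk (K : {set 'I_n}) : K \in bases a -> ker b (y - x K).
  move=> KB; rewrite xE opprB addrC subrK; apply: ker_sum => i iK; apply: kerZ.
  exact: (alphaI_ker hD KB).
have xj j : j \notin J -> x J 0 j = pairing b (teta D) (betaI a J j).
  move=> jJ; have bk := betaI_ker hD JB jJ.
  rewrite (pairingE ab Hy bk).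
  have : dot (y - x J) (betaI a J j) = 0 by rewrite dotC (dot_ker ab)//; exact: xk.
  rewrite dotDl dotNl => /eqP; rewrite subr_eq0 => /eqP ->.
  rewrite /dot (bigD1 j)//= (betaI_val hD JB jJ jJ) eqxx mulr1 big1 ?addr0// => k kj.
  have [kJ|kJ] := boolP (k \in J); first by rewrite x0// mul0r.
  by rewrite (betaI_val hD JB jJ kJ) eq_sym (negPf kj) mulr0.
have E : x J - x I = \sum_(i in I) x J 0 i *: alphaI D I i.
  have xJI : ker b (x J - x I).
    have -> : x J - x I = (y - x I) - (y - x J).
      by apply/rowP => k; rewrite !mxE; ring.
    by apply: kerB; exact: xk.
  apply: (ker_b_eq hD IB) => //.
    by apply: ker_sum => i iI; apply: kerZ; exact: (alphaI_ker hD IB).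
  move=> k kI; have -> : (x J - x I) 0 k = x J 0 k - x I 0 k by rewrite !mxE.
  rewrite (x0 I k IB kI) subr0 summxE (bigD1 k)//=.
  have Z (c : int) (v : 'rV[int]_n) : (c *: v) 0 k = c * v 0 k by rewrite mxE.
  rewrite Z (alphaI_val hD IB)// eqxx mulr1 big1 ?addr0// => i /andP[iI /negPf ik].
  by rewrite Z (alphaI_val hD IB)// ik mulr0.
have -> : dot t (x J) - dot t (x I) = dot t (x J - x I).
  by rewrite (dotBr (x J) (x I) t).
rewrite E dotC dot_mx mulmx_suml summxE (bigID (mem J)) /= big1 ?add0r; last first.
  by move=> i /andP[iI iJ]; rewrite x0// scale0r mul0mx mxE.
rewrite (eq_bigl (fun i => i \in (I :\: J)%SET)); last by move=> i; rewrite !inE andbC.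
apply: eq_bigr => i; rewrite !inE => /andP[iJ iI].
rewrite -scalemxAl mxE -dot_mx xj// (pairingE ba Ht); last exact: (alphaI_ker hD IB).
by rewrite dotC.
Qed.

(** If the signs match, then all the terms in the difference of the potentials
    are positive. *)
Lemma potential_lt : exists phi : {set 'I_n} -> int, forall I J, I \in bases a -> J \in bases a ->
  I != J -> (forall i, i \in I -> i \notin J -> (i \in Iplus D I) = (i \in Icplus D J)) ->
  phi I < phi J.
Proof.
have [phi H] := potential; exists phi => I J IB JB IJ sgn.
rewrite -subr_gt0 H//.
have term_gt0 i : i \in (I :\: J)%SET ->
    0 < pairing b (teta D) (betaI a J i) * pairing a (txi D) (alphaI D I i).
  rewrite !inE => /andP[iJ iI]; have := sgn i iI iJ.
  rewrite IplusE// iI IcplusE iJ /= => E.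
  have n1 := pairing_neq0 hD JB iJ.
  have n2 : pairing a (txi D) (alphaI D I i) != 0.
    by apply: (pairing_neq0 hD' (compl_basis hD IB)); rewrite inE negbK.
  move: n1 n2 E; rewrite -/a -/b.
  move: (pairing b (teta D) _) (pairing a (txi D) _) => x y n1 n2 E.
  have [[hx hy]|[hx hy]] : (0 < x /\ 0 < y) \/ (x < 0 /\ y < 0) by lia.
    by rewrite mulr_gt0.
  by rewrite nmulr_rgt0.
have [i iIJ] : exists i, i \in (I :\: J)%SET.
  apply/finset.set0Pn; rewrite finset.setD_eq0; apply: contra IJ => sIJ.
  by rewrite eqEcard sIJ (basis_card IB) (basis_card JB) leqnn.
rewrite (bigD1 i)//= ltr_wpDr ?term_gt0// sumr_ge0// => k /andP[/term_gt0 kp _]; exact: ltW.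
Qed.
End Triangular.

(** * The number of bases and the order of Xi *)

Section CauchyBinet.
Variables (R : comNzRingType) (n d : nat) (a : 'M[R]_(n, d)).

Definition row_select (f : {ffun 'I_d -> 'I_n}) : 'M[R]_d := rowsub f a.

Lemma det_gram_expand :
  \det (a^T *m a) = \sum_(f : {ffun 'I_d -> 'I_n}) (\prod_i a (f i) i) * \det (row_select f).
Proof.
rewrite /determinant.
transitivity (\sum_(s : 'S_d) \sum_(f : {ffun 'I_d -> 'I_n})
   (-1) ^+ s * \prod_i (a (f i) i * a (f i) (s i))).
  apply: eq_bigr => s _; rewrite -mulr_sumr; congr (_ * _).
  rewrite -(bigA_distr_bigA (fun i k => a k i * a k (s i))) /=.
  by apply: eq_bigr => i _; rewrite mxE; apply: eq_bigr => k _; rewrite mxE.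
rewrite exchange_big; apply: eq_bigr => f _; rewrite mulr_sumr; apply: eq_bigr => s _.
rewrite big_split /= mulrCA; congr (_ * (_ * _)).
by apply: eq_bigr => i _; rewrite mxE.
Qed.

(** The Cauchy-Binet formula. The sum is over all maps f instead of subsets: a
    map that is not injective contributes 0, and every subset is the image of
    d! injective maps. *)
Lemma det_gram : (d`!)%:R * \det (a^T *m a) = \sum_(f : {ffun 'I_d -> 'I_n}) \det (row_select f) ^+ 2.
Proof.
transitivity (\sum_(t : 'S_d) \sum_(f : {ffun 'I_d -> 'I_n})
    (\prod_j a (f j) (t j)) * ((-1) ^+ t * \det (row_select f))).
  rewrite mulr_natl -card_Sn -sumr_const; apply: eq_bigr => t _.
  rewrite det_gram_expand.
  pose h (f : {ffun 'I_d -> 'I_n}) : {ffun 'I_d -> 'I_n} := [ffun i => f ((t^-1)%g i)].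
  rewrite (reindex_onto h (fun f => [ffun i => f (t i)])) /=; last first.
    by move=> f _; apply/ffunP => i; rewrite !ffunE permKV.
  apply: eq_big => [f|f _].
    by apply/eqP/ffunP => i; rewrite !ffunE permK.
  congr (_ * _).
    rewrite (reindex_inj (@perm_inj _ t)) /=.
    by apply: eq_bigr => i _; rewrite ffunE permK.
  have -> : row_select (h f) = row_perm (t^-1)%g (row_select f).
    by apply/matrixP => i j; rewrite !mxE ffunE.
  by rewrite row_permE det_mulmx det_perm odd_permV.
rewrite exchange_big /=; apply: eq_bigr => f _.
rewrite expr2 {2}/determinant mulr_suml; apply: eq_bigr => t _.
rewrite mulrCA mulrA; congr (_ * _ * _).
by apply: eq_bigr => i _; rewrite mxE.
Qed.
End CauchyBinet.

Section Count.
Variables (n d r : nat) (D : toric_data n d r).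
Hypothesis hD : toric_hyperkahler D.
Let a := ta D.
Let b := tb D.
Let ab : split_pair a b := hk_split hD.

Definition nb_bases : nat := #|[set I : {set 'I_n} | I \in bases (ta D)]%SET|.

Lemma row_select_sum (f : {ffun 'I_d -> 'I_n}) (c : 'I_n -> int) : injective f ->
  \sum_(i in [set f k | k : 'I_d]%SET) c i *: row i a = (\row_k c (f k)) *m row_select a f.
Proof.
move=> fi; rewrite big_imset /=; last by move=> x y _ _; exact: fi.
rewrite mulmx_sum_row; apply: eq_big => [k|k _]; first by rewrite inE.
by rewrite mxE; congr (_ *: _); apply/rowP => l; rewrite !mxE.
Qed.

Lemma sqr_absz1 (t : int) : absz t = 1%N -> t ^+ 2 = 1.
Proof. by move=> h; have [->|->] : t = 1 \/ t = -1 by lia. Qed.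

(** By unimodularity a nonzero maximal minor is 1 or -1. *)
Lemma det_row_select_sqr (f : {ffun 'I_d -> 'I_n}) :
  \det (row_select a f) ^+ 2 = (injectiveb f && ([set f k | k : 'I_d]%SET \in bases a))%:R.
Proof.
have [/injectiveP fi|/injectivePn[i [j ij fij]]] := boolP (injectiveb f); last first.
  rewrite /= (determinant_alternate ij) ?expr0n// => k.
  by rewrite !mxE fij.
set I := [set f k | k : 'I_d]%SET.
have cI : #|I| = d by rewrite card_imset// card_ord.
have invc (v : 'rV[int]_d) : exists c : 'I_n -> int, v = \row_k c (f k).
  exists (fun l => \sum_(k | f k == l) v 0 k); apply/rowP => k; rewrite mxE.
  by rewrite (bigD1 k)//= big1 ?addr0// => k' /andP[/eqP/fi -> ]; rewrite eqxx.
have [IB|IB] := boolP (I \in bases a).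
  have [_ gen] := (basesP a I).1 IB.
  have /choice[B HB] : forall k : 'I_d, exists v : 'rV[int]_d, v *m row_select a f = delta_mx 0 k.
    by move=> k; have [c Hc] := gen (delta_mx 0 k); exists (\row_k c (f k)); rewrite Hc row_select_sum.
  have E : \matrix_k B k *m row_select a f = 1%:M.
    by apply/row_matrixP => k; rewrite row_mul rowK HB rowE mulmx1.
  have := congr1 determinant E; rewrite det_mulmx det1 => h.
  have /eqP := congr1 absz h; rewrite abszM muln_eq1 => /andP[_ /eqP h2].
  exact: sqr_absz1.
apply/eqP; rewrite /= sqrf_eq0; apply/negPn/negP => nz; move/negP: IB; apply.
have ind : independent a I.
  move=> c; rewrite row_select_sum// => h i /imsetP[k _ ->].
  have : \det (row_select a f) *: (\row_k c (f k)) = 0.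
    by rewrite -mul_mx_scalar -mul_mx_adj mulmxA h mul0mx.
  by move=> /rowP/(_ k); rewrite !mxE => /eqP; rewrite mulf_eq0 (negPf nz) => /eqP.
by apply/basesP; split => //; exact: hk_unimodular hD _ cI ind.
Qed.

Lemma det_gram_bases : \det (a^T *m a) = nb_bases%:R.
Proof.
have d0 : (d`!)%:R != 0 :> int by rewrite pnatr_eq0 -lt0n fact_gt0.
apply: (mulfI d0); rewrite det_gram.
under eq_bigr do rewrite det_row_select_sqr.
rewrite -natr_sum.
have -> : (\sum_(f : {ffun 'I_d -> 'I_n})
     (injectiveb f && ([set f k | k : 'I_d]%SET \in bases a)))%N =
  #|[pred f : {ffun 'I_d -> 'I_n} | injectiveb f && ([set f k | k : 'I_d]%SET \in bases a)]|.
  by rewrite -sum1_card [RHS]big_mkcond; apply: eq_bigr => f _; rewrite inE; case: ifP.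
rewrite -natrM; congr (_%:R).
rewrite -sum1_card (partition_big (fun f : {ffun 'I_d -> 'I_n} => [set f k | k : 'I_d]%SET)
   (mem [set I : {set 'I_n} | I \in bases a]%SET)) /=; last first.
  by move=> f; rewrite inE => /andP[_ h]; rewrite inE.
rewrite mulnC -sum_nat_const; apply: eq_bigr => I; rewrite inE => IB.
rewrite sum1_card; have cI := basis_card IB.
transitivity #|[set f : {ffun 'I_d -> 'I_n} in ffun_on (mem I) | injectiveb f]%SET|; last first.
  by rewrite (card_inj_ffuns_on _ (mem I)) card_ord cI ffactnn.
rewrite -sum1_card -[RHS]sum1_card; apply: eq_bigl => f; rewrite {1}/in_mem /= !inE.
have [/injectiveP fi|] := boolP (injectiveb f); last by rewrite andbF.
rewrite andbT /=; apply/andP/ffun_onP => [[_ /eqP <-] k|H].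
  by apply/imsetP; exists k.
have E : [set f k | k : 'I_d]%SET = I.
  apply/eqP; rewrite eqEcard card_imset// card_ord cI leqnn andbT.
  by apply/fintype.subsetP => i /imsetP[k _ ->]; exact: H.
by rewrite E.
Qed.

Lemma gram_inj (u : 'rV[int]_d) : u *m (a^T *m a) = 0 -> u = 0.
Proof.
rewrite mulmxA => h; have : dot (u *m a^T) (u *m a^T) = 0.
  by rewrite dot_mx trmx_mul trmxK mulmxA h mul0mx mxE.
move=> /eqP; rewrite psumr_eq0 => [|i _]; last by rewrite -expr2 sqr_ge0.
move=> /allP H; apply: (bT_inj (split_pair_sym ab)); rewrite mul0mx.
apply/rowP => i; have := H i; rewrite mem_index_enum => /(_ isT).
by rewrite mulf_eq0 orbb mxE => /eqP ->; rewrite mxE.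
Qed.

(** The map a identifies Z^n modulo X_*(S) + X^*(H) with Z^d modulo the image
    of the Gram matrix a^T a. *)
Lemma Xi_equivE lam mu : Xi_equiv D lam mu <-> exists u, (mu - lam) *m a = u *m (a^T *m a).
Proof.
split=> [[be [al [h1 h2 ->]]]|[u h]].
  have [u Eu] := (kerP (split_pair_sym ab) al).1 h2; exists u.
  by rewrite addrC addrA addNr add0r mulmxDl h1 add0r Eu mulmxA.
exists (mu - lam - u *m a^T), (u *m a^T); split.
- by rewrite mulmxBl h mulmxA subrr.
- by apply/(kerP (split_pair_sym ab)); exists u.
- by rewrite subrK addrC subrK.
Qed.

(** By the Smith normal form of the Gram matrix, Xi is a product of cyclic
    groups of orders |e_i|, and the product of the orders is the absolute
    value of the determinant. *)
Lemma Xi_lifts_ex : exists s : seq 'rV[int]_n, Xi_lifts D s /\ size s = nb_bases.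
Proof.
have [s0 [p [sa _ _ _]]] := ab.
have [L Lu [U Uu [e _ E]]] := int_Smith_normal_form (a^T *m a).
set Dm := \matrix_(i, j) _ in E.
have unit1 (M : 'M[int]_d) : M \in unitmx -> absz (\det M) = 1%N.
  by rewrite unitmxE => /unitrP[x [_ h]]; have /eqP := congr1 absz h; rewrite abszM muln_eq1 => /andP[/eqP].
have detD : \det Dm = \prod_(i < d) e`_i.
  rewrite det_trig; last first.
    apply/is_trig_mxP => i j ij; rewrite mxE.
    by case: eqP => [E'|]; rewrite ?mulr0n//; move: ij; rewrite E' ltnn.
  by apply: eq_bigr => i _; rewrite mxE eqxx mulr1n.
have Pe : (\prod_(i < d) absz (e`_i)%R)%N = nb_bases.
  have := congr1 absz det_gram_bases; rewrite E !det_mulmx !abszM (unit1 L Lu) (unit1 U Uu) mul1n muln1 detD natz absz_nat => <-.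
  by rewrite (big_morph absz abszM absz1).
have nz : \det (a^T *m a) != 0.
  by apply/eqP => /det0_ker[c c0 cB]; move/eqP: c0; apply; exact: gram_inj.
have e0 i : (i < d)%N -> e`_i != 0.
  move=> id; move: nz; rewrite E !det_mulmx detD !mulf_eq0 !negb_or => /andP[/andP[_ h] _].
  by move/prodf_neq0: h => /(_ (Ordinal id) isT).
pose T := {dffun forall i : 'I_d, 'I_(absz (e`_i)%R)}.
pose lam (c : T) : 'rV[int]_n := (\row_i (c i : nat)%:Z) *m U *m s0.
have lamA c : lam c *m a = (\row_i (c i : nat)%:Z) *m U by rewrite /lam -mulmxA sa mulmx1.
exists [seq lam c | c <- enum (@predT T)]; split; last first.
  rewrite size_map -cardE -Pe card_dep_ffun foldrE big_map big_enum /=.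
  by apply: eq_bigr => i _; rewrite card_ord.
move=> mu; rewrite count_map.
have [y Hy] : exists y : 'rV[int]_d, y *m U = mu *m a.
  by exists (mu *m a *m invmx U); rewrite mulmxKV.
have DE (v : 'rV[int]_d) i : (v *m Dm) 0 i = v 0 i * e`_i.
  rewrite mxE (bigD1 i)//= mxE eqxx mulr1n big1 ?addr0// => k /negPf ki.
  by rewrite mxE -[nat_of_ord k == i]/(k == i) ki mulr0n mulr0.
have clt (i : 'I_d) : (absz (modz (y 0 i) e`_i)%R < absz (e`_i)%R)%N.
  by rewrite -ltz_nat gez0_abs ?modz_ge0 ?e0// ltz_mod ?e0.
(* The remainders of the coordinates of mu modulo the e_i single out its lift. *)
pose c0 : T := [ffun i => Ordinal (clt i)].
rewrite (eq_count (a2 := pred1 c0)); first by rewrite count_uniq_mem ?enum_uniq// mem_enum.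
move=> c /=; apply/asboolP/eqP => [/Xi_equivE[u h]|->].
  have h2 : y - \row_i (c i : nat)%:Z = (u *m L) *m Dm.
    apply: (can_inj (mulmxK Uu)); rewrite mulmxBl Hy -lamA -mulmxBl h E.
    by rewrite !mulmxA.
  apply/ffunP => i; apply/val_inj; rewrite /= ffunE /=.
  have dv : y 0 i - (c i : nat)%:Z \in dvdz e`_i.
    have /rowP/(_ i) := h2; rewrite DE !mxE => ->.
    by rewrite dvdz_mull.
  have : modz (y 0 i) e`_i = modz (c i : nat)%:Z e`_i by apply/eqP; rewrite eqz_mod_dvd.
  move=> ->; rewrite -modz_abs modz_small ?absz_nat//=.
  by rewrite ltz_nat; exact: ltn_ord.
apply/Xi_equivE; pose v : 'rV[int]_d := \row_i divz (y 0 i) e`_i.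
exists (v *m invmx L); rewrite E !mulmxA mulmxKV// mulmxBl lamA -Hy -mulmxBl.
congr (_ *m _); apply/rowP => i; rewrite DE !mxE.
rewrite ffunE /= gez0_abs ?modz_ge0 ?e0//.
by rewrite {1}(divz_eq (y 0 i) e`_i) addrK.
Qed.
End Count.

(** * Theta series as holomorphic functions on the torus *)

Section EvalSpec.
Variables (R : realType) (d r : nat).
Local Notation C := R[i].
Local Notation P := (tpoint R d r).

Section S.
Variables (n d' r' : nat) (D : toric_data n d' r').

Definition wsize (w : weight n) : nat :=
  (\sum_i `|w.1.1 0%R i|%N + \sum_i `|w.1.2 0%R i|%N + `|w.2|%N)%N.

(** The properties of an evaluation of weights on which the proof relies. They
    hold for X and are preserved by the exchange of a and z, hence hold for
    X^!. *)
Record eval_spec (e : P -> weight n -> C) : Prop := {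
  es_add : forall x w w', torus x -> wlat D w -> wlat D w' -> e x (w + w') = e x w * e x w';
  es_neq0 : forall x w, torus x -> e x w != 0;
  es_good : forall x, torus x -> exists dl K0 K : R, [/\ 0 < dl <= 1, 0 <= K0, 1 <= K
     & forall w, wlat D w -> expands x dl (fun y => e y w) (K0 * K ^+ wsize w)];
  es_bar : forall x w, e (iota_v x) w = e x (w.1, - w.2);
  es_sqrt : forall x w, e (sqrt_point x) w ^+ 2 = e x w;
  es_gen : forall (q : C) x w B, normc q < 1 -> q != 0 -> torus x -> nbhs x B -> wlat D w ->
     w.1.1 != 0 \/ w.1.2 != 0 ->
     exists y, [/\ B y, torus y & forall l : int, e y w != q ^ l] }.
End S.

Lemma wsize_swap n (w : weight n) : wsize (wswap w) = wsize w.
Proof. by rewrite /wsize /wswap /= addnAC addnC addnA addnAC -addnA addnC addnAC -!addnA; congr (_ + _)%N; rewrite addnC. Qed.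

Lemma eval_spec_dual n d' r' (D : toric_data n d' r') e : eval_spec D e ->
  eval_spec (dual_data D) (fun x w => e x (wswap w)).
Proof.
move=> sp; have sw (w : weight n) : wlat (dual_data D) w -> wlat D (wswap w) by move=> [].
split.
- by move=> x w w' Tx hw hw'; rewrite -(es_add sp)//; exact: sw.
- by move=> x w Tx; exact: (es_neq0 sp).
- move=> x Tx; have [dl [K0 [K [h1 h2 h3 H]]]] := es_good sp Tx.
  by exists dl, K0, K; split => // w hw; rewrite -wsize_swap; apply: H; exact: sw.
- by move=> x w; rewrite (es_bar sp).
- by move=> x w; exact: (es_sqrt sp x (wswap w)).
- move=> q x w B q1 q0 Tx Bx hw nz; apply: (es_gen sp q1 q0 Tx Bx (sw _ hw)).
  by case: nz; [right|left].
Qed.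

Section EvalX.
Variables (n : nat) (D : toric_data n d r).
Hypothesis hD : toric_hyperkahler D.
Let a := ta D.
Let b := tb D.
Let ab : split_pair a b := hk_split hD.
Let ba := split_pair_sym ab.

Lemma evalX_mono (x : P) (w : weight n) : evalX D x w =
  mono x (fun k => lattice_coord a w.1.1 0 k) (fun k => lattice_coord b w.1.2 0 k) w.2.
Proof. by []. Qed.

Lemma coordD m (c : 'M[int]_(n, m)) m' (c' : 'M[int]_(n, m')) (cc : split_pair c c') x y :
  ker c x -> ker c y -> lattice_coord c' (x + y) = lattice_coord c' x + lattice_coord c' y.
Proof.
move=> hx hy; apply: (bT_inj cc); rewrite mulmxDl !(lattice_coordK cc)//.
exact: kerD.
Qed.

Lemma coord_bound m (c : 'M[int]_(n, m)) m' (c' : 'M[int]_(n, m')) : split_pair c c' ->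
  exists A : nat, forall x, ker c x ->
   (\sum_k `|lattice_coord c' x 0%R k|%N <= A * \sum_i `|x 0%R i|%N)%N.
Proof.
move=> cc; have [s [p [_ _ _ cp]]] := cc.
exists (\sum_k \sum_i `|p i k|)%N => x xc.
have -> : lattice_coord c' x = x *m p.
  by rewrite -{2}(lattice_coordK cc xc) -mulmxA cp mulmx1.
rewrite big_distrl /=; apply: leq_sum => k _; rewrite mxE.
apply: (@leq_trans (\sum_i `|x 0%R i| * `|p i k|)%N).
  elim/big_rec2: _ => [|i u v _ H]; first by rewrite absz0.
  have T (u' t : int) : (absz (u' + t)%R <= absz u' + absz t)%N by lia.
  by apply: leq_trans (T _ _) _; rewrite abszM leq_add2l.
rewrite big_distrl /= [X in (_ <= X)%N](eq_bigr (fun i => \sum_j `|p i k| * `|x 0%R j|)%N); last by move=> i _; rewrite big_distrr.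
by apply: leq_sum => i _; rewrite mulnC (bigD1 i)//= leq_addr.
Qed.

Lemma evalX_spec : eval_spec D (evalX D : P -> weight n -> C).
Proof.
split.
- move=> x w w' Tx [h1 h2] [h1' h2']; rewrite !evalX_mono -mono_add//=.
  by congr (mono x _ _ _); apply: funext => k;
     rewrite ?(coordD ba h1 h1') ?(coordD ab h2 h2') mxE.
- by move=> x w Tx; exact: mono_neq0.
- move=> x Tx; have [dl [K0 [K [/andP[h1 h1'] h2 h3 H]]]] := mono_expands Tx.
  have [A1 HA1] := coord_bound ba; have [A2 HA2] := coord_bound ab.
  exists dl, K0, (K ^+ (A1 + A2 + 1)); split; rewrite ?h1 ?exprn_ege1//.
  move=> w [w1 w2]; apply: expands_le (H _ _ _).
  rewrite ler_wpM2l// -exprM ler_weXn2l// /wsize.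
  have := HA1 _ w1; have := HA2 _ w2; rewrite -/a -/b.
  move: (\sum_k _)%N (\sum_k _)%N (\sum_i _)%N (\sum_i _)%N => t1 t2 t3 t4; nia.
- by move=> x w; rewrite /iota_v !evalX_mono mono_inv.
- by move=> x w; rewrite !evalX_mono mono_sqrt.
- move=> q x w B q1 q0 Tx Bx [h1 h2] nz.
  have [//|y Hy] := @mono_generic R d r q x (fun k => lattice_coord a w.1.1 0 k)
    (fun k => lattice_coord b w.1.2 0 k) w.2 B q1 q0 Tx Bx _; last by exists y.
  have nzc m (c : 'M[int]_(n, m)) m' (c' : 'M[int]_(n, m')) (cc : split_pair c c') z :
     ker c z -> z != 0 -> exists k, lattice_coord c' z 0 k != 0.
    move=> zc z0; apply: contrapT => N; move/eqP: z0; apply.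
    rewrite -(lattice_coordK cc zc); suff -> : lattice_coord c' z = 0 by rewrite mul0mx.
    apply/rowP => k; rewrite [RHS]mxE; apply/eqP/negPn/negP => h; apply: N; by exists k.
  by case: nz => h; [left; exact: (nzc _ _ _ _ ba)|right; exact: (nzc _ _ _ _ ab)].
Qed.
End EvalX.

Section Theta.
Variables (q : C) (n d' r' : nat) (D : toric_data n d' r') (e : P -> weight n -> C).
Hypotheses (q0 : q != 0) (q1 : normc q < 1).
Hypothesis hD : toric_hyperkahler D.
Hypothesis sp : eval_spec D e.
Let a := ta D.
Let b := tb D.
Let ab : split_pair a b := hk_split hD.
Let ba := split_pair_sym ab.

Lemma wlat0 : wlat D 0.
Proof. by split; exact: ker0. Qed.

Lemma wlatD w w' : wlat D w -> wlat D w' -> wlat D (w + w').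
Proof. by move=> [h1 h2] [h1' h2']; split; exact: kerD. Qed.

Lemma wlatN w : wlat D w -> wlat D (- w).
Proof. by move=> [h1 h2]; split; exact: kerN. Qed.

Lemma eval0 x : torus x -> e x 0 = 1.
Proof.
move=> Tx; have := es_add sp Tx wlat0 wlat0; rewrite addr0 => /esym.
by move=> h; apply: (mulfI (es_neq0 sp 0 Tx)); rewrite mulr1.
Qed.

Lemma evalN x w : torus x -> wlat D w -> e x (- w) = (e x w)^-1.
Proof.
move=> Tx hw; apply: (mulfI (es_neq0 sp w Tx)).
by rewrite -(es_add sp)//; [rewrite subrr eval0// mulfV// (es_neq0 sp)|exact: wlatN].
Qed.

(** The triple product writes the function as a series of monomials with
    Gaussian coefficients. *)
Lemma holo_theta w : wlat D w -> holo (fun x => thetaF q (e x w)).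
Proof.
move=> hw x Tx; have [dl [K0 [K [/andP[dl0 dl1] K00 K1 H]]]] := es_good sp Tx.
have [U /nbhsC[ep ep0 HT] TU] : exists2 U, nbhs x U & (U `<=` @torus R d r)%classic.
  by exists (@torus R d r) => //; exact: torus_nbhs.
pose dl' := Num.min dl ep.
have dl'0 : 0 < dl' by rewrite lt_min dl0.
have dl'1 : dl' <= 1 by rewrite ge_min dl1.
have gsub f K' : expands x dl f K' -> expands x dl' f K'.
  move=> [L [l1 l2 l3 l4]]; exists L; split => // h; rewrite lt_min => /andP[hh _]; [exact: l2|exact: l4].
have inT h : nrm h < dl' -> torus (x + h).
  by rewrite lt_min => /andP[_ hh]; apply: TU; apply: HT; rewrite addrC addKr.
pose K' := Num.max (K0 * K ^+ wsize w) (K0 * K ^+ wsize (- w)).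
have K'0 : 0 <= K' by rewrite le_max mulr_ge0// exprn_ge0//; lra.
have g1 : expands x dl' (fun y => e y w) K'.
  by apply: (expands_le (K := K0 * K ^+ wsize w)); [rewrite le_max lexx|apply: gsub; exact: H].
have good_ext f f' K2 : (forall y, torus y -> f y = f' y) -> expands x dl' f K2 -> expands x dl' f' K2.
  move=> ff [L [l1 l2 l3 l4]]; exists L; split => // h hh.
    by rewrite -ff; [exact: l2|exact: inT].
  by rewrite -!ff; [exact: l4|exact: Tx|exact: inT].
have g2 : expands x dl' (fun y => (e y w)^-1) K'.
  apply: (good_ext (fun y => e y (- w))); first by move=> y Ty; rewrite evalN.
  apply: (expands_le (K := K0 * K ^+ wsize (- w))); first by rewrite le_max lexx orbT.
  by apply: gsub; apply: H; exact: wlatN.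
have L0 : 0 <= 4 * K' by rewrite mulr_ge0.
have [B HB] := theta_bsum (introT andP (conj (normc_ge0 q) q1)) L0.
have Bs : bsum (fun k : int => 4 * normc ((-1) ^ k * q ^ tri k) * (4 * K') ^+ `|k|%N) (4 * B).
  apply: bsum_le (bsumZ (_ : 0 <= 4) HB) => // k.
  by rewrite normcM !normcXz normcNE normc1 exp1rz mul1r mulrA.
have g3 : expands x dl' (fun y => qpoch q * thetaF q (e y w)) (4 * B).
  apply: (@expands_sum _ _ x dl' dl'0 _ (fun (k : int) y => ((-1) ^ k * q ^ tri k) * e y w ^ k) _ _ _ _ Bs).
    move=> k; apply: expands_mul => //; first by apply: expands_cst.
    exact: expands_expz.
  move=> h hh; have := jacobi_triple q0 q1 (es_neq0 sp w (inT h hh)).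
  by move=> [_]; apply: has_sum_ext.
have g4 : expands x dl' (fun y => thetaF q (e y w)) (4 * normc (qpoch q)^-1 * (4 * B)).
  apply: (good_ext (fun y => (qpoch q)^-1 * (qpoch q * thetaF q (e y w)))).
    by move=> y _; rewrite mulKf// qpoch_neq0.
  by apply: expands_mul => //; apply: expands_cst.
exact: expands_differentiable g4.
Qed.

Lemma dense_theta w : wlat D w -> w.1.1 != 0 \/ w.1.2 != 0 ->
  dense_neq0 (fun x => thetaF q (e x w)).
Proof.
move=> hw nz x Tx B Bx; have [y [By Ty Hy]] := es_gen sp q1 q0 Tx Bx hw nz.
by exists y; split => //; apply: thetaF_neq0 => //; exact: (es_neq0 sp).
Qed.

Lemma wsizeD (w w' : weight n) : (wsize (w + w')%R <= wsize w + wsize w')%N.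
Proof.
have T (u t : int) : (absz (u + t)%R <= absz u + absz t)%N by lia.
have S (x y : 'rV[int]_n) : (\sum_i `|(x + y)%R 0%R i| <= \sum_i `|x 0%R i| + \sum_i `|y 0%R i|)%N.
  by rewrite -big_split; apply: leq_sum => i _; rewrite mxE T.
have := T w.2 w'.2; have := S w.1.1 w'.1.1; have := S w.1.2 w'.1.2; rewrite /wsize /=.
lia.
Qed.

Lemma wsize_sum (I : Type) (s : seq I) (F : I -> weight n) :
  (wsize (\sum_(i <- s) F i)%R <= \sum_(i <- s) wsize (F i))%N.
Proof.
elim: s => [|i s IH]; last by rewrite !big_cons; apply: leq_trans (wsizeD _ _) _; rewrite leq_add2l.
by rewrite !big_nil /wsize /= !big1 ?absz0// => i _; rewrite mxE absz0.
Qed.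

Lemma Lres_size (J : {set 'I_n}) : exists A : nat, forall mu,
  (wsize (Lres D J mu) <= A * \sum_i `|mu 0%R i|)%N.
Proof.
exists (\sum_i wsize (Lres D J (eps i)))%N => mu.
have L0 : Lres D J 0 = 0.
  rewrite /Lres; have z x : dot (0 : 'rV[int]_n) x = 0 by rewrite /dot big1// => i _; rewrite mxE mul0r.
  rewrite !big1 ?subrr// => i _; rewrite ?z ?scale0r//.
have Lc (c : int) x : wsize (Lres D J (c *: x)) = (`|c| * wsize (Lres D J x))%N.
  have -> : Lres D J (c *: x) = (c *: (Lres D J x).1.1, 0, c * (Lres D J x).2).
    rewrite /Lres /=; congr (_, _, _).
      rewrite scalerBr scaler_sumr; congr (_ - _); apply: eq_bigr => j _.
      by rewrite dotZl scalerA.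
    rewrite mulrBr !mulr_sumr; congr (_ - _); apply: eq_bigr => j _; exact: dotZl.
  rewrite /wsize /= abszM !mulnDr; congr (_ + _ + _)%N.
    by rewrite big_distrr; apply: eq_bigr => i _; rewrite mxE abszM.
  by rewrite !big1 ?muln0// => i _; rewrite mxE absz0.
have -> : Lres D J mu = \sum_i Lres D J (mu 0 i *: eps i).
  rewrite [in LHS](row_sum_delta mu).
  exact: (big_morph _ (Lres_D D J) L0).
apply: leq_trans (wsize_sum _ _) _; rewrite big_distrl /=; apply: leq_sum => i _.
by rewrite Lc mulnC leq_mul2l; apply/orP; right; rewrite (bigD1 i)//= leq_addr.
Qed.

(** A product of m series over Z is a series over Z^m; the first coordinate is
    split off. *)
Lemma asum_rV m (f : 'I_m -> int -> C) (s : 'I_m -> C) : (forall i, asum (f i) (s i)) ->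
  asum (fun mu : 'rV[int]_m => \prod_i f i (mu 0 i)) (\prod_i s i).
Proof.
elim: m f s => [|m IH] f s H.
  have all0 (x : 'rV[int]_0) : x = 0 by apply/rowP => -[].
  rewrite big_ord0; split.
    exists 1 => A; apply: (@le_trans _ _ (\sum_(i <- [fset (0 : 'rV[int]_0)]%fset) 1)).
      apply: le_trans (fsum_le (g := fun _ => 1) _ (_ : (A `<=` [fset 0])%fset)).
      - by apply: ler_sum => i _; rewrite big_ord0 normc1.
      - by move=> _; exact: ler01.
      - by apply/fsubsetP => x _; rewrite inE (all0 x).
    by rewrite big_seq_fset1.
  move=> ep ep0; exists [fset (0 : 'rV[int]_0)]%fset => B sB.
  have -> : B = [fset (0 : 'rV[int]_0)]%fset.
    apply/eqP; rewrite eqEfsubset sB andbT; apply/fsubsetP => x _.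
    by rewrite inE (all0 x).
  by rewrite big_seq_fset1 big_ord0 subrr normc0.
pose h (mu : 'rV[int]_(1 + m)) := (mu 0 0, rsubmx mu).
pose k (p : int * 'rV[int]_m) : 'rV[int]_(1 + m) := row_mx (const_mx p.1) p.2.
have hk : cancel h k.
  move=> mu; rewrite /h /k /=; rewrite -[RHS]hsubmxK; congr row_mx.
  by apply/rowP => i; rewrite !mxE (ord1 i) lshift0.
have kh : cancel k h.
  move=> [c v]; rewrite /h /k /=; congr (_, _); last by rewrite row_mxKr.
  by rewrite -(lshift0 m 0) row_mxEl mxE.
have := asum_bij hk kh (asum_prod (H ord0) (IH (fun i => f (lift ord0 i)) _ (fun i => H (lift ord0 i)))).
rewrite big_ord_recl; apply: asum_ext => mu /=.
rewrite big_ord_recl; congr (_ * _); apply: eq_bigr => i _; congr (f _ _).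
by rewrite mxE; congr (mu _ _); apply: val_inj.
Qed.

Lemma bsum_rV m (g : int -> R) B : (forall k, 0 <= g k) -> bsum g B ->
  exists B', bsum (fun mu : 'rV[int]_m => \prod_i g (mu 0 i)) B'.
Proof.
move=> g0 gB.
have gB' : bsum (fun k => normc (g k)%:C%C) B by apply: bsum_le gB => k; rewrite normc_real.
have [s Hs] := asum_ex gB'.
have [[B' HB'] _] := @asum_rV m (fun _ k => (g k)%:C%C) (fun _ => s) (fun _ => Hs).
exists B'; apply: bsum_le HB' => mu; rewrite normc_prod.
by rewrite le_eqVlt; apply/orP; left; apply/eqP; apply: eq_bigr => i _; rewrite normc_real.
Qed.

Lemma half_dot (x : 'rV[int]_n) : divz (dot x (x + kappa)) 2 = \sum_i tri (x 0 i).
Proof.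
suff -> : dot x (x + kappa) = (\sum_i tri (x 0 i)) * 2 by rewrite mulzK.
rewrite mulr_suml.
by apply: eq_bigr => i _; rewrite !mxE tri2.
Qed.

Definition Theta_coef (lam x : 'rV[int]_n) : C :=
  (-1) ^ dot kappa x * q ^ (divz (dot x (x + kappa)) 2 + dot lam x).

(** The linear term (lam, x) in the exponent of q amounts to a geometric
    factor, so that the sum is dominated by a product of n one-dimensional
    theta series. *)
Lemma Theta_coef_bound lam (K : R) : 1 <= K ->
  exists B, bsum (fun x : 'rV[int]_n => normc (Theta_coef lam x) * K ^+ (\sum_i `|x 0%R i|)%N) B.
Proof.
move=> K1; have rq : 0 < normc q by rewrite normc_gt0.
pose M := (\sum_i `|lam 0%R i|)%N.
pose L := ((normc q)^-1) ^+ M * K.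
have L0 : 0 <= L by rewrite mulr_ge0 ?exprn_ge0 ?invr_ge0 ?normc_ge0//; lra.
have [B HB] := theta_bsum (introT andP (conj (normc_ge0 q) q1)) L0.
have g0 (k : int) : 0 <= normc q ^ tri k * L ^+ `|k|%N.
  by rewrite mulr_ge0 ?exprn_ge0// exprz_ge0 ?normc_ge0.
have [B' HB'] := bsum_rV n g0 HB; exists B'; apply: bsum_le HB' => x.
rewrite normcM !normcXz normcNE normc1 exp1rz mul1r half_dot expfzDr; last by rewrite gt_eqF.
have -> : normc q ^ (\sum_i tri (x 0 i)) = \prod_i normc q ^ tri (x 0 i).
  by rewrite (big_morph (fun z : int => normc q ^ z) (id1 := 1) (op1 := *%R))// => u v;
     rewrite expfzDr// gt_eqF.
have -> : normc q ^ dot lam x = \prod_i normc q ^ (lam 0 i * x 0 i).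
  by rewrite /dot (big_morph (fun z : int => normc q ^ z) (id1 := 1) (op1 := *%R))// => u v;
     rewrite expfzDr// gt_eqF.
rewrite -prodrXr -!big_split /=; apply: ler_prod => i _.
have q_0 z : 0 <= normc q ^ z by rewrite exprz_ge0 ?normc_ge0.
rewrite !mulr_ge0 ?exprn_ge0//=; last lra.
rewrite /L exprMn -!mulrA ler_wpM2l// ler_wpM2r ?exprn_ge0//; first lra.
rewrite -exprM.
have qi : 1 <= (normc q)^-1 by rewrite invf_ge1// ltW.
apply: (@le_trans _ _ ((normc q)^-1 ^+ `|lam 0%R i * x 0%R i|)).
  move: (lam 0 i * x 0 i) => z; case: (z) => k; rewrite ?NegzE ?abszN absz_nat.
    apply: (@le_trans _ _ 1); last exact: exprn_ege1.
    by rewrite -exprnP exprn_ile1 ?normc_ge0// ltW.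
  by rewrite -exprnN exprVn.
rewrite ler_weXn2l// abszM leq_mul2r; apply/orP; right.
by rewrite /M (bigD1 i)//= leq_addr.
Qed.

Definition ker_lattice := {x : 'rV[int]_n | x *m ta D == 0}.

Definition Theta_term lam J (h : weight n -> C) (x : ker_lattice) : C :=
  Theta_coef lam (val x) * h (Lres D J (lam + val x) + wz (val x)).

Lemma Theta_valE lam J h : Theta_val q D lam J h = qpoch q ^- r' * summability.sum (Theta_term lam J h).
Proof. by []. Qed.

Section OneJ.
Variables (lam : 'rV[int]_n) (J : {set 'I_n}).
Hypothesis JB : J \in bases a.

Lemma Theta_term_lat (x : ker_lattice) : wlat D (Lres D J (lam + val x) + wz (val x)).
Proof.
apply: wlatD; first exact: (Lres_lat hD JB).
by split => /=; [exact: ker0|exact/eqP/(valP x)].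
Qed.

Lemma Theta_term_size : exists A : nat, forall x : ker_lattice,
  (wsize (Lres D J (lam + val x) + wz (val x))%R <= A + A * \sum_i `|val x 0%R i|)%N.
Proof.
have [A HA] := Lres_size J; exists (A.+1 * (\sum_i `|lam 0%R i|).+1)%N => x.
apply: leq_trans (wsizeD _ _) _.
have -> : wsize (wz (val x)) = (\sum_i `|val x 0%R i|)%N.
  by rewrite /wsize /= big1 ?add0n ?addn0// => i _; rewrite mxE.
have T (u t : int) : (absz (u + t)%R <= absz u + absz t)%N by lia.
have := HA (lam + val x).
have : (\sum_i `|(lam + val x)%R 0%R i| <= \sum_i `|lam 0%R i| + \sum_i `|val x 0%R i|)%N.
  by rewrite -big_split; apply: leq_sum => i _; rewrite mxE; exact: T.
move: (\sum_i `|(lam + _)%R 0%R i|)%N (\sum_i `|lam 0%R i|)%N (\sum_i `|val x 0%R i|)%N => t1 t2 t3.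
nia.
Qed.

Lemma Theta_term_bsum (K0 K : R) : 0 <= K0 -> 1 <= K -> exists B, bsum (fun x : ker_lattice =>
   normc (Theta_coef lam (val x)) * (K0 * K ^+ wsize (Lres D J (lam + val x) + wz (val x)))) B.
Proof.
move=> K00 K1; have [A HA] := Theta_term_size.
have [B HB] := Theta_coef_bound lam (exprn_ege1 A K1).
exists (K0 * K ^+ A * B).
have g0 (u : 'rV[int]_n) : 0 <= K0 * K ^+ A * (normc (Theta_coef lam u) * (K ^+ A) ^+ (\sum_i `|u 0%R i|)%N).
  by rewrite !mulr_ge0 ?normc_ge0 ?exprn_ge0//; lra.
apply: (bsum_inj (h := val) val_inj g0 _ (bsumZ _ HB)); last by rewrite mulr_ge0 ?exprn_ge0//; lra.
move=> x; have := HA x; move: (wsize _) => w wA.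
rewrite [leRHS](_ : _ = normc (Theta_coef lam (val x)) * (K0 * (K ^+ A * (K ^+ A) ^+ (\sum_i `|val x 0%R i|)%N))); last by ring.
by rewrite ler_wpM2l ?normc_ge0// ler_wpM2l// -exprM -exprD ler_weXn2l.
Qed.

Lemma Theta_term_asum x : torus x -> exists s, asum (Theta_term lam J (e x)) s.
Proof.
move=> Tx; have [dl [K0 [K [/andP[dl0 dl1] K00 K1 H]]]] := es_good sp Tx.
have [B HB] := Theta_term_bsum K00 K1; apply: (asum_ex (B := B)); apply: bsum_le HB => t.
rewrite normcM ler_wpM2l ?normc_ge0//.
by have := expands_at dl0 (H _ (Theta_term_lat t)).
Qed.

(** The constants in the expansions of the terms are summable by
    [Theta_term_bsum]. *)
Lemma holo_Theta : holo (fun x => Theta_val q D lam J (e x)).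
Proof.
move=> x Tx; have [dl [K0 [K [/andP[dl0 dl1] K00 K1 H]]]] := es_good sp Tx.
have /nbhsC[ep ep0 HT] := torus_nbhs Tx.
pose dl' := Num.min dl ep.
have dl'0 : 0 < dl' by rewrite lt_min dl0.
have dl'1 : dl' <= 1 by rewrite ge_min dl1.
have inT h : nrm h < dl' -> torus (x + h).
  by rewrite lt_min => /andP[_ hh]; apply: HT; rewrite addrC addKr.
have [B HB] := Theta_term_bsum K00 K1.
have Bs : bsum (fun t : ker_lattice => 4 * normc (Theta_coef lam (val t)) *
    (K0 * K ^+ wsize (Lres D J (lam + val t) + wz (val t)))) (4 * B).
  by apply: bsum_le (bsumZ (_ : 0 <= 4) HB) => // t; rewrite -mulrA.
have g : expands x dl' (fun y => summability.sum (Theta_term lam J (e y))) (4 * B).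
  apply: (@expands_sum _ _ x dl' dl'0 _ (fun (t : ker_lattice) y => Theta_coef lam (val t) *
     e y (Lres D J (lam + val t) + wz (val t))) _ _ _ _ Bs).
    move=> t; apply: expands_mul => //; first by apply: expands_cst.
    have [L [l1 l2 l3 l4]] := H _ (Theta_term_lat t).
    by exists L; split => // h; rewrite lt_min => /andP[hh _]; [exact: l2|exact: l4].
  move=> h hh; have [s [_ hs]] := Theta_term_asum (inT h hh).
  by rewrite (has_sumE hs).
have gc : expands x dl' (fun=> qpoch q ^- r') (normc (qpoch q ^- r')) by exact: expands_cst.
have := expands_mul dl'0 dl'1 gc g.
exact: expands_differentiable.
Qed.
End OneJ.
End Theta.
End EvalSpec.

(** * Elliptic stable classes as products of theta functions *)

Section ThetaFun.
Variables (R : realType) (q : R[i]).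

Lemma theta_thetaF (s : R[i]) : s != 0 -> theta q s = s * thetaF q (s ^+ 2).
Proof.
move=> s0; rewrite /theta /thetaF mulrA; congr (_ * _).
by rewrite mulrBr mulr1 exprS expr1 invfM mulrA mulfV// mul1r.
Qed.

Lemma theta_inv (s : R[i]) : theta q s^-1 = - theta q s.
Proof.
rewrite /theta -mulNr opprB invrK; congr (_ * _); congr (limn _).
by apply: funext => N; apply: eq_bigr => m _; rewrite mulrC exprVn invrK.
Qed.

Lemma thetaF1 : thetaF q 1 = 0.
Proof. by rewrite /thetaF invr1 subrr mul0r. Qed.
End ThetaFun.

(** The exponents of v met in the stable class, with l_j in the form given by
    [ell_eq]. *)
Section Tau.
Variable n : nat.
Implicit Types (L : weight n) (be : 'rV[int]_n).

Lemma dotNr (x y : 'rV[int]_n) : dot x (- y) = - dot x y.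
Proof. by rewrite dotC dotNl dotC. Qed.

Lemma tau_z L : L.1.2 = 0 -> tau L = L.
Proof.
case: L => [[w1 w2] w3] /= ->; rewrite /tau /=.
by rewrite dotC /dot big1 ?addr0// => i _; rewrite mxE mul0r.
Qed.

Lemma tau_num L be c : L.1.2 = 0 ->
  tau (wv (- dot kappa be + c + 1 - 1) + wz be + L) = L + (0, be, c).
Proof.
case: L => [[w1 w2] w3] /= ->; apply: (congr2 pair); first apply: (congr2 pair).
- by rewrite /= !add0r addr0.
- by rewrite /= !add0r addr0.
- by rewrite /= !addr0 add0r; ring.
Qed.

Lemma tau_den be c :
  tau (wv (- dot kappa be + c + 1) + wz be) = wv 1 + (0, be, c).
Proof.
apply: (congr2 pair); first apply: (congr2 pair) => //.
by rewrite /= !addr0 add0r; ring.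
Qed.

Lemma tau_numN L be c : L.1.2 = 0 ->
  tau (wv (- (- dot kappa be + c + -1) - 1) + wz (- be) - L) = - (L + (0, be, c)).
Proof.
case: L => [[w1 w2] w3] /= ->; apply: (congr2 pair); first apply: (congr2 pair).
- by rewrite /= !add0r addr0.
- by rewrite /= !add0r oppr0 addr0.
- by rewrite /= oppr0 !addr0 !add0r dotNr; ring.
Qed.

Lemma tau_denN be c :
  tau (wv (- (- dot kappa be + c + -1)) + wz (- be)) = wv 1 - (0, be, c).
Proof.
apply: (congr2 pair); first apply: (congr2 pair).
- by rewrite /= oppr0.
- by [].
- by rewrite /= !addr0 !add0r dotNr; ring.
Qed.
End Tau.

Section Stable.
Variables (R : realType) (d r : nat).
Local Notation C := R[i].
Local Notation P := (tpoint R d r).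
Local Notation M := (merofield R d r).
Variables (q : C) (n d' r' : nat) (D : toric_data n d' r') (e : P -> weight n -> C).
Hypotheses (q0 : q != 0) (q1 : normc q < 1).
Hypothesis hD : toric_hyperkahler D.
Hypothesis sp : eval_spec D e.
Let a := ta D.
Let b := tb D.

Definition pos_sign (I : {set 'I_n}) k := if k \in I then k \in Iplus D I else k \in Icplus D I.
(** Each of these indices reverses the sign once, because theta is odd. *)
Definition sign_exp I : nat := #|[pred k | pos_sign I k]|.
Definition cross_wt (I J : {set 'I_n}) k := Lres D J (eps k) + Ldres D I (eps k).
(** The arguments of the denominators in the stable class, after the
    substitution tau. *)
Definition denom_wt (I : {set 'I_n}) j : weight n :=
  if j \in Icplus D I then wv 1 + Ldres D I (eps j) else wv 1 - Ldres D I (eps j).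

Lemma sign_expE I : (-1) ^+ sign_exp I = \prod_k (if pos_sign I k then -1 else 1) :> C.
Proof. by rewrite -big_mkcond prodr_const. Qed.

Lemma prodr_mem (T : comNzRingType) (A : {set 'I_n}) (F : 'I_n -> T) :
  \prod_(i in A) F i = \prod_i (if i \in A then F i else 1).
Proof. by rewrite big_mkcond. Qed.

Section Pair.
Variables I J : {set 'I_n}.
Hypotheses (IB : I \in bases a) (JB : J \in bases a).

Lemma wlat_wv k : wlat D (wv k).
Proof. by split; exact: ker0. Qed.

Lemma cross_wt_lat k : wlat D (cross_wt I J k).
Proof. by apply: wlatD; [exact: (Lres_lat hD JB)|exact: (Ldres_lat hD IB)]. Qed.

Lemma denom_wt_lat j : wlat D (denom_wt I j).
Proof.
have L := Ldres_lat hD IB (eps j).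
by rewrite /denom_wt; case: ifP => _; apply: wlatD => //; [exact: wlat_wv|exact: wlat_wv|exact: wlatN].
Qed.

Lemma Lres_N lam : Lres D J (- lam) = - Lres D J lam.
Proof.
apply/eqP; rewrite -addr_eq0 -Lres_D addNr Lres_ker//; exact: ker0.
Qed.

Lemma Ldres_N lam : Ldres D I (- lam) = - Ldres D I lam.
Proof.
apply/eqP; rewrite -addr_eq0 -Ldres_D addNr Ldres_ker//; exact: ker0.
Qed.

Variable x : P.
Hypothesis Tx : torus x.
Let h := e (sqrt_point x).
Let Ty : torus (sqrt_point x) := torus_sqrt Tx.

Lemma theta_h w : theta q (h w) = h w * thetaF q (e x w).
Proof. by rewrite theta_thetaF ?(es_sqrt sp)// (es_neq0 sp). Qed.

Lemma theta_hN w : wlat D w -> theta q (h (- w)) = - theta q (h w).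
Proof. by move=> hw; rewrite /h (evalN sp)// theta_inv. Qed.

(** Index by index: numerators are theta functions of the cross weight or its
    inverse; a denominator equals, up to sign, the factor of the normal bundle
    at p_I^! with the same index; and the square roots of the cross weights
    multiply to the square root of L(kappa) L^!(kappa). *)
Lemma frakS_fac : frakS q D I J h = (-1) ^+ sign_exp I *
  \prod_k (thetaF q (e x (cross_wt I J k)) *
    (if k \in I then 1 else thetaF q (e x (denom_wt I k)) * (thetaF q (e x (denom_wt I k)))^-1)).
Proof.
rewrite /frakS /stab_ell /stabAO !prodr_mem -!big_split /=.
have -> : h (Lres D J kappa + Ldres D I kappa) = \prod_k h (cross_wt I J k).
  have kE : (kappa : 'rV[int]_n) = \sum_k eps k.
    by rewrite [LHS]row_sum_delta; apply: eq_bigr => k _; rewrite mxE scale1r.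
  have WE (s : seq 'I_n) : h (Lres D J (\sum_(k <- s) eps k) + Ldres D I (\sum_(k <- s) eps k))
      = \prod_(k <- s) h (cross_wt I J k).
    elim: s => [|k s IH].
      rewrite !big_nil (Lres_ker hD JB) ?(Ldres_ker hD IB); [|exact: ker0|exact: ker0].
      by rewrite -[RHS](eval0 sp Ty); congr (e _ _); rewrite -[LHS]/(0 + 0, 0 + 0, 0 + 0) !addr0.
    rewrite !big_cons Lres_D Ldres_D addrACA -IH; apply: (es_add sp) => //; first exact: cross_wt_lat.
    by apply: wlatD; [exact: (Lres_lat hD JB)|exact: (Ldres_lat hD IB)].
  by rewrite kE WE.
rewrite sign_expE -prodfV -!big_split /=; apply: eq_bigr => k _.
have hW : h (cross_wt I J k) != 0 by exact: (es_neq0 sp).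
rewrite !(IminusE hD IB) !(IcminusE hD IB) /pos_sign.
have [kI|kI] := boolP (k \in I); rewrite /=.
- have WE := Ldres_eps_in hD IB kI.
  have -> : (k \in Icplus D I) = false by rewrite IcplusE kI.
  case: ifP WE => kp WE; rewrite ?kp ?mulr1 ?mul1r /=.
    have -> : tau (wv (-1) + Lres D J (- eps k)) = - cross_wt I J k.
      rewrite tau_z; last by rewrite /= addr0.
      rewrite Lres_N /cross_wt WE opprD addrC; congr (_ + _).
      by rewrite -[RHS]/(- 0, - 0, - 1) !oppr0.
    rewrite theta_hN ?theta_h; last exact: cross_wt_lat.
    by rewrite mulrN mulKf// mulN1r.
  have -> : tau (wv (-1) + Lres D J (eps k)) = cross_wt I J k.
    rewrite tau_z; last by rewrite /= addr0.
    by rewrite /cross_wt WE addrC.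
  by rewrite theta_h mulKf.
have WE := Ldres_eps_out hD IB kI.
have LE := ell_eq hD IB kI.
have nb : wlat D (denom_wt I k) by exact: denom_wt_lat.
have kP : (k \in Iplus D I) = false by rewrite (IplusE D I) (negbTE kI).
have Lz : (Lres D J (eps k)).1.2 = 0 by [].
have hd : h (denom_wt I k) != 0 by exact: (es_neq0 sp).
rewrite kP; case: ifP LE => kp LE; rewrite ?kp ?mulr1 ?mul1r /=.
  have dn : denom_wt I k = wv 1 + Ldres D I (eps k) by rewrite /denom_wt kp.
  have -> : tau (wv (ell D I k - 1) + wz (betaI (ta D) I k) + Lres D J (eps k)) = cross_wt I J k.
    by rewrite LE /cross_wt WE tau_num.
  have -> : tau (wv (ell D I k) + wz (betaI (ta D) I k)) = denom_wt I k.
    by rewrite LE dn WE tau_den.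
  have -> : wv (-1) + Ldres D I (- eps k) = - denom_wt I k.
    rewrite Ldres_N dn opprD; congr (_ + _).
    by rewrite -[RHS]/(- 0, - 0, - 1) !oppr0.
  rewrite theta_hN// !theta_h invfM.
  move: (thetaF q (e x (denom_wt I k)))^-1 => t2.
move: (thetaF q (e x (denom_wt I k))) (thetaF q (e x (cross_wt I J k))) => t1 t3.
  field.
  by rewrite hW hd.
have dn : denom_wt I k = wv 1 - Ldres D I (eps k) by rewrite /denom_wt kp.
have -> : tau (wv (- ell D I k - 1) + wz (- betaI (ta D) I k) + Lres D J (- eps k)) = - cross_wt I J k.
  by rewrite LE Lres_N /cross_wt WE tau_numN.
have -> : tau (wv (- ell D I k) + wz (- betaI (ta D) I k)) = denom_wt I k.
  by rewrite LE dn WE tau_denN.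
have -> : wv (-1) + Ldres D I (eps k) = - denom_wt I k.
  rewrite dn opprB addrC; congr (_ + _).
  by rewrite -[RHS]/(- 0, - 0, - 1) !oppr0.
rewrite !theta_hN//; last exact: cross_wt_lat.
rewrite !theta_h invfM.
move: (thetaF q (e x (denom_wt I k)))^-1 => t2.
move: (thetaF q (e x (denom_wt I k))) (thetaF q (e x (cross_wt I J k))) => t1 t3.
field.
by rewrite hW hd.
Qed.
End Pair.

Definition theta_prod I J : M := mclass (fun x => \prod_k thetaF q (e x (cross_wt I J k))).

Lemma mclass_sign (m : nat) : mclass (fun _ : P => (-1) ^+ m : C) = (-1) ^+ m.
Proof.
elim: m => [|m IH]; first by rewrite !expr0 mclass1.
have N1 : mclass (fun _ : P => -1 : C) = -1.
  apply/eqP; rewrite -subr_eq0 opprK -mclass1 -mclassD; try exact: mero_cst.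
  by rewrite addNr mclass0.
under eq_fun do rewrite exprS.
by rewrite mclassM ?IH ?N1 ?exprS//; exact: mero_cst.
Qed.

Lemma holo_cross_wt I J k : I \in bases a -> J \in bases a -> holo (fun x => thetaF q (e x (cross_wt I J k))).
Proof. by move=> IB JB; apply: (holo_theta q0 q1 sp); exact: cross_wt_lat. Qed.

Lemma betaI_neq0 I j : I \in bases a -> j \notin I -> betaI a I j != 0.
Proof.
move=> IB jI; apply/eqP => h; have := betaI_val hD IB jI jI.
by rewrite h mxE eqxx.
Qed.

Lemma dense_denom_wt I j : I \in bases a -> j \notin I -> dense_neq0 (fun x => thetaF q (e x (denom_wt I j))).
Proof.
move=> IB jI; apply: (dense_theta q0 q1 sp); first exact: denom_wt_lat.
right; rewrite /denom_wt (Ldres_eps_out hD IB jI).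
by case: ifP => _; rewrite /= add0r ?oppr_eq0; exact: betaI_neq0.
Qed.

(** The quotients left in [frakS_fac] are 1 in the field, since the theta
    functions of the nontrivial weights [denom_wt] are invertible there. *)
Lemma frakS_mclass I J : I \in bases a -> J \in bases a ->
  mclass (fun x => frakS q D I J (e (sqrt_point x))) = (-1) ^+ sign_exp I * theta_prod I J.
Proof.
move=> IB JB; rewrite (mclass_ext (fun x Tx => frakS_fac IB JB Tx)).
have mW k : meromorphic (fun x => thetaF q (e x (cross_wt I J k))).
  by apply: holo_mero; exact: holo_cross_wt.
have mX k : meromorphic (fun x : P => if k \in I then 1 else thetaF q (e x (denom_wt I k)) * (thetaF q (e x (denom_wt I k)))^-1).
  have [kI|kI] := boolP (k \in I); first exact: mero_cst.
  apply: meromorphic_mul; first by apply: holo_mero; apply: (holo_theta q0 q1 sp); exact: denom_wt_lat.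
  by apply: mero_inv; [apply: (holo_theta q0 q1 sp); exact: denom_wt_lat|exact: dense_denom_wt].
have mWX k : meromorphic (fun x => thetaF q (e x (cross_wt I J k)) *
    (if k \in I then 1 else thetaF q (e x (denom_wt I k)) * (thetaF q (e x (denom_wt I k)))^-1)).
  exact: meromorphic_mul (mW k) (mX k).
rewrite mclassM ?mclass_sign; [|exact: mero_cst|exact: (mero_prod _ mWX).1].
rewrite /theta_prod (mero_prod _ mWX).2 (mero_prod _ mW).2; congr (_ * _); apply: eq_bigr => k _.
rewrite mclassM// -[RHS]mulr1; congr (_ * _).
have [kI|kI] := boolP (k \in I); first exact: mclass1.
rewrite mclassM.
- by apply: mclassV; [apply: (holo_theta q0 q1 sp); exact: denom_wt_lat|exact: dense_denom_wt].
- by apply: holo_mero; apply: (holo_theta q0 q1 sp); exact: denom_wt_lat.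
- by apply: mero_inv; [apply: (holo_theta q0 q1 sp); exact: denom_wt_lat|exact: dense_denom_wt].
Qed.

(** At such an index both line bundles restrict to a power of v, and the two
    powers are inverse to each other; so one factor is theta(1) = 0. *)
Lemma theta_prod_vanish I J i : I \in bases a -> J \in bases a -> i \in I -> i \notin J ->
  (i \in Iplus D I) != (i \in Icplus D J) -> theta_prod I J = 0.
Proof.
move=> IB JB iI iJ ne; rewrite /theta_prod -[RHS]mclass0; apply: mclass_ext => x Tx.
rewrite (bigD1 i)//= /cross_wt (Ldres_eps_in hD IB iI) (Lres_eps_out hD JB iJ).
set w := (X in e x X); have -> : w = 0.
  rewrite /w -[LHS]/(0 + 0, 0 + 0, _ + _) !addr0.
  by move: ne; case: (i \in Iplus D I); case: (i \in Icplus D J).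
by rewrite (eval0 sp Tx) thetaF1 mul0r.
Qed.

(** For I = J every cross weight is nontrivial: it contains alpha^I_k if k is
    in I, and beta^I_k otherwise. *)
Lemma theta_prod_diag I : I \in bases a -> exists u, u * theta_prod I I = 1.
Proof.
move=> IB; have mW k : meromorphic (fun x => thetaF q (e x (cross_wt I I k))).
  by apply: holo_mero; exact: holo_cross_wt.
exists (\prod_k mclass (fun x => (thetaF q (e x (cross_wt I I k)))^-1)).
rewrite /theta_prod (mero_prod _ mW).2 -big_split /= big1// => k _; rewrite mulrC.
apply: mclassV; first exact: holo_cross_wt.
apply: (dense_theta q0 q1 sp); first exact: cross_wt_lat.
have [kI|kI] := boolP (k \in I).
  left; rewrite /cross_wt (Ldres_eps_in hD IB kI) -[X in X != 0]/((Lres D I (eps k)).1.1 + 0) addr0 (Lres_eps_in hD IB kI).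
  apply/eqP => h; have := alphaI_val hD IB kI kI.
  by rewrite h mxE eqxx.
by right; rewrite /cross_wt (Ldres_eps_out hD IB kI) /= add0r; exact: betaI_neq0.
Qed.

End Stable.

(** * Expansion in products of theta series *)

Section Characters.
Variables (F : fieldType) (n : nat).

Lemma expz_sum (c : F) (I : Type) (s : seq I) (f : I -> int) : c != 0 ->
  c ^ (\sum_(i <- s) f i) = \prod_(i <- s) c ^ f i.
Proof. by move=> c0; apply: (big_morph (fun z : int => c ^ z)) => // u v; rewrite expfzDr. Qed.

Lemma char_rV (phi : 'rV[int]_n -> F) mu :
  (forall x y, phi (x + y) = phi x * phi y) -> (forall x, phi x != 0) ->
  phi mu = \prod_i phi (eps i) ^ mu 0 i.
Proof.
move=> phiD phi_n0.
have phi0 : phi 0 = 1 by apply: (mulfI (phi_n0 0)); rewrite -phiD addr0 mulr1.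
have phiX v (k : nat) : phi (v *+ k) = phi v ^+ k.
  by elim: k => [|k IH]; rewrite ?mulr0n ?expr0// mulrS phiD IH exprS.
have phiZ (c : int) v : phi (c *: v) = phi v ^ c.
  have -> : c *: v = v *~ c by rewrite -scaler_int intz.
  case: c => k; first exact: phiX.
  rewrite NegzE mulrNz -exprnN; apply: (mulfI (phi_n0 (v *+ k.+1))).
  by rewrite -phiD subrr phi0 phiX mulfV// expf_neq0.
rewrite [in LHS](row_sum_delta mu) (big_morph phi phiD phi0).
by apply: eq_bigr => i _; exact: phiZ.
Qed.
End Characters.

Section QuadraticForm.
Variable n : nat.
Implicit Types x y : 'rV[int]_n.

Definition tri_sum x : int := \sum_i tri (x 0 i).

Lemma triD (u v : int) : tri (u + v) = tri u + tri v + u * v.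
Proof. by apply: (mulIf (_ : 2 != 0)) => //; rewrite !mulrDl !tri2; ring. Qed.

(** The exponent of q is additive on orthogonal vectors, which is why a coset
    sum factors. *)
Lemma tri_sumD x y : tri_sum (x + y) = tri_sum x + tri_sum y + dot x y.
Proof. by rewrite /tri_sum /dot -!big_split /=; apply: eq_bigr => i _; rewrite mxE triD. Qed.

Lemma dot_self0 x : dot x x = 0 -> x = 0.
Proof.
move=> h; apply/rowP => i; rewrite mxE; apply/eqP; rewrite -sqrf_eq0 expr2.
have nn j : true -> 0 <= x 0 j * x 0 j by rewrite -expr2 sqr_ge0.
by rewrite (psumr_eq0P nn h).
Qed.
End QuadraticForm.

Section Expansion.
Variables (R : realType) (d r : nat).
Local Notation C := R[i].
Local Notation P := (tpoint R d r).
Local Notation M := (merofield R d r).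
Variables (q : C) (n d' r' : nat) (D : toric_data n d' r') (e : P -> weight n -> C).
Hypotheses (q0 : q != 0) (q1 : normc q < 1).
Hypothesis hD : toric_hyperkahler D.
Hypothesis sp : eval_spec D e.
Let a := ta D.
Let b := tb D.
Let ab : split_pair a b := hk_split hD.
Let hD' := dual_hk hD.
Let ed := fun (x : P) (w : weight n) => e x (wswap w).
Let spd : eval_spec (dual_data D) ed := eval_spec_dual sp.

Definition lift_coef (lam : 'rV[int]_n) : C :=
  (-1) ^ dot lam kappa * q ^ (dot lam (lam + kappa) %/ 2)%Z.

Section Pair.
Variables I J : {set 'I_n}.
Hypotheses (IB : I \in bases a) (JB : J \in bases a).
Let IB' : ~: I \in bases (ta (dual_data D)) := compl_basis hD IB.

Section Point.
Variable x : P.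
Hypothesis Tx : torus x.

(** The general term of the product of the n triple product series. *)
Definition fullterm (mu : 'rV[int]_n) : C :=
  \prod_i theta_term q (e x (cross_wt D I J i)) (mu 0 i).

Lemma fullterm_asum :
  asum fullterm (qpoch q ^+ n * \prod_i thetaF q (e x (cross_wt D I J i))).
Proof.
have := asum_rV (fun i => jacobi_triple q0 q1 (es_neq0 sp (cross_wt D I J i) Tx)).
by rewrite big_split /= prodr_const card_ord.
Qed.

Lemma fulltermE mu : fullterm mu =
  (-1) ^ dot kappa mu * q ^ tri_sum mu * e x (Lres D J mu + Ldres D I mu).
Proof.
rewrite (@char_rV _ _ (fun mu => e x (Lres D J mu + Ldres D I mu)) mu).
- rewrite /fullterm /theta_term !big_split /=; congr (_ * _ * _); last by rewrite /tri_sum expz_sum.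
  rewrite /dot expz_sum ?oppr_eq0 ?oner_eq0//.
  by apply: eq_bigr => i _; rewrite mxE mul1r.
- move=> u v; rewrite Lres_D Ldres_D addrACA; apply: (es_add sp Tx).
    by apply: wlatD; [exact: (Lres_lat hD JB)|exact: (Ldres_lat hD IB)].
  by apply: wlatD; [exact: (Lres_lat hD JB)|exact: (Ldres_lat hD IB)].
- by move=> u; exact: (es_neq0 sp).
Qed.

(** Moving alpha or beta into the argument of a line bundle is harmless:
    L(alpha) restricts to a^alpha at every fixed point of X, and L^!(beta) to
    z^beta at every fixed point of X^!. *)
Lemma pairterm lam (u : ker_lattice D) (v : ker_lattice (dual_data D)) :
  lift_coef lam * (Theta_term q lam J (e x) u * Theta_term q lam (~: I) (ed x) v)
  = fullterm (lam + val u + val v).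
Proof.
have ua : ker a (val u) by exact/eqP/(valP u).
have vb : ker b (val v) by exact/eqP/(valP v).
rewrite fulltermE /Theta_term /Theta_coef /lift_coef !half_dot -!/(tri_sum _) !tri_sumD.
rewrite dotDl (_ : dot (val u) (val v) = 0); last exact: (dot_ker ab).
have N1 : (-1 : C) != 0 by rewrite oppr_eq0 oner_eq0.
rewrite !dotDr !expfzDr// (dotC kappa lam).
have -> : e x (Lres D J (lam + val u + val v) + Ldres D I (lam + val u + val v)) =
   e x (Lres D J (lam + val u) + wz (val u)) *
   ed x (Lres (dual_data D) (~: I) (lam + val v) + wz (val v)).
  rewrite /ed -(es_add sp Tx); [|exact: (Theta_term_lat hD lam JB u)|by have [? ?] := Theta_term_lat hD' lam IB' v; split].
  congr (e x _); rewrite (Lres_D _ _ (lam + val u)) (Lres_ker hD JB vb).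
  rewrite (addrAC lam) (Ldres_D _ _ (lam + val v)) (Ldres_ker hD IB ua) /Ldres.
  case: (Lres D J _) => [[a1 a2] a3]; case: (Lres _ _ _) => [[b1 b2] b3].
  apply: (congr2 pair); first apply: (congr2 pair).
  - by rewrite /= !addr0 -!addrA (addrC (val v)).
  - by rewrite /= !addr0 -!addrA (addrC (val u)).
  - by rewrite /= !addr0.
rewrite expr0z.
move: (e x _) (ed x _) ((-1) ^ dot lam _) ((-1) ^ dot _ (val u)) ((-1) ^ dot _ (val v)).
move: (q ^ tri_sum lam) (q ^ tri_sum (val u)) (q ^ tri_sum (val v)) (q ^ dot lam (val u)) (q ^ dot lam (val v)).
by move=> *; ring.
Qed.

(** A pair (beta, alpha) is determined by beta + alpha, because the two
    lattices are orthogonal for a definite form. *)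
Lemma coset_asum lam :
  asum (fun mu => if `[< Xi_equiv D lam mu >] then fullterm mu else 0)
   (qpoch q ^+ n * (lift_coef lam * Theta_val q (dual_data D) lam (~: I) (ed x)
                    * Theta_val q D lam J (e x))).
Proof.
have [s1 A1] := Theta_term_asum q0 q1 hD sp lam JB Tx.
have [s2 A2] := Theta_term_asum q0 q1 hD' spd lam IB' Tx.
have qp0 := qpoch_neq0 q1.
rewrite !Theta_valE (has_sumE A1.2) (has_sumE A2.2).
have -> : qpoch q ^+ n * (lift_coef lam * (qpoch q ^- d' * s2) * (qpoch q ^- r' * s1)) = lift_coef lam * (s1 * s2).
  rewrite -(hk_dim hD) exprD; field.
  by rewrite !expf_neq0.
apply: (asum_inj (h := fun p : ker_lattice D * ker_lattice (dual_data D) => lam + val p.1 + val p.2)).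
- move=> [u v] [u' v'] /=; rewrite -!addrA => /addrI E.
  have ua : ker a (val u - val u') by apply: kerB; [exact/eqP/(valP u)|exact/eqP/(valP u')].
  have vb : ker b (val v' - val v) by apply: kerB; [exact/eqP/(valP v')|exact/eqP/(valP v)].
  have uv : val u - val u' = val v' - val v.
    by apply/eqP; rewrite subr_eq addrAC eq_sym subr_eq addrC -E addrC.
  have z : val u - val u' = 0 by apply: dot_self0; rewrite {2}uv; exact: (dot_ker ab).
  have uu : u = u' by apply: val_inj; apply/eqP; rewrite -subr_eq0 z.
  have vv : v = v' by apply: val_inj; apply/esym/eqP; rewrite -subr_eq0 -uv z.
  by rewrite uu vv.
- move=> mu N; case: asboolP => // -[u [v [hu hv E]]]; exfalso.
  have := N (exist _ u (introT eqP hu), exist _ v (introT eqP hv)).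
  by rewrite /= -addrA => /eqP; apply; rewrite E.
apply: asum_ext (asumZ (lift_coef lam) (asum_prod A1 A2)) => -[u v] /=.
rewrite pairterm; case: asboolP => // N; exfalso; apply: N.
exists (val u), (val v); split; [exact/eqP/(valP u)|exact/eqP/(valP v)|by rewrite addrA].
Qed.

(** Every element of Z^n lies in the coset of exactly one lift. *)
Lemma expansion_point s : Xi_lifts D s ->
  \sum_(lam <- s) (lift_coef lam * Theta_val q (dual_data D) lam (~: I) (ed x)
                    * Theta_val q D lam J (e x)) = \prod_i thetaF q (e x (cross_wt D I J i)).
Proof.
move=> hs; have qp0 := qpoch_neq0 q1.
apply: (mulfI (expf_neq0 n qp0)); rewrite big_distrr /=.
have [_ h1] := asum_sum s coset_asum.
apply: has_sum_unique h1 _; have [_ h2] := fullterm_asum.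
apply: has_sum_ext h2 => mu.
by rewrite -big_mkcond /= big_const_seq hs /= addr0.
Qed.

(** Both sides are the sum of the same series over the same coset. *)
Lemma term_point lam mu : Xi_equiv D lam mu ->
  lift_coef lam * Theta_val q (dual_data D) lam (~: I) (ed x) * Theta_val q D lam J (e x) =
  lift_coef mu * Theta_val q (dual_data D) mu (~: I) (ed x) * Theta_val q D mu J (e x).
Proof.
move=> E; apply: (mulfI (expf_neq0 n (qpoch_neq0 q1))).
have [_ h1] := coset_asum lam; have [_ h2] := coset_asum mu.
apply: has_sum_unique h1 _; apply: has_sum_ext h2 => nu.
suff -> : `[< Xi_equiv D mu nu >] = `[< Xi_equiv D lam nu >] by [].
have [u [v [hu hv Emu]]] := E.
apply/asboolP/asboolP => -[u' [v' [hu' hv' ->]]].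
  exists (u + u'), (v + v'); split; [exact: kerD|exact: kerD|].
  by rewrite Emu -!addrA; congr (_ + (_ + _)); rewrite addrCA.
exists (u' - u), (v' - v); split; [exact: kerB|exact: kerB|].
have -> : u' - u + (v' - v) = u' + v' - (u + v) by rewrite opprD addrACA.
by rewrite Emu -addrA (addrCA (u + v)) subrr addr0.
Qed.
End Point.

Definition lift_class lam : M := mclass (fun _ : P => lift_coef lam).

Lemma mero_Theta lam : meromorphic (fun x => Theta_val q D lam J (e x)).
Proof. exact/holo_mero/(holo_Theta q0 q1 hD sp lam JB). Qed.

Lemma mero_Theta_dual lam : meromorphic (fun x => Theta_val q (dual_data D) lam (~: I) (ed x)).
Proof. exact/holo_mero/(holo_Theta q0 q1 hD' spd lam IB'). Qed.

Lemma term_mclass lam : lift_class lam * Theta_res q (dual_data D) ed lam (~: I) * Theta_res q D e lam J =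
  mclass (fun x => lift_coef lam * Theta_val q (dual_data D) lam (~: I) (ed x) * Theta_val q D lam J (e x)).
Proof.
have mc : meromorphic (fun _ : P => lift_coef lam) by exact: mero_cst.
have m1 := mero_Theta_dual lam; have m2 := mero_Theta lam.
by rewrite (mclassM (meromorphic_mul mc m1) m2) (mclassM mc m1).
Qed.

Lemma expansion_mclass s : Xi_lifts D s ->
  \sum_(lam <- s) lift_class lam * Theta_res q (dual_data D) ed lam (~: I) * Theta_res q D e lam J
  = theta_prod q D e I J.
Proof.
move=> hs; rewrite /theta_prod.
under eq_bigr do rewrite term_mclass.
rewrite -(mero_sum s _).2; first by apply: mclass_ext => x Tx; exact: expansion_point.
move=> lam; apply: meromorphic_mul; last exact: mero_Theta.
apply: meromorphic_mul; [exact: mero_cst|exact: mero_Theta_dual].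
Qed.

Lemma term_inv lam mu : Xi_equiv D lam mu ->
  lift_class lam * Theta_res q (dual_data D) ed lam (~: I) * Theta_res q D e lam J =
  lift_class mu * Theta_res q (dual_data D) ed mu (~: I) * Theta_res q D e mu J.
Proof.
move=> E; apply: etrans (term_mclass lam) _; apply: etrans (esym (term_mclass mu)).
by apply: mclass_ext => x Tx; have := term_point Tx E; exact.
Qed.
End Pair.
End Expansion.

(** * The bar involution *)

Section Opposite.
Variables (n d r : nat) (D : toric_data n d r).

Lemma opp_xi_hk : toric_hyperkahler D -> toric_hyperkahler (opp_xi D).
Proof.
move=> h; split; try by case: h.
move=> C hC; rewrite /pairing /= dotNl oppr_eq0; exact: (hk_xi h hC).
Qed.

Lemma Icplus_opp K : Icplus (dual_data (opp_xi D)) K = Icminus (dual_data D) K.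
Proof. by apply/setP => k; rewrite !inE /pairing /= dotNl oppr_gt0. Qed.

Lemma Icminus_opp K : Icminus (dual_data (opp_xi D)) K = Icplus (dual_data D) K.
Proof. by apply/setP => k; rewrite !inE /pairing /= dotNl oppr_lt0. Qed.

Lemma Lres_opp K lam : Lres (dual_data (opp_xi D)) K lam =
  ((Lres (dual_data D) K lam).1, - (Lres (dual_data D) K lam).2).
Proof. by rewrite /Lres Icplus_opp Icminus_opp /= opprB. Qed.

(** Replacing xi by -xi changes the sign attached to each of the d elements of
    I and to no other index. *)
Lemma sign_exp_opp (T : comNzRingType) I : toric_hyperkahler D -> I \in bases (ta D) ->
  (-1) ^+ sign_exp D I = (-1) ^+ d * (-1) ^+ sign_exp (opp_xi D) I :> T.
Proof.
move=> hD IB.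
have E D' : (-1) ^+ sign_exp D' I = \prod_k (if pos_sign D' I k then -1 else 1) :> T.
  by rewrite -big_mkcond prodr_const.
have -> : (-1) ^+ d = \prod_k (if k \in I then -1 else 1) :> T.
  by rewrite -big_mkcond prodr_const (basis_card IB).
rewrite !E -big_split /=; apply: eq_bigr => k _; rewrite /pos_sign.
have [kI|kI] := boolP (k \in I); last by rewrite mul1r.
have -> : (k \in Iplus (opp_xi D) I) = (k \notin Iplus D I).
  by have := IminusE hD IB k; rewrite kI /= => <-; rewrite /Iplus Icplus_opp.
by case: (k \in Iplus D I); rewrite ?mulr1 ?mulrNN ?mulr1.
Qed.
End Opposite.

Section BarMap.
Variables (R : realType) (d r : nat).
Local Notation C := R[i].
Local Notation P := (tpoint R d r).
Local Notation M := (merofield R d r).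
Variables (q : C) (n d' r' : nat) (D : toric_data n d' r') (e : P -> weight n -> C).
Hypotheses (q0 : q != 0) (q1 : normc q < 1).
Hypothesis hD : toric_hyperkahler D.
Hypothesis sp : eval_spec D e.
Let a := ta D.
Let ed := fun (x : P) (w : weight n) => e x (wswap w).
Let Dm := opp_xi D.
Let hDm : toric_hyperkahler Dm := opp_xi_hk hD.

Lemma eval_spec_opp : eval_spec Dm e.
Proof. by case: sp => h1 h2 h3 h4 h5 h6; split. Qed.
Let spm := eval_spec_opp.

(** Only the exponents of v in the restrictions of L^! depend on xi, and these
    change sign with xi. *)
Lemma bar_Theta_dual I lam : I \in bases a ->
  bar (Theta_res q (dual_data D) ed lam (~: I)) = Theta_res q (dual_data Dm) ed lam (~: I).
Proof.
move=> IB; rewrite bar_mclass; last exact: (mero_Theta_dual q0 q1 hD sp IB lam).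
apply: mclass_ext => x Tx; rewrite !Theta_valE; congr (_ * _); apply: (congr1 (@summability.sum _ _ _)).
apply: funext => al; rewrite /Theta_term; congr (_ * _).
by rewrite /ed (es_bar sp) Lres_opp; congr (e x _); rewrite /wswap /= !addr0.
Qed.

Lemma bar_lift_class (lam : 'rV[int]_n) : bar (lift_class d r q lam) = lift_class d r q lam.
Proof. exact: bar_cst. Qed.

Local Notation B := {I : {set 'I_n} | I \in bases a}.
Let N := #|{: B}|.

Lemma card_basis : nb_bases D = N.
Proof. by rewrite /N card_sig /nb_bases; apply: eq_card => I; rewrite inE. Qed.

Definition nth_basis (k : 'I_N) : {set 'I_n} := val (enum_val k : B).
Lemma nth_basisB k : nth_basis k \in bases a. Proof. exact: (valP (enum_val k : B)). Qed.
Lemma nth_basis_inj : injective nth_basis.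
Proof. by move=> i j /val_inj; exact: enum_val_inj. Qed.

Definition Smat (D0 : toric_data n d' r') : 'M[M]_N := \matrix_(i, j) theta_prod q D0 e (nth_basis i) (nth_basis j).

(** In the Leibniz formula, a permutation with a nonzero product cannot
    decrease the potential at any index; as the total change is 0, it is the
    identity. So the determinant is the product of the diagonal entries. *)
Lemma Smat_det : exists u, u * \det (Smat D) = 1.
Proof.
have [phi Hphi] := potential_lt hD.
have S_lt i j : i != j -> Smat D i j != 0 -> phi (nth_basis i) < phi (nth_basis j).
  move=> ij; rewrite mxE => nz; apply: Hphi; [exact: nth_basisB|exact: nth_basisB| |].
    by rewrite (inj_eq nth_basis_inj).
  move=> k ki kj; apply/eqP/negPn/negP => ne; move/eqP: nz; apply.
  exact: (theta_prod_vanish q hD sp (nth_basisB i) (nth_basisB j) ki kj ne).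
have dE : \det (Smat D) = \prod_k Smat D k k.
  rewrite /determinant (bigD1 (1%g : 'S_N))//= odd_perm1 mul1r [X in _ + X]big1 ?addr0.
    by apply: eq_bigr => k _; rewrite perm1.
  move=> s s1; suff [i Hi] : exists i, Smat D i (s i) = 0.
    by rewrite (bigD1 i)//= Hi mul0r mulr0.
  apply: contrapT => Hn.
  have nz i : Smat D i (s i) != 0 by apply/eqP => h; apply: Hn; exists i.
  have [i0 Hi0] : exists i, s i != i.
    apply: contrapT => H; move/eqP: s1; apply; apply/perm.permP => i; rewrite perm1.
    by apply/eqP/negPn/negP => h; apply: H; exists i.
  have le i : true -> 0 <= phi (nth_basis (s i)) - phi (nth_basis i).
    move=> _; rewrite subr_ge0; have [->//|h] := eqVneq (s i) i.
    by apply/ltW/S_lt => //; rewrite eq_sym.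
  have z : \sum_i (phi (nth_basis (s i)) - phi (nth_basis i)) = 0.
    rewrite sumrB; apply/eqP; rewrite subr_eq0; apply/eqP.
    by rewrite [RHS](reindex_inj (@perm_inj _ s)).
  have := psumr_eq0P le z (i := i0) isT.
  have := S_lt i0 (s i0); rewrite eq_sym => /(_ Hi0 (nz i0)) h1 /eqP.
  by rewrite subr_eq0 => /eqP h2; rewrite h2 ltxx in h1.
pose u k := projT1 (cid (theta_prod_diag q0 q1 hD sp (nth_basisB k))).
have uE k : u k * Smat D k k = 1.
  by rewrite mxE; exact: (projT2 (cid (theta_prod_diag q0 q1 hD sp (nth_basisB k)))).
by exists (\prod_k u k); rewrite dE -big_split /= big1.
Qed.

Lemma Smat_inv : exists V, Smat D *m V = 1%:M.
Proof.
have [u hu] := Smat_det; exists (u *: \adj (Smat D)).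
by rewrite -scalemxAr mul_mx_adj scale_scalar_mx hu.
Qed.

(** Elements of the localized K-group as row vectors, for the matrix calculus
    below. *)
Definition Kloc_row (m : Kloc R d r a) : 'rV[M]_N := \row_k m (enum_val k).

Lemma Kloc_row_inj : injective Kloc_row.
Proof.
move=> m m' /rowP h; apply/ffunP => J; have := h (enum_rank J).
by rewrite !mxE enum_rankK.
Qed.

Lemma Kloc_rowD m m' : Kloc_row (m + m') = Kloc_row m + Kloc_row m'.
Proof. by apply/rowP => k; rewrite !mxE ffunE. Qed.

Lemma Kloc_rowZ c m : Kloc_row (Kscale c m) = c *: Kloc_row m.
Proof. by apply/rowP => k; rewrite !mxE ffunE. Qed.

Lemma Kloc_row_frakS k : Kloc_row (frakS_class q e D (nth_basis k)) = (-1) ^+ sign_exp D (nth_basis k) *: row k (Smat D).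
Proof.
apply/rowP => j; rewrite !mxE ffunE.
exact: (frakS_mclass q0 q1 hD sp (nth_basisB k) (nth_basisB j)).
Qed.

Lemma Kloc_row_frakS_opp k : Kloc_row (frakS_class q e Dm (nth_basis k)) = (-1) ^+ sign_exp Dm (nth_basis k) *: row k (Smat Dm).
Proof.
apply/rowP => j; rewrite !mxE ffunE.
exact: (frakS_mclass q0 q1 hDm spm (nth_basisB k) (nth_basisB j)).
Qed.

Lemma nth_basis_ex I : I \in bases a -> exists k, nth_basis k = I.
Proof. by move=> IB; exists (enum_rank (exist _ I IB : B)); rewrite /nth_basis enum_rankK. Qed.

(** The classes of the fixed points span, as their matrix is invertible. *)
Lemma bar_unique f g : elliptic_bar q D e f -> elliptic_bar q D e g -> f =1 g.
Proof.
move=> [fD fZ fS] [gD gZ gS] m.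
have [V SV] := Smat_inv; have VS := mulmx1C SV.
have nul (h : Kloc R d r a -> Kloc R d r a) : (forall x y, h (x + y) = h x + h y) -> h 0 = 0.
  by move=> hA; apply: (addrI (h 0)); rewrite -hA !addr0.
pose c k := (Kloc_row m *m V) 0 k * (-1) ^+ sign_exp D (nth_basis k).
have -> : m = \sum_k Kscale (c k) (frakS_class q e D (nth_basis k)).
  apply: Kloc_row_inj.
  rewrite (big_morph Kloc_row (id1 := 0) (op1 := +%R) Kloc_rowD); last by apply/rowP => k; rewrite !mxE ffunE.
  rewrite -[LHS]mulmx1 -VS mulmxA mulmx_sum_row; apply: eq_bigr => k _.
  by rewrite Kloc_rowZ Kloc_row_frakS scalerA /c -mulrA -expr2 sqrr_sign mulr1.
rewrite (big_morph f fD (nul f fD)) (big_morph g gD (nul g gD)); apply: eq_bigr => k _.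
by rewrite fZ gZ fS ?gS//; exact: nth_basisB.
Qed.

Section Lifts.
Variable s : seq 'rV[int]_n.
Hypotheses (hs : Xi_lifts D s) (ss : size s = N).

Definition Pmat (D0 : toric_data n d' r') : 'M[M]_N := \matrix_(i, k)
  (lift_class d r q (nth 0 s k) * Theta_res q (dual_data D0) ed (nth 0 s k) (~: nth_basis i)).
Definition Tmat : 'M[M]_N := \matrix_(k, j) Theta_res q D e (nth 0 s k) (nth_basis j).

Lemma PT : Pmat D *m Tmat = Smat D.
Proof.
apply/matrixP => i j; rewrite !mxE.
rewrite -(expansion_mclass q0 q1 hD sp (nth_basisB i) (nth_basisB j) hs) (big_nth 0) ss big_mkord.
by apply: eq_bigr => k _; rewrite !mxE.
Qed.

Lemma PT_opp : Pmat Dm *m Tmat = Smat Dm.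
Proof.
apply/matrixP => i j; rewrite !mxE.
rewrite -(expansion_mclass q0 q1 hDm spm (nth_basisB i) (nth_basisB j) hs) (big_nth 0) ss big_mkord.
by apply: eq_bigr => k _; rewrite !mxE.
Qed.

Lemma Pmat_bar : map_mx (@bar R d r) (Pmat D) = Pmat Dm.
Proof.
apply/matrixP => i k; rewrite mxE [X in bar X]mxE [RHS]mxE.
rewrite barM bar_lift_class; congr (_ * _).
exact: (bar_Theta_dual _ (nth_basisB i)).
Qed.

Lemma Tmat_inv : exists T', Tmat *m T' = 1%:M.
Proof.
have [V] := Smat_inv; rewrite -PT -mulmxA => /mulmx1C h.
by exists (V *m Pmat D); rewrite mulmxA.
Qed.

(** The map multiplies a row by the inverse of [Tmat], applies bar to the
    coordinates, and multiplies by [Tmat] again. *)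
Lemma bar_ex : exists f, elliptic_bar q D e f /\
  forall lam, lam \in s -> f (Theta_class q D e lam) = Theta_class q D e lam.
Proof.
have [T' TT'] := Tmat_inv.
pose F (v : 'rV[M]_N) := map_mx (@bar R d r) (v *m T') *m Tmat.
have [f fE] : exists f : Kloc R d r a -> Kloc R d r a, forall m, Kloc_row (f m) = F (Kloc_row m).
  exists (fun m => [ffun J => F (Kloc_row m) 0 (enum_rank J)]) => m.
  by apply/rowP => k; rewrite mxE ffunE enum_valK.
have bD (v w : 'rV[M]_N) : map_mx (@bar R d r) (v + w) = map_mx (@bar R d r) v + map_mx (@bar R d r) w.
  by apply/rowP => k; rewrite !mxE barD.
have bZ c (v : 'rV[M]_N) : map_mx (@bar R d r) (c *: v) = bar c *: map_mx (@bar R d r) v.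
  by apply/rowP => k; rewrite !mxE barM.
exists f; split; first split.
- by move=> m m'; apply: Kloc_row_inj; rewrite [RHS]Kloc_rowD !fE Kloc_rowD /F mulmxDl bD mulmxDl.
- by move=> c m; apply: Kloc_row_inj; rewrite [RHS]Kloc_rowZ !fE Kloc_rowZ /F -scalemxAl bZ -scalemxAl.
- move=> I IB; apply: Kloc_row_inj; rewrite fE [RHS]Kloc_rowZ.
  have [k <-] := nth_basis_ex IB.
  rewrite [X in F X](Kloc_row_frakS k).
  rewrite [X in _ = _ *: X](Kloc_row_frakS_opp k).
  rewrite /F -scalemxAl bZ -scalemxAl.
  have -> : bar ((-1) ^+ sign_exp D (nth_basis k)) = (-1) ^+ sign_exp D (nth_basis k) :> M.
    by rewrite -mclass_sign bar_cst.
  rewrite scalerA -(sign_exp_opp _ hD (nth_basisB k)); congr (_ *: _).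
  have e1 : row k (Smat D) *m T' = row k (Pmat D).
    by rewrite -PT row_mul -mulmxA TT' mulmx1.
  have e2 : row k (Smat Dm) = row k (Pmat Dm) *m Tmat by rewrite -PT_opp row_mul.
  have e3 : map_mx (@bar R d r) (row k (Pmat D)) = row k (Pmat Dm).
    exact: etrans (map_row _ _ _) (congr1 (row k) Pmat_bar).
  apply: etrans (esym e2); apply: (congr1 (fun v => v *m Tmat)).
  by apply: etrans e3; apply: congr1.
move=> lam ls; apply: Kloc_row_inj; rewrite fE.
have kl : (index lam s < N)%N by rewrite -ss index_mem.
have -> : Kloc_row (Theta_class q D e lam) = row (Ordinal kl) Tmat.
  by apply/rowP => j; rewrite !mxE ffunE /= nth_index.
rewrite /F -row_mul TT' row1.
have -> : map_mx (@bar R d r) (delta_mx 0 (Ordinal kl)) = delta_mx 0 (Ordinal kl) :> 'rV[M]_N.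
  by apply/rowP => j; rewrite !mxE; case: (_ && _); [exact: bar1|exact: bar0].
by rewrite -rowE.
Qed.
End Lifts.

Lemma Xi_sym lam mu : Xi_equiv D lam mu -> Xi_equiv D mu lam.
Proof.
move=> [u [v [hu hv ->]]]; exists (- u), (- v); split; [exact: kerN|exact: kerN|].
by rewrite -opprD addrK.
Qed.

Lemma Xi_trans lam mu nu : Xi_equiv D lam mu -> Xi_equiv D mu nu -> Xi_equiv D lam nu.
Proof.
move=> [u [v [hu hv ->]]] [u' [v' [hu' hv' ->]]]; exists (u + u'), (v + v').
by split; [exact: kerD|exact: kerD|rewrite -addrA addrACA].
Qed.

(** The representative of the class of lam can be replaced by lam. *)
Lemma Xi_lifts_through lam : exists s, [/\ Xi_lifts D s, size s = N & lam \in s].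
Proof.
have [s [hs ss]] := Xi_lifts_ex hD.
pose g x := if `[< Xi_equiv D x lam >] then lam else x.
exists (map g s); split; last 2 first.
- by rewrite size_map ss card_basis.
- have : has (fun x => `[< Xi_equiv D x lam >]) s by rewrite has_count hs.
  by move=> /hasP[x xs hx]; apply/mapP; exists x => //; rewrite /g hx.
move=> mu; rewrite count_map -[RHS](hs mu); apply: eq_count => x /=; rewrite /g.
case: (asboolP (Xi_equiv D x lam)) => // h; apply: asbool_equiv_eq; split=> h'; first exact: Xi_trans h h'.
exact: Xi_trans (Xi_sym h) h'.
Qed.

(** The map constructed from a set of lifts fixes the theta classes of these
    lifts. By uniqueness it does not depend on the set, and every lam belongs
    to some set of lifts. *)
Lemma bar_involution : exists f, [/\ elliptic_bar q D e f,
    forall g, elliptic_bar q D e g -> forall m, g m = f m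
  & forall lam, f (Theta_class q D e lam) = Theta_class q D e lam].
Proof.
have [s [hs ss _]] := Xi_lifts_through 0.
have [f [Hf _]] := bar_ex hs ss.
exists f; split => //; first by move=> g Hg m; exact: bar_unique.
move=> lam; have [s' [hs' ss' ls]] := Xi_lifts_through lam.
have [g [Hg gT]] := bar_ex hs' ss'.
by rewrite (bar_unique Hf Hg) gT.
Qed.
End BarMap.

Lemma KscaleE (R : realType) (d r n d' : nat) (a : 'M[int]_(n, d'))
    (c : merofield R d r) (m : Kloc R d r a) J : Kscale c m J = c * m J.
Proof. by rewrite /Kscale ffunE. Qed.

Lemma S_termE (R : realType) (q : R[i]) (n d r : nat) (D : toric_data n d r) I lam J :
  S_term q D I lam J = lift_class d r q lam *
    Theta_res q (dual_data D) (fun x w => evalX D x (wswap w)) lam (~: I) *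
    Theta_res q D (evalX D) lam (val J).
Proof. by rewrite /S_term KscaleE; congr (_ * _); rewrite /Theta_class ffunE. Qed.

Theorem theorem1p4 (R : realType) (q : R[i]) (hq : 0 < `|q| < 1)
    (n d r : nat) (D : toric_data n d r) (hD : toric_hyperkahler D) :
  (exists f : Kloc R d r (ta D) -> Kloc R d r (ta D),
     [/\ elliptic_bar q D (evalX D) f,
         forall g, elliptic_bar q D (evalX D) g -> forall m, g m = f m
       & forall lam : 'rV[int]_n,
           f (Theta_class q D (evalX D) lam) = Theta_class q D (evalX D) lam]) /\
  (exists f : Kloc R d r (ta (dual_data D)) -> Kloc R d r (ta (dual_data D)),
     [/\ elliptic_bar q (dual_data D) (evalXdual D) f,
         forall g, elliptic_bar q (dual_data D) (evalXdual D) g ->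
           forall m, g m = f m
       & forall lam : 'rV[int]_n,
           f (Theta_class q (dual_data D) (evalXdual D) lam)
           = Theta_class q (dual_data D) (evalXdual D) lam]) /\
  (exists s : seq 'rV[int]_n, Xi_lifts D s) /\
  (forall I : {set 'I_n}, I \in bases (ta D) ->
     (forall lam mu : 'rV[int]_n,
        Xi_equiv D lam mu -> S_term q D I lam = S_term q D I mu) /\
     exists sgn : bool, forall s : seq 'rV[int]_n, Xi_lifts D s ->
       Kscale ((-1) ^+ sgn) (frakS_class q (evalX D) D I)
       = \sum_(lam <- s) S_term q D I lam).
Proof.
have [q0 q1] : q != 0 /\ normc q < 1.
  by move: hq; rewrite normr_gt0 norm_normc (ltcR (normc q) 1) => /andP[].
have sp : eval_spec D (fun x : tpoint R d r => evalX D x) := evalX_spec R hD.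
split; first exact: (bar_involution q0 q1 hD sp).
split; first exact: (bar_involution q0 q1 (dual_hk hD) (eval_spec_dual sp)).
split; first by have [s [hs _]] := Xi_lifts_ex hD; exists s.
move=> I IB; split.
  move=> lam mu E; apply/ffunP => J; apply: etrans (S_termE q I lam J) _.
  apply: etrans (esym (S_termE q I mu J)).
  exact: (term_inv q0 q1 hD sp IB (valP J) E).
exists (odd (sign_exp D I)) => s hs; apply/ffunP => J; rewrite sum_ffunE.
transitivity (theta_prod q D (evalX D) I (val J)).
  rewrite KscaleE signr_odd ffunE [X in _ * X](frakS_mclass q0 q1 hD sp IB (valP J)).
  by rewrite mulrA -expr2 sqrr_sign mul1r.
rewrite -(expansion_mclass q0 q1 hD sp IB (valP J) hs).
by apply: eq_bigr => lam _; rewrite S_termE.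
Qed.
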